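(* Let $m,n\ge1$ and $M\in\mathbb S_{++}^{mn}$. Fix $G_0\in\mathcal K_{m,n}$, $\bar\eta>0$ and $\gamma,c\in(0,1)$. Let $f(G)=\frac12d_{\mathrm{AI}}(G,M)^2$, let $$\mathcal Q_0=\{G\in\mathcal K_{m,n}:f(G)\le f(G_0)\},$$ and let $L_0$ be a Lipschitz constant for the restricted gradient of $f$ on a compact geodesic neighborhood of $\mathcal Q_0$ in $\mathcal K_{m,n}$ (such an $L_0$ exists). At iteration $r\ge0$ set $V_r=\Pi_{\mathcal L}\log(G_r^{-1/2}MG_r^{-1/2})$. If $V_r=0$, stop. Otherwise choose the largest $\eta_r\in\{\bar\eta,\bar\eta\gamma,\bar\eta\gamma^2,\ldots\}$ satisfying $$f\bigl(G_r^{1/2}\exp(\eta_rV_r)G_r^{1/2}\bigr)\le f(G_r)-c\,\eta_r\|V_r\|_F^2,$$ and set $$G_{r+1}=G_r^{1/2}\exp(\eta_rV_r)G_r^{1/2}.$$ Then the iteration is well defined, remains in $\mathcal K_{m,n}$, and either terminates at $P_{\mathcal K}(M)$ or converges to $P_{\mathcal K}(M)$. Moreover, there exists $\underline\eta\in(0,(2c)^{-1}]$, depending only on $\mathcal Q_0,L_0,\bar\eta,\gamma$ and $c$, such that for every iterate $G_r$, $$f(G_r)-f(P_{\mathcal K}(M))\le(1-2c\underline\eta)^r\bigl[f(G_0)-f(P_{\mathcal K}(M))\bigr].$$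
   Context: $\mathbb S^d$ denotes real symmetric $d\times d$ matrices and $\mathbb S_{++}^d$ the positive-definite ones, with the affine-invariant Riemannian metric $\|Z\|_{S,\mathrm{AI}}=\|S^{-1/2}ZS^{-1/2}\|_F$ and distance $d_{\mathrm{AI}}(G_0,G_1)=\|\log(G_0^{-1/2}G_1G_0^{-1/2})\|_F$. The Kronecker family is $\mathcal K_{m,n}=\{B\otimes A: A\in\mathbb S_{++}^m,\ B\in\mathbb S_{++}^n\}\subset\mathbb S_{++}^{mn}$; it is a closed totally geodesic submanifold. The restricted gradient of $f$ is the Riemannian gradient of $f|_{\mathcal K_{m,n}}$ for the induced metric, and Lipschitz continuity is in the Riemannian sense (comparing gradients by parallel transport along geodesics). For every $M\in\mathbb S_{++}^{mn}$ there is a unique point $P_{\mathcal K}(M)=\operatorname*{arg\,min}_{G\in\mathcal K_{m,n}}d_{\mathrm{AI}}(M,G)$. The log-Kronecker subspace is $\mathcal L_{m,n}=\{I_n\otimes X+Y\otimes I_m: X\in\mathbb S^m,\ Y\in\mathbb S^n\}\subset\mathbb S^{mn}$, and $\Pi_{\mathcal L}$ is the Frobenius-orthogonal projection of $\mathbb S^{mn}$ onto it. *)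

(* Defs.v *)
From HB Require Import structures.
From mathcomp Require Import all_boot all_order all_algebra mxtens.
From mathcomp Require Import all_classical all_reals all_analysis.
Import Order.TTheory GRing.Theory Num.Theory numFieldNormedType.Exports.

Set Implicit Arguments.
Unset Strict Implicit.
Unset Printing Implicit Defensive.

Local Open Scope classical_set_scope.
Local Open Scope ring_scope.

Definition symset (R : realType) (d : nat) : set 'M[R]_d :=
  [set A | A \is symmetricmx].

Definition spd (R : realType) (d : nat) : set 'M[R]_d :=
  [set A | symset A /\
    forall x : 'cV[R]_d, x != 0 -> 0 < (x^T *m A *m x) 0 0].

Definition frob (R : realType) (d : nat) (A B : 'M[R]_d) : R := \tr (A^T *m B).

Definition frobn (R : realType) (d : nat) (A : 'M[R]_d) : R :=
  Num.sqrt (frob A A).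

Definition expmx (R : realType) (d : nat) (A : 'M[R]_d) : 'M[R]_d :=
  limn (series (fun k : nat => (k`!%:R : R)^-1 *: A ^+ k)).

(* Meaningful on [spd] only: [expmx] is a bijection from the symmetric matrices
   onto the positive definite ones, and a positive definite matrix has exactly
   one positive definite square root. *)
Definition logmx (R : realType) (d : nat) (A : 'M[R]_d) : 'M[R]_d :=
  get [set X | symset X /\ expmx X = A].

Definition sqrtmx (R : realType) (d : nat) (A : 'M[R]_d) : 'M[R]_d :=
  get [set X | spd X /\ X *m X = A].

Definition isqrtmx (R : realType) (d : nat) (A : 'M[R]_d) : 'M[R]_d :=
  invmx (sqrtmx A).

(* S^{-1/2} Z S^{-1/2} and S^{1/2} Z S^{1/2} *)
Definition whiten (R : realType) (d : nat) (S Z : 'M[R]_d) : 'M[R]_d :=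
  isqrtmx S *m Z *m isqrtmx S.

Definition unwhiten (R : realType) (d : nat) (S Z : 'M[R]_d) : 'M[R]_d :=
  sqrtmx S *m Z *m sqrtmx S.

Definition ai_dot (R : realType) (d : nat) (S Z W : 'M[R]_d) : R :=
  frob (whiten S Z) (whiten S W).

Definition ai_norm (R : realType) (d : nat) (S Z : 'M[R]_d) : R :=
  frobn (whiten S Z).

Definition ai_dist (R : realType) (d : nat) (G0 G1 : 'M[R]_d) : R :=
  frobn (logmx (whiten G0 G1)).

(* Christoffel symbol of the Levi-Civita connection in the global chart of the
   open cone [spd] of the symmetric matrices: Koszul's formula applied to the
   constant (hence commuting) vector fields X, Y, W. *)
Definition christoffel (R : realType) (d : nat) (S X Y : 'M[R]_d) : 'M[R]_d :=
  get [set C | symset C /\ forall W, symset W ->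
    2 * ai_dot S C W =
      'D_X (fun T : 'M[R]_d => ai_dot T Y W : R^o) S
      + 'D_Y (fun T : 'M[R]_d => ai_dot T X W : R^o) S
      - 'D_W (fun T : 'M[R]_d => ai_dot T X Y : R^o) S].

(* Covariant derivative at time t of the field Z along the curve c. *)
Definition covariant (R : realType) (d : nat) (c Z : R -> 'M[R]_d) (t : R) :
    'M[R]_d :=
  derive1 Z t + christoffel (c t) (derive1 c t) (Z t).

(* [spd] is geodesically complete, so geodesics are taken on the whole line. *)
Definition geodesic (R : realType) (d : nat) (c : R -> 'M[R]_d) : Prop :=
  forall t, [/\ spd (c t), derivable c t 1, derivable (derive1 c) t 1 &
                covariant c (derive1 c) t = 0].

Definition parallel (R : realType) (d : nat) (c Z : R -> 'M[R]_d) : Prop :=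
  forall t, [/\ symset (Z t), derivable Z t 1 & covariant c Z t = 0].

(* The size n * m (rather than m * n) is the one for which the block index,
   carried by the left factor B, comes first. *)
Definition kronecker_family (R : realType) (m n : nat) : set 'M[R]_(n * m) :=
  [set G | exists A : 'M[R]_m, exists B : 'M[R]_n,
    [/\ spd A, spd B & G = B *t A]].

Definition log_kronecker (R : realType) (m n : nat) : set 'M[R]_(n * m) :=
  [set Z | exists X : 'M[R]_m, exists Y : 'M[R]_n,
    [/\ symset X, symset Y &
        Z = (1%:M : 'M[R]_n) *t X + Y *t (1%:M : 'M[R]_m)]].

Definition proj_log_kronecker (R : realType) (m n : nat) (Z : 'M[R]_(n * m)) :
    'M[R]_(n * m) :=
  get [set V | log_kronecker V /\
    forall W, log_kronecker W -> frob (Z - V) W = 0].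

(* P_K(M): the unique point of the Kronecker family closest to M. *)
Definition proj_kronecker (R : realType) (m n : nat) (M : 'M[R]_(n * m)) :
    'M[R]_(n * m) :=
  get [set P | kronecker_family P /\
    forall G, kronecker_family G -> ai_dist M P <= ai_dist M G].

(* Tangent vectors of a submanifold K at G, as velocities of curves in K. *)
Definition curve_through (R : realType) (d : nat) (K : set 'M[R]_d)
    (G : 'M[R]_d) (c : R -> 'M[R]_d) : Prop :=
  [/\ forall t, K (c t), c 0 = G & derivable c 0 1].

Definition tangent (R : realType) (d : nat) (K : set 'M[R]_d) (G : 'M[R]_d) :
    set 'M[R]_d :=
  [set W | exists2 c, curve_through K G c & derive1 c 0 = W].

(* Riemannian gradient at G of the restriction of f to K, for the metric
   induced on K. *)
Definition restricted_grad (R : realType) (d : nat) (K : set 'M[R]_d)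
    (f : 'M[R]_d -> R) (G : 'M[R]_d) : 'M[R]_d :=
  get [set Z | tangent K G Z /\ forall c, curve_through K G c ->
    is_derive (0 : R) (1 : R) (fun t => f (c t) : R^o)
      (ai_dot G Z (derive1 c 0))].

Definition geodesically_convex (R : realType) (d : nat) (N : set 'M[R]_d) :
    Prop :=
  forall c, geodesic c -> N (c 0) -> N (c 1) ->
  forall t, 0 <= t <= 1 -> N (c t).

Definition compact_geodesic_nbhd (R : realType) (d : nat)
    (K Q N : set 'M[R]_d) : Prop :=
  [/\ N `<=` K, compact N, geodesically_convex N &
      forall G, Q G -> within K (nbhs G) N].

(* The field X is compared at the two ends of every geodesic joining two points
   of N, after parallel transport from the initial to the final point. *)
Definition riemannian_lipschitz (R : realType) (d : nat) (N : set 'M[R]_d)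
    (X : 'M[R]_d -> 'M[R]_d) (L : R) : Prop :=
  0 <= L /\
  forall c Z, geodesic c -> N (c 0) -> N (c 1) ->
    parallel c Z -> Z 0 = X (c 0) ->
    ai_norm (c 1) (Z 1 - X (c 1)) <= L * ai_dist (c 0) (c 1).

(* L is a Lipschitz constant of the restricted gradient of f on some compact
   geodesic neighborhood of Q in K. The geodesics and the parallel transport of
   K are those of [spd], because the Kronecker family is totally geodesic. *)
Definition grad_lipschitz_near (R : realType) (d : nat) (K Q : set 'M[R]_d)
    (f : 'M[R]_d -> R) (L : R) : Prop :=
  exists2 N, compact_geodesic_nbhd K Q N &
    riemannian_lipschitz N (restricted_grad K f) L.

Definition objective (R : realType) (d : nat) (M G : 'M[R]_d) : R :=
  2^-1 * ai_dist G M ^+ 2.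

Definition sublevel_kronecker (R : realType) (m n : nat)
    (M G0 : 'M[R]_(n * m)) : set 'M[R]_(n * m) :=
  [set G | kronecker_family G /\ objective M G <= objective M G0].

Definition direction (R : realType) (m n : nat) (M G : 'M[R]_(n * m)) :
    'M[R]_(n * m) :=
  proj_log_kronecker (logmx (whiten G M)).

Definition update (R : realType) (m n : nat) (M G : 'M[R]_(n * m)) (eta : R) :
    'M[R]_(n * m) :=
  unwhiten G (expmx (eta *: direction M G)).

Definition armijo (R : realType) (m n : nat) (M : 'M[R]_(n * m)) (c : R)
    (G : 'M[R]_(n * m)) (eta : R) : Prop :=
  objective M (update M G eta)
    <= objective M G - c * eta * frobn (direction M G) ^+ 2.

Definition step_size (R : realType) (m n : nat) (M : 'M[R]_(n * m))
    (etabar gamma c : R) (G : 'M[R]_(n * m)) (eta : R) : Prop :=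
  let trials := range (fun k : nat => etabar * gamma ^+ k) in
  [/\ trials eta, armijo M c G eta &
      forall eta', trials eta' -> armijo M c G eta' -> eta' <= eta].

(* [iterate M G0 etabar gamma c r G]: the iteration started at G0 reaches
   iteration r, with G_r = G. An iterate with zero direction has no
   successor. *)
Inductive iterate (R : realType) (m n : nat) (M G0 : 'M[R]_(n * m))
    (etabar gamma c : R) : nat -> 'M[R]_(n * m) -> Prop :=
| iterate0 : iterate M G0 etabar gamma c 0 G0
| iterateS (r : nat) (G : 'M[R]_(n * m)) (eta : R) :
    iterate M G0 etabar gamma c r G ->
    direction M G <> 0 ->
    step_size M etabar gamma c G eta ->
    iterate M G0 etabar gamma c r.+1 (update M G eta).

(* Main.v *)
Require Import Defs.
From mathcomp Require Import all_boot all_order all_algebra perm mxtens complex.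
From mathcomp Require Import ring lra.
From mathcomp Require Import all_classical all_reals all_analysis.
Import Order.TTheory GRing.Theory Num.Theory numFieldNormedType.Exports.
Local Open Scope classical_set_scope.
Local Open Scope ring_scope.

(** The objective, half the squared affine-invariant distance to [M], is
    strongly convex with constant 1 along geodesics. The Kronecker family is
    totally geodesic, so its restriction is strongly convex as well, and the
    iteration is gradient descent with backtracking for such a function.

    Strong convexity is the exponential metric increasing property
    ([exponential_metric_increasing]): the logarithm does not increase
    distances from the affine-invariant metric to the Frobenius norm. For
    nearby points it is a trace inequality. Written with the overlap weights of
    two eigenbases ([spectral_overlap]), a trace inequality between functions
    of two symmetric matrices is a weighted sum of scalar inequalities, here
    the bound of the hyperbolic cosine by its quadratic part. Cutting a
    geodesic into many small pieces gives the property for all pairs of points.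
    Whitening by the base point turns it into a first-order lower bound with a
    quadratic term ([objective_strongly_convex]), from which come gradient
    dominance ([gradient_dominance]), the uniqueness of critical points with
    quadratic growth around them ([direction0_min]) and the geodesic convexity
    of sublevel sets ([objective_geod_convex]).

    The overlap weights also give a Taylor expansion of the objective with a
    quadratic remainder ([objective_taylor]). Whitened tangent vectors of the
    family form the linear space [L] of its logarithms, so the restricted
    gradient at [G] is minus the search direction, unwhitened
    ([restricted_gradE]). Koszul's formula determines the Christoffel symbols
    ([christoffelE]); the equations of geodesics and of parallel fields then
    integrate to exponentials ([geodesic_form], [parallel_form]). In whitened
    coordinates parallel transport is conjugation by an orthogonal matrix that
    preserves [L] ([transport_log_kronecker]).

    Sublevel sets in the family are images under the exponential of compact
    subsets of [L] ([compact_sublevel]). Hence the projection of [M] exists,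
    and the restricted gradient is Lipschitz on sublevel sets
    ([lipschitz_gradient]), the logarithm being Lipschitz on the spectra that
    occur.

    Given a Lipschitz constant [L0] on a neighborhood, the mean value theorem
    shows that the objective decreases along the search geodesic as long as
    the geodesic stays in the neighborhood. It does stay there for times up to
    [2 / L0], since it cannot reach the boundary without the objective having
    increased ([geodesic_stays]). Every step up to a constant depending on
    [L0] and [c] only is therefore accepted ([armijo_small]), so that the
    largest accepted trial is at least [step_bound]; gradient dominance then
    contracts the gap at each iteration ([iterate_rate]), and quadratic growth
    turns the decay of the gap into convergence ([iterate_cvg]). *)

Set Implicit Arguments.
Unset Strict Implicit.
Unset Printing Implicit Defensive.

(** * The spectral theorem for real symmetric matrices *)

Lemma symsetE (R : realType) d (A : 'M[R]_d) : symset A <-> A^T = A.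
Proof.
rewrite /symset /= qualifE /= expr0 scale1r map_mx_id //.
by split => [/eqP <-|->].
Qed.

(** The complexified matrix has an eigenvalue because the field is
    algebraically closed; it is Hermitian, so this eigenvalue is real, hence a
    root of the real characteristic polynomial. *)
Lemma symmetric_eigenvalue (R : realType) d (A : 'M[R]_d.+1) :
  A^T = A -> exists a, eigenvalue A a.
Proof.
move=> symA; pose f := real_complex R.
have [a /eigenvalueP[v vA v0]] := eigenvalue_closed (map_mx f A) (ltn0Sn d).
pose w := (map_mx Num.conj v)^T.
have fA : (map_mx Num.conj (map_mx f A))^T = map_mx f A.
  by apply/matrixP => i j; rewrite -[in RHS]symA !mxE; apply: conjc_real.
have s_gt0 : 0 < (v *m w) 0 0.
  rewrite !mxE lt0r sumr_ge0 ?andbT => [|i _]; last first.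
    by rewrite !mxE mul_conjC_ge0.
  apply: contraNneq v0 => /psumr_eq0P s0; apply/eqP/rowP => i.
  rewrite mxE; apply/eqP; rewrite -mul_conjC_eq0; apply/eqP.
  by have := s0 _ i isT; rewrite !mxE; apply => j _; rewrite !mxE mul_conjC_ge0.
have areal : a^* = a.
  have e1 : (v *m map_mx f A *m w) 0 0 = a * (v *m w) 0 0.
    by rewrite vA -scalemxAl mxE.
  have : ((map_mx Num.conj (v *m map_mx f A *m w))^T) 0 0 = (v *m map_mx f A *m w) 0 0.
    have wv : (map_mx Num.conj w)^T = v.
      by apply/rowP => i; rewrite !mxE conjCK.
    by rewrite !map_mxM !trmx_mul fA wv mulmxA.
  rewrite mxE mxE e1 rmorphM /= (CrealP (gtr0_real s_gt0)).
  by move/(mulIf (lt0r_neq0 s_gt0)).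
have [r ar] : exists r, a = f r.
  case: a areal {vA} => x y /= [] yy; exists x.
  by congr Complex; apply/eqP; rewrite -eqNr yy.
exists r; rewrite eigenvalue_root_char -(fmorph_root f) map_char_poly.
by rewrite -eigenvalue_root_char; apply/eigenvalueP; exists v; rewrite // vA ar.
Qed.

Lemma mulmx_tr_gt0 (R : realFieldType) d (v : 'rV[R]_d) :
  v != 0 -> 0 < (v *m v^T) 0 0.
Proof.
move=> v0; rewrite mxE lt0r sumr_ge0 ?andbT => [|i _]; last first.
  by rewrite mxE -expr2 sqr_ge0.
apply: contraNneq v0 => /psumr_eq0P s0; apply/eqP/rowP => i.
rewrite mxE; apply/eqP; rewrite -sqrf_eq0 expr2; apply/eqP.
by have := s0 _ i isT; rewrite mxE; apply => j _; rewrite mxE -expr2 sqr_ge0.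
Qed.

(** The Householder reflection exchanging [u] and the first basis vector, or
    the identity when they coincide. *)
Lemma orthogonal_completion (R : realType) d (u : 'rV[R]_d.+1) :
  u *m u^T = 1%:M ->
  exists Q : 'M[R]_d.+1, Q *m Q^T = 1%:M /\ delta_mx 0 0 *m Q = u.
Proof.
move=> uu; pose e : 'rV[R]_d.+1 := delta_mx 0 0.
rewrite -/e; have ee : e *m e^T = 1%:M.
  rewrite trmx_delta mul_delta_mx; apply/matrixP => i j.
  by rewrite !ord1 !mxE.
have ue : u *m e^T = (u 0 0)%:M.
  apply/matrixP => i j; rewrite !ord1 !mxE (bigD1 ord0) //= !mxE eqxx mulr1.
  rewrite big1 ?addr0 // => k k0; rewrite !mxE.
  by rewrite (negbTE k0) andbF mulr0.
have eu : e *m u^T = (u 0 0)%:M.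
  by rewrite -[LHS]trmxK trmx_mul !trmxK ue tr_scalar_mx.
have [w0|w0] := eqVneq (u - e) 0.
  exists 1%:M; rewrite mulmx1 trmx1 mulmx1; split=> //.
  by apply/esym/eqP; rewrite -subr_eq0; apply/eqP.
set w := u - e in w0.
have ww : w *m w^T = (2 - 2 * u 0 0)%:M.
  rewrite /w linearB /= mulmxBl !mulmxBr uu ue eu ee -raddfB -raddfB -raddfB /=.
  by congr (_%:M); ring.
have w1 : 2 - 2 * u 0 0 != 0.
  have := mulmx_tr_gt0 w0; rewrite ww mxE eqxx mulr1n.
  by move/lt0r_neq0.
have uE : u = e + w by rewrite addrC subrK.
have ew : e *m w^T = (u 0 0 - 1)%:M.
  by rewrite /w linearB /= mulmxBr eu ee -raddfB.
clearbody w e.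
have u1 : 1 - u 0 0 != 0 by apply: contraNneq w1 => u1; apply/eqP; lra.
pose k := (1 - u 0 0)^-1.
have k1 : k * (1 - u 0 0) = 1 by rewrite /k mulVf.
exists (1%:M - k *: (w^T *m w)); split.
  have -> : (1%:M - k *: (w^T *m w))^T = 1%:M - k *: (w^T *m w).
    by rewrite [LHS]linearB /= trmx1 [(_ *: _)^T]linearZ /= trmx_mul trmxK.
  rewrite mulmxBl mul1mx mulmxBr mulmx1 -scalemxAl -scalemxAr mulmxA.
  rewrite -(mulmxA _ w) ww mul_mx_scalar -scalemxAl !scalerA.
  rewrite -addrA -[RHS]addr0; congr (_ + _).
  rewrite opprB addrC -addrA -opprD -scalerDl -scalerBl.
  suff -> : k * (k * (2 - 2 * u 0 0)) - (k + k) = 0 by rewrite scale0r.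
  have -> : k * (2 - 2 * u 0 0) = 2 by rewrite -[RHS]mulr1 -k1; ring.
  by ring.
rewrite mulmxBr mulmx1 -scalemxAr mulmxA ew mul_scalar_mx scalerA.
have -> : k * (u 0 0 - 1) = - 1.
  by apply: oppr_inj; rewrite opprK -[RHS]k1; ring.
by rewrite scaleN1r opprK.
Qed.

(** A unit eigenvector is completed to an orthogonal matrix; symmetry then
    clears the first row and column together, and the induction hypothesis
    applies to the remaining block. *)
Lemma symmetric_diagonalization (R : realType) d (A : 'M[R]_d) : A^T = A ->
  exists (U : 'M[R]_d) (a : 'rV[R]_d), U^T *m U = 1%:M /\ A = U *m diag_mx a *m U^T.
Proof.
elim: d A => [|d IH] A symA.
  by exists 1%:M, 0; split; apply/matrixP => -[].
have [a /eigenvalueP[v vA v0]] := symmetric_eigenvalue symA.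
pose s := (v *m v^T) 0 0.
have s_gt0 : 0 < s by exact: mulmx_tr_gt0.
pose u := (Num.sqrt s)^-1 *: v.
have uu : u *m u^T = 1%:M.
  rewrite /u linearZ /= -scalemxAl -scalemxAr scalerA.
  rewrite [v *m _]mx11_scalar -/s -scalemx1 scalerA -expr2 exprVn.
  by rewrite sqr_sqrtr ?ltW // mulVf ?scale1r // lt0r_neq0.
have uA : u *m A = a *: u by rewrite -scalemxAl vA !scalerA mulrC.
have [Q [QQ eQ]] := orthogonal_completion uu.
have QQ' : Q^T *m Q = 1%:M by apply: mulmx1C.
pose B := Q *m A *m Q^T.
have symB : B^T = B by rewrite /B !trmx_mul trmxK symA mulmxA.
have rowB : delta_mx 0 0 *m B = a *: (delta_mx 0 0 : 'rV[R]_d.+1).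
  by rewrite /B !mulmxA eQ uA -scalemxAl -eQ -mulmxA QQ mulmx1.
have B0 j : B 0 j = a *+ (0 == j).
  have := congr1 (fun C : 'rV[R]_d.+1 => C 0 j) rowB.
  rewrite -rowE !mxE eqxx /= eq_sym => ->.
  by case: (0 == j); rewrite ?mulr1 ?mulr0.
suff [V [b [VV eB]]] : exists (V : 'M[R]_d.+1) (b : 'rV[R]_d.+1),
    V^T *m V = 1%:M /\ B = V *m diag_mx b *m V^T.
  exists (Q^T *m V), b; split.
    by rewrite trmx_mul trmxK mulmxA -(mulmxA V^T) QQ mulmx1.
  have -> : A = Q^T *m B *m Q.
    by rewrite /B !mulmxA QQ' mul1mx -mulmxA QQ' mulmx1.
  by rewrite eB trmx_mul trmxK !mulmxA.
move: {rowB Q QQ eQ QQ' uA uu} B symB B0; rewrite -[d.+1]/(1 + d)%N => B symB B0.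
have eB : B = block_mx a%:M 0 0 (drsubmx B).
  have l0 (j : 'I_1) : lshift d j = 0 by rewrite ord1; apply: val_inj.
  rewrite -[LHS]submxK; congr block_mx; apply/matrixP => i j.
  - by rewrite !mxE !l0 B0 !ord1.
  - by rewrite !mxE l0 B0.
  - by rewrite !mxE l0 -symB mxE B0.
have [U [b [UU eD]]] : exists (U : 'M[R]_d) (b : 'rV[R]_d), U^T *m U = 1%:M /\
    drsubmx B = U *m diag_mx b *m U^T.
  by apply: IH; rewrite trmx_drsub symB.
pose V : 'M[R]_(1 + d) := block_mx 1%:M 0 0 U.
have VT : V^T = block_mx 1%:M 0 0 U^T by rewrite tr_block_mx !trmx0 trmx1.
exists V, (row_mx a%:M b); split.
  rewrite VT mulmx_block !(mul0mx, mulmx0, mul1mx, addr0, add0r) UU.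
  by rewrite -scalar_mx_block.
rewrite eB eD VT diag_mx_row !mulmx_block.
rewrite !(mul0mx, mulmx0, mul1mx, addr0, add0r, mulmx1).
by congr block_mx; apply/matrixP => i j; rewrite !mxE !ord1 eqxx.
Qed.

(** * Functional calculus *)

Section functional_calculus.
Variables (R : realType) (d : nat).
Implicit Types (A B S : 'M[R]_d) (h k : R -> R).

(** One diagonalization is chosen once and for all, so that [fcalc] is a
    function; [fcalc_diag] shows that the choice does not matter. *)
Definition spectral_pair A : 'M[R]_d * 'rV[R]_d :=
  get [set p | p.1^T *m p.1 = 1%:M /\ A = p.1 *m diag_mx p.2 *m p.1^T].

Definition fcalc h A : 'M[R]_d :=
  let p := spectral_pair A in p.1 *m diag_mx (map_mx h p.2) *m p.1^T.

Lemma spectral_pairP A : A^T = A ->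
  let p := spectral_pair A in
  p.1^T *m p.1 = 1%:M /\ A = p.1 *m diag_mx p.2 *m p.1^T.
Proof.
move=> /symmetric_diagonalization[U [a Ua]].
have /getPex : exists p : 'M[R]_d * 'rV[R]_d,
    [set p | p.1^T *m p.1 = 1%:M /\ A = p.1 *m diag_mx p.2 *m p.1^T] p.
  by exists (U, a).
exact.
Qed.

Lemma mulmx_diagE (e : nat) (T : 'M[R]_(e, d)) (a : 'rV[R]_d) i j :
  (T *m diag_mx a) i j = T i j * a 0 j.
Proof. by rewrite mul_mx_diag mxE. Qed.

(** An entry [T i j] is nonzero only if [a 0 j = b 0 i], and then [h] takes
    the same value at both. This one remark gives the independence of [fcalc]
    from the diagonalization and its transfer between similar matrices. *)
Lemma diag_intertwine (e : nat) (T : 'M[R]_(e, d)) a b h :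
  T *m diag_mx a = diag_mx b *m T ->
  T *m diag_mx (map_mx h a) = diag_mx (map_mx h b) *m T.
Proof.
move=> Tab; apply/matrixP => i j; rewrite mulmx_diagE mul_diag_mx !mxE.
have /matrixP/(_ i j) := Tab; rewrite mulmx_diagE mul_diag_mx mxE mulrC.
have [->|T0] := eqVneq (T i j) 0; first by rewrite mul0r !mulr0.
by move=> /(mulIf T0) ->; rewrite mulrC.
Qed.

Lemma eigenvalue_diag (U : 'M[R]_d) a x : U^T *m U = 1%:M ->
  eigenvalue (U *m diag_mx a *m U^T) x <-> exists i, x = a 0 i.
Proof.
move=> UU; have UU' : U *m U^T = 1%:M by apply: mulmx1C.
split.
  move=> /eigenvalueP[v vA v0].
  have w0 : v *m U != 0.
    by apply: contraNneq v0 => w0; rewrite -[v]mulmx1 -UU' mulmxA w0 mul0mx.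
  have [i wi] : exists i, (v *m U) 0 i != 0.
    apply/existsP; apply: contraNT w0 => /existsPn w0; apply/eqP/rowP => i.
    by rewrite [RHS]mxE; have /negPn/eqP := w0 i.
  exists i; apply: (mulfI wi); rewrite -mulmx_diagE.
  have -> : v *m U *m diag_mx a = x *: (v *m U).
    by rewrite scalemxAl -vA !mulmxA -(mulmxA _ U^T) UU mulmx1.
  by rewrite [RHS]mxE mulrC.
move=> [i ->]; apply/eigenvalueP; exists (row i U^T).
  by rewrite -row_mul !mulmxA UU mul1mx row_mul row_diag_mx -scalemxAl -rowE.
apply: contra_eqN UU => /eqP U0; apply/eqP => /matrixP/(_ i i).
have : row i (U^T *m U) = 0 by rewrite row_mul U0 mul0mx.
by move=> /rowP/(_ i); rewrite !mxE => ->; rewrite eqxx => /eqP; rewrite eq_sym oner_eq0.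
Qed.

Lemma fcalc_intertwine S A B h : A^T = A -> B^T = B ->
  S *m A = B *m S -> S *m fcalc h A = fcalc h B *m S.
Proof.
rewrite /fcalc => /spectral_pairP; move: (spectral_pair A) => [U a] /= [UU {1}->].
move=> /spectral_pairP; move: (spectral_pair B) => [V b] /= [VV {1}->] SAB.
have UU' : U *m U^T = 1%:M by apply: mulmx1C.
have VV' : V *m V^T = 1%:M by apply: mulmx1C.
have : V^T *m S *m U *m diag_mx a = diag_mx b *m (V^T *m S *m U).
  transitivity (V^T *m (S *m (U *m diag_mx a *m U^T)) *m U).
    by rewrite -!mulmxA UU mulmx1.
  by rewrite SAB !mulmxA VV mul1mx.
move=> /(diag_intertwine h) SUV.
transitivity (V *m (V^T *m S *m U *m diag_mx (map_mx h a)) *m U^T).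
  by rewrite !mulmxA VV' mul1mx.
by rewrite SUV -!mulmxA UU' mulmx1.
Qed.

Lemma tr_fcalc A h : (fcalc h A)^T = fcalc h A.
Proof. by rewrite /fcalc !trmx_mul trmxK tr_diag_mx mulmxA. Qed.

Lemma tr_diag_form (U : 'M[R]_d) a :
  (U *m diag_mx a *m U^T)^T = U *m diag_mx a *m U^T.
Proof. by rewrite !trmx_mul trmxK tr_diag_mx mulmxA. Qed.

Lemma fcalc_diag (U : 'M[R]_d) a h : U^T *m U = 1%:M ->
  fcalc h (U *m diag_mx a *m U^T) = U *m diag_mx (map_mx h a) *m U^T.
Proof.
move=> UU; have UU' : U *m U^T = 1%:M by apply: mulmx1C.
set A := U *m diag_mx a *m U^T.
have [] := spectral_pairP (tr_diag_form U a); rewrite -/A /fcalc.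
move: (spectral_pair A) => [V b] /= VV AE.
have VV' : V *m V^T = 1%:M by apply: mulmx1C.
have : V^T *m U *m diag_mx a = diag_mx b *m (V^T *m U).
  transitivity (V^T *m A *m U); first by rewrite /A -!mulmxA UU mulmx1.
  by rewrite AE !mulmxA VV mul1mx.
move=> /(diag_intertwine h) VU.
transitivity (V *m (diag_mx (map_mx h b) *m (V^T *m U)) *m U^T).
  by rewrite -!mulmxA UU' mulmx1.
by rewrite -VU !mulmxA VV' mul1mx.
Qed.

Lemma sym_spectral A : A^T = A -> exists (U : 'M[R]_d) (a : 'rV[R]_d),
  [/\ U^T *m U = 1%:M, A = U *m diag_mx a *m U^T,
      forall h, fcalc h A = U *m diag_mx (map_mx h a) *m U^T &
      forall i, eigenvalue A (a 0 i)].
Proof.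
move=> /symmetric_diagonalization[U [a [UU AE]]].
exists U, a; split=> // [h|i]; first by rewrite AE fcalc_diag.
by rewrite AE; apply/eigenvalue_diag => //; exists i.
Qed.

Lemma eq_fcalc A h k : A^T = A -> (forall x, eigenvalue A x -> h x = k x) ->
  fcalc h A = fcalc k A.
Proof.
move=> /sym_spectral[U [a [UU AE hE ev]]] hk; rewrite !hE.
by congr (_ *m diag_mx _ *m _); apply/rowP => i; rewrite !mxE hk.
Qed.

Lemma fcalc_id A : A^T = A -> fcalc id A = A.
Proof.
move=> /sym_spectral[U [a [UU AE hE _]]]; rewrite hE [RHS]AE.
by congr (_ *m diag_mx _ *m _); apply/rowP => i; rewrite !mxE.
Qed.

Lemma fcalc_cst A c : A^T = A -> fcalc (fun=> c) A = c%:M.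
Proof.
move=> /sym_spectral[U [a [UU AE hE _]]]; rewrite hE.
have -> : diag_mx (map_mx (fun=> c) a) = c%:M.
  by apply/matrixP => i j; rewrite !mxE; case: eqP.
by rewrite mul_mx_scalar -scalemxAl (mulmx1C UU) scalemx1.
Qed.

Lemma fcalcD A h k : A^T = A ->
  fcalc h A + fcalc k A = fcalc (fun x => h x + k x) A.
Proof.
move=> /sym_spectral[U [a [UU AE hE _]]]; rewrite !hE -mulmxDl -mulmxDr.
rewrite -raddfD /=; congr (_ *m diag_mx _ *m _).
by apply/rowP => i; rewrite !mxE.
Qed.

Lemma fcalcZ A h c : A^T = A -> c *: fcalc h A = fcalc (fun x => c * h x) A.
Proof.
move=> /sym_spectral[U [a [UU AE hE _]]].
rewrite !hE scalemxAl scalemxAr -linearZ /=; congr (_ *m diag_mx _ *m _).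
by apply/rowP => i; rewrite !mxE.
Qed.

Lemma fcalcM A h k : A^T = A ->
  fcalc h A *m fcalc k A = fcalc (fun x => h x * k x) A.
Proof.
move=> /sym_spectral[U [a [UU AE hE _]]]; rewrite !hE.
rewrite -!mulmxA (mulmxA U^T) UU mul1mx (mulmxA (diag_mx _)) mulmx_diag.
rewrite !mulmxA; congr (_ *m diag_mx _ *m _).
by apply/rowP => i; rewrite !mxE.
Qed.

Lemma fcalc_comp A h k : A^T = A -> fcalc h (fcalc k A) = fcalc (h \o k) A.
Proof.
move=> /sym_spectral[U [a [UU AE hE _]]]; rewrite !hE fcalc_diag //.
by congr (_ *m diag_mx _ *m _); apply/rowP => i; rewrite !mxE.
Qed.

Lemma eigenvalue_fcalc A h x : A^T = A ->
  eigenvalue (fcalc h A) x -> exists2 y, eigenvalue A y & x = h y.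
Proof.
move=> /sym_spectral[U [a [UU AE hE ev]]]; rewrite hE.
move=> evx; case: ((eigenvalue_diag _ x UU).1 evx) => i; rewrite mxE => ->.
by exists (a 0 i).
Qed.

Lemma spd_sym A : spd A -> A^T = A.
Proof. by case=> /symsetE. Qed.

Lemma quad_diag (U : 'M[R]_d) a (x : 'cV[R]_d) :
  (x^T *m (U *m diag_mx a *m U^T) *m x) 0 0 =
  \sum_i a 0 i * ((U^T *m x) i 0) ^+ 2.
Proof.
have -> : x^T *m (U *m diag_mx a *m U^T) *m x =
    (U^T *m x)^T *m diag_mx a *m (U^T *m x) by rewrite trmx_mul trmxK !mulmxA.
rewrite mxE; apply: eq_bigr => i _; rewrite mulmx_diagE [_^T _ _]mxE.
by rewrite expr2; ring.
Qed.

Lemma spdP A : spd A <-> A^T = A /\ forall x, eigenvalue A x -> 0 < x.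
Proof.
split=> [[/symsetE symA posA]|[symA posA]].
  split=> // x /eigenvalueP[v vA v0].
  have := posA v^T; rewrite trmx_eq0 trmxK vA -scalemxAl mxE => /(_ v0) xv.
  by rewrite -(pmulr_lgt0 x (mulmx_tr_gt0 v0)).
split; first exact/symsetE.
move=> x x0; have [U [a [UU AE _ ev]]] := sym_spectral symA.
rewrite AE quad_diag lt0r sumr_ge0 ?andbT => [|i _]; last first.
  by rewrite mulr_ge0 ?sqr_ge0 // ltW // posA.
apply: contraNneq x0 => /psumr_eq0P s0; rewrite -[x]mul1mx -(mulmx1C UU) -mulmxA.
suff -> : U^T *m x = 0 by rewrite mulmx0.
apply/colP => i; rewrite [RHS]mxE; apply/eqP; rewrite -sqrf_eq0.
have /eqP := s0 (fun i _ => mulr_ge0 (ltW (posA _ (ev i))) (sqr_ge0 _)) i isT.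
by rewrite mulf_eq0 gt_eqF //= posA.
Qed.

End functional_calculus.

(** * The Frobenius inner product *)

Lemma cauchy_schwarz_sum (R : realFieldType) (I : finType) (x y : I -> R) :
  (\sum_i x i * y i) ^+ 2 <= (\sum_i x i ^+ 2) * (\sum_i y i ^+ 2).
Proof.
set c := \sum_i _; set X := \sum_i x i ^+ 2; set Y := \sum_i y i ^+ 2.
have Y0 : 0 <= Y by apply: sumr_ge0 => i _; exact: sqr_ge0.
have [Yz|Yn] := eqVneq Y 0.
  have yz i : y i = 0.
    apply/eqP; rewrite -sqrf_eq0; apply/eqP.
    by move/psumr_eq0P: Yz; apply => // j _; exact: sqr_ge0.
  by rewrite /c Yz mulr0 big1 ?expr0n // => i _; rewrite yz mulr0.
have Yp : 0 < Y by rewrite lt0r Yn.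
rewrite -subr_ge0 -(pmulr_rge0 _ Yp).
suff -> : Y * (X * Y - c ^+ 2) = \sum_i (Y * x i - c * y i) ^+ 2.
  by apply: sumr_ge0 => i _; exact: sqr_ge0.
transitivity (\sum_i (Y ^+ 2 * x i ^+ 2 - (2 * Y * c) * (x i * y i)
                      + c ^+ 2 * y i ^+ 2)).
  by rewrite big_split /= sumrB -!mulr_sumr -/c -/X -/Y; ring.
by apply: eq_bigr => i _; ring.
Qed.

Section frobenius.
Variables (R : realType) (d : nat).
Implicit Types (A B C : 'M[R]_d) (h k : R -> R).

Lemma frobE A B : frob A B = \sum_(p : 'I_d * 'I_d) A p.1 p.2 * B p.1 p.2.
Proof.
rewrite /frob /mxtrace -(pair_bigA _ (fun i j => A i j * B i j)) exchange_big /=.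
by apply: eq_bigr => j _; rewrite mxE; apply: eq_bigr => i _; rewrite mxE.
Qed.

Lemma frobC A B : frob A B = frob B A.
Proof. by rewrite !frobE; apply: eq_bigr => p _; rewrite mulrC. Qed.

Lemma frobDl A B C : frob (A + B) C = frob A C + frob B C.
Proof. by rewrite /frob !linearD /= mulmxDl linearD. Qed.

Lemma frobZl c A B : frob (c *: A) B = c * frob A B.
Proof. by rewrite /frob !linearZ /= -scalemxAl linearZ. Qed.

Lemma frobNl A B : frob (- A) B = - frob A B.
Proof. by rewrite -scaleN1r frobZl mulN1r. Qed.

Lemma frobBl A B C : frob (A - B) C = frob A C - frob B C.
Proof. by rewrite frobDl frobNl. Qed.

Lemma frobDr A B C : frob C (A + B) = frob C A + frob C B.
Proof. by rewrite !(frobC C) frobDl. Qed.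

Lemma frobZr c A B : frob B (c *: A) = c * frob B A.
Proof. by rewrite !(frobC B) frobZl. Qed.

Lemma frobBr A B C : frob C (A - B) = frob C A - frob C B.
Proof. by rewrite !(frobC C) frobBl. Qed.

Lemma frob_ge0 A : 0 <= frob A A.
Proof. by rewrite frobE sumr_ge0 // => p _; rewrite -expr2 sqr_ge0. Qed.

Lemma frobn_ge0 A : 0 <= frobn A. Proof. exact: sqrtr_ge0. Qed.

Lemma frobn_sqr A : frobn A ^+ 2 = frob A A.
Proof. by rewrite sqr_sqrtr // frob_ge0. Qed.

Lemma frobn0_eq0 A : frobn A = 0 -> A = 0.
Proof.
move=> A0; have : frob A A = 0 by rewrite -frobn_sqr A0 expr0n.
rewrite frobE => /psumr_eq0P A0'; apply/matrixP => i j; rewrite mxE.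
apply/eqP; rewrite -sqrf_eq0 expr2; apply/eqP.
by apply: (A0' _ (i, j)) => // p _; rewrite -expr2 sqr_ge0.
Qed.

Lemma frobn0 : frobn (0 : 'M[R]_d) = 0.
Proof. by rewrite /frobn -(scale0r 0) frobZl mul0r sqrtr0. Qed.

Lemma frobnZ c A : frobn (c *: A) = `|c| * frobn A.
Proof.
by rewrite /frobn frobZl frobZr mulrA -expr2 sqrtrM ?sqr_ge0 // sqrtr_sqr.
Qed.

Lemma frobnN A : frobn (- A) = frobn A.
Proof. by rewrite -scaleN1r frobnZ normrN normr1 mul1r. Qed.

Lemma frobnB A B : frobn (A - B) = frobn (B - A).
Proof. by rewrite -frobnN opprB. Qed.

Lemma frob_le A B : `|frob A B| <= frobn A * frobn B.
Proof.
rewrite -(ler_pXn2r (isT : (0 < 2)%N)) ?nnegrE ?mulr_ge0 ?frobn_ge0 //.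
rewrite exprMn !frobn_sqr real_normK ?num_real // !frobE.
exact: cauchy_schwarz_sum.
Qed.

Lemma frobnD A B : frobn (A + B) <= frobn A + frobn B.
Proof.
rewrite -(ler_pXn2r (isT : (0 < 2)%N)) ?nnegrE ?addr_ge0 ?frobn_ge0 //.
rewrite sqrrD !frobn_sqr frobDl !frobDr (frobC B A).
have := le_trans (ler_norm _) (frob_le A B).
by rewrite mulr2n; lra.
Qed.

Lemma frobn_triangle B A C : frobn (A - C) <= frobn (A - B) + frobn (B - C).
Proof. by rewrite -[A - C](subrKA B) frobnD. Qed.

Lemma frobn_mul A B : frobn (A *m B) <= frobn A * frobn B.
Proof.
rewrite -(ler_pXn2r (isT : (0 < 2)%N)) ?nnegrE ?mulr_ge0 ?frobn_ge0 //.
rewrite exprMn !frobn_sqr !frobE.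
apply: (@le_trans _ _ (\sum_(p : 'I_d * 'I_d)
    (\sum_k A p.1 k ^+ 2) * (\sum_k B k p.2 ^+ 2))).
  apply: ler_sum => p _; rewrite -expr2 mxE; exact: cauchy_schwarz_sum.
rewrite -(pair_bigA _ (fun i j => A i j * A i j)).
rewrite -(pair_bigA _ (fun i j => B i j * B i j)) /=.
rewrite (exchange_big _ _ _ _ _ (fun i j => B i j * B i j)) /=.
rewrite -(pair_bigA _ (fun i j => (\sum_k A i k ^+ 2) * (\sum_k B k j ^+ 2))) /=.
rewrite big_distrl /= le_eqVlt; apply/orP; left; apply/eqP.
by apply: eq_bigr => i _; rewrite big_distrr.
Qed.

Lemma entry_le_frobn A i j : `|A i j| <= frobn A.
Proof.
rewrite -(ler_pXn2r (isT : (0 < 2)%N)) ?nnegrE ?frobn_ge0 //.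
rewrite frobn_sqr frobE real_normK ?num_real // (bigD1 (i, j)) //= expr2.
by rewrite lerDl sumr_ge0 // => p _; rewrite -expr2 sqr_ge0.
Qed.

Lemma norm_le_frobn A : `|A| <= frobn A.
Proof.
rewrite /Num.norm /= mx_normrE bigmax_le ?frobn_ge0 // => -[i j] _ /=.
exact: entry_le_frobn.
Qed.

Lemma entry_le_norm A i j : `|A i j| <= `|A|.
Proof.
by rewrite {2}/Num.norm /= mx_normrE; exact: (le_bigmax _ _ (i, j)).
Qed.

Lemma frobn_le_norm A : frobn A <= d%:R * `|A|.
Proof.
rewrite -(ler_pXn2r (isT : (0 < 2)%N)) ?nnegrE ?mulr_ge0 ?frobn_ge0 //.
rewrite frobn_sqr frobE exprMn.
apply: (@le_trans _ _ (\sum_(p : 'I_d * 'I_d) `|A| ^+ 2)).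
  apply: ler_sum => p _; rewrite -expr2 -real_normK ?num_real //.
  by rewrite ler_pXn2r ?nnegrE // entry_le_norm.
by rewrite sumr_const card_prod card_ord -[leLHS]mulr_natl natrM expr2.
Qed.

End frobenius.

(** * Traces of functions of two symmetric matrices *)

Section overlap.
Variables (R : realType) (d : nat).
Implicit Types (A B : 'M[R]_d) (g h k : R -> R).

Lemma frob_tr A : frob (1%:M) A = \tr A.
Proof. by rewrite /frob trmx1 mul1mx. Qed.

Lemma frob_fcalcM A h k : A^T = A ->
  frob (fcalc h A) (fcalc k A) = \tr (fcalc (fun x => h x * k x) A).
Proof. by move=> symA; rewrite /frob tr_fcalc fcalcM. Qed.

Lemma frob_trl A B : B^T = B -> frob A (fcalc (fun=> 1) B) = \tr A.
Proof. by move=> symB; rewrite fcalc_cst // frobC frob_tr. Qed.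

Lemma frob_trr A B : A^T = A -> frob (fcalc (fun=> 1) A) B = \tr B.
Proof. by move=> symA; rewrite fcalc_cst // frob_tr. Qed.

(** The weights are the squared entries of the orthogonal matrix from one
    eigenbasis to the other, and depend neither on [h] nor on [k]. An
    inequality between traces of functions of [A] and [B] is thus a weighted
    sum of instances of one scalar inequality. *)
Lemma spectral_overlap A B : A^T = A -> B^T = B ->
  exists (a b : 'I_d -> R) (w : 'I_d * 'I_d -> R),
  [/\ forall p, 0 <= w p, forall i, eigenvalue A (a i),
      forall j, eigenvalue B (b j) &
      forall h k, frob (fcalc h A) (fcalc k B) =
        \sum_p w p * (h (a p.1) * k (b p.2))].
Proof.
move=> symA symB; have [U [a [UU AE hA evA]]] := sym_spectral symA.
have [V [b [VV BE hB evB]]] := sym_spectral symB.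
exists (a 0), (b 0), (fun p => (U^T *m V) p.1 p.2 ^+ 2).
split=> // [p|h k]; first exact: sqr_ge0.
transitivity (frob (diag_mx (map_mx h a) *m (U^T *m V))
                   ((U^T *m V) *m diag_mx (map_mx k b))).
  rewrite hA hB /frob tr_diag_form !trmx_mul trmxK tr_diag_mx.
  by rewrite !mulmxA [LHS]mxtrace_mulC !mulmxA.
rewrite frobE; apply: eq_bigr => p _.
by rewrite mul_diag_mx mulmx_diagE !mxE; ring.
Qed.

Lemma spectral_overlap_dist A B : A^T = A -> B^T = B ->
  exists (a b : 'I_d -> R) (w : 'I_d * 'I_d -> R),
  [/\ forall p, 0 <= w p, forall i, eigenvalue A (a i),
      forall j, eigenvalue B (b j),
      forall h k, frob (fcalc h A) (fcalc k B) =
        \sum_p w p * (h (a p.1) * k (b p.2)) &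
      forall h k, frobn (fcalc h A - fcalc k B) ^+ 2 =
        \sum_p w p * (h (a p.1) - k (b p.2)) ^+ 2].
Proof.
move=> symA symB; have [a [b [w [w0 evA evB wE]]]] := spectral_overlap symA symB.
exists a, b, w; split=> // h k.
rewrite frobn_sqr frobBl !frobBr (frobC (fcalc k B)).
rewrite !frob_fcalcM // -(frob_trl _ symB) // -(frob_trr _ symA) // !wE -!sumrB.
by apply: eq_bigr => p _; ring.
Qed.

(** By [spectral_overlap_dist] a scalar Lipschitz bound on the spectra passes
    to matrices with the same constant, although [A] and [B] need not commute.
    *)
Lemma fcalc_lipschitz A B h K : A^T = A -> B^T = B -> 0 <= K ->
  (forall x y, eigenvalue A x -> eigenvalue B y ->
     `|h x - h y| <= K * `|x - y|) ->
  frobn (fcalc h A - fcalc h B) <= K * frobn (A - B).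
Proof.
move=> symA symB K0 hK.
have [a [b [w [w0 evA evB _ wE]]]] := spectral_overlap_dist symA symB.
rewrite -(ler_pXn2r (isT : (0 < 2)%N)) ?nnegrE ?mulr_ge0 ?frobn_ge0 //.
rewrite exprMn -[in leRHS](fcalc_id symA) -[in leRHS](fcalc_id symB) !wE.
rewrite mulr_sumr; apply: ler_sum => p _; rewrite [leRHS]mulrCA ler_wpM2l //.
rewrite -exprMn -[leLHS]real_normK ?num_real // -[leRHS]real_normK ?num_real //.
by rewrite ler_pXn2r ?nnegrE // normrM (ger0_norm K0) hK.
Qed.

(** With [h] the derivative of [g], this is the first-order expansion of a
    spectral trace: the overlap weights carry the scalar expansion over to
    matrices. *)
Lemma trace_fcalc_taylor A B g h K : A^T = A -> B^T = B ->
  (forall x y, eigenvalue A x -> eigenvalue B y ->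
     `|g y - g x - h x * (y - x)| <= K * (x - y) ^+ 2) ->
  `|\tr (fcalc g B) - \tr (fcalc g A) - frob (fcalc h A) (B - A)|
    <= K * frobn (A - B) ^+ 2.
Proof.
move=> symA symB ghK.
have [a [b [w [w0 evA evB wF wE]]]] := spectral_overlap_dist symA symB.
rewrite -[in leRHS](fcalc_id symA) -[in leRHS](fcalc_id symB) wE.
have -> : \tr (fcalc g B) - \tr (fcalc g A) - frob (fcalc h A) (B - A) =
    \sum_p w p * (g (b p.2) - g (a p.1) - h (a p.1) * (b p.2 - a p.1)).
  have -> : frob (fcalc h A) (B - A) =
      frob (fcalc h A) (fcalc id B) - frob (fcalc h A) (fcalc id A).
    by rewrite !fcalc_id // frobBr.
  rewrite frob_fcalcM // -(frob_trr (fcalc g B) symA).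
  rewrite -!(frob_trl _ symB) !wF -!sumrB.
  by apply: eq_bigr => p _; ring.
rewrite mulr_sumr (le_trans (ler_norm_sum _ _ _)) //; apply: ler_sum => p _.
by rewrite normrM (ger0_norm (w0 p)) [leRHS]mulrCA ler_wpM2l // ghK.
Qed.

(** The dependence on [h] is confined to scalar coefficients of fixed
    matrices, so limits and derivatives of [fcalc] in a parameter reduce to
    scalar ones. *)
Lemma fcalc_projections A : A^T = A ->
  exists (a : 'I_d -> R) (P : 'I_d -> 'M[R]_d),
    (forall i, eigenvalue A (a i)) /\
    forall h, fcalc h A = \sum_i h (a i) *: P i.
Proof.
move=> /sym_spectral[U [a [UU AE hA evA]]].
exists (a 0), (fun i => U *m delta_mx i i *m U^T); split=> // h; rewrite hA.
have -> : diag_mx (map_mx h a) = \sum_i h (a 0 i) *: delta_mx i i.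
  apply/matrixP => i j; rewrite summxE (bigD1 i) //= big1 ?addr0.
    by rewrite !mxE eqxx (eq_sym j) mulr_natr.
  by move=> l li; rewrite !mxE eq_sym (negbTE li) mulr0.
rewrite mulmx_sumr mulmx_suml; apply: eq_bigr => i _.
by rewrite -scalemxAr -scalemxAl.
Qed.

Lemma eigenvalue_le_frobn A x : A^T = A -> eigenvalue A x -> `|x| <= frobn A.
Proof.
move=> symA; have [U [a [UU AE hA evA]]] := sym_spectral symA.
rewrite {1}AE => evx; case: ((eigenvalue_diag _ x UU).1 evx) => i ->.
have -> : a 0 i = (U^T *m A *m U) i i.
  by rewrite AE !mulmxA UU mul1mx -mulmxA UU mulmx1 mxE eqxx.
have -> : frobn A = frobn (U^T *m A *m U).
  rewrite /frobn /frob !trmx_mul trmxK symA; congr (Num.sqrt _).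
  transitivity (\tr (U^T *m (A *m A *m U))).
    by rewrite [RHS]mxtrace_mulC -!mulmxA (mulmx1C UU) mulmx1.
  congr (\tr _); rewrite !mulmxA -(mulmxA _ U U^T) (mulmx1C UU) mulmx1.
  by rewrite -!mulmxA.
exact: entry_le_frobn.
Qed.

End overlap.

(** * Exponential, logarithm, square root and inverse *)

Section exp_log_sqrt.
Variables (R : realType) (d : nat).
Implicit Types (A B G H S T X : 'M[R]_d).

Lemma fcalcX A k : A^T = A -> fcalc (fun x => x ^+ k) A = A ^+ k.
Proof.
move=> symA; elim: k => [|k IH].
  by rewrite expr0 (fcalc_cst 1 symA).
rewrite exprS -IH -[in RHS](fcalc_id symA) fcalc_comp //.
transitivity (fcalc id A *m fcalc (fun x => x ^+ k) A); last by rewrite fcalc_id.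
by rewrite fcalcM //; apply: eq_fcalc => // x _; rewrite exprS.
Qed.

Lemma expmx_fcalc A : A^T = A -> expmx A = fcalc expR A.
Proof.
move=> symA; have [a [P [_ hP]]] := fcalc_projections symA.
rewrite /expmx hP; apply: cvg_lim => //.
have -> : series (fun k : nat => (k`!%:R : R)^-1 *: A ^+ k) =
    (fun n => \sum_i series (exp_coeff (a i)) n *: P i).
  apply/funext => n; rewrite /series /=.
  transitivity (\sum_(0 <= k < n) \sum_i (exp_coeff (a i) k) *: P i).
    apply: eq_bigr => k _; rewrite -fcalcX // hP scaler_sumr.
    by apply: eq_bigr => i _; rewrite scalerA /exp_coeff /= mulrC.
  by rewrite exchange_big /=; apply: eq_bigr => i _; rewrite scaler_suml.
apply: cvg_big => [|i _]; first exact: add_continuous.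
apply: cvgZr_tmp.
exact: is_cvg_series_exp_coeff.
Qed.

Lemma tr_expmx A : A^T = A -> (expmx A)^T = expmx A.
Proof. by move=> symA; rewrite expmx_fcalc // tr_fcalc. Qed.

Lemma spd_fcalc A h : A^T = A -> (forall x, eigenvalue A x -> 0 < h x) ->
  spd (fcalc h A).
Proof.
move=> symA h0; apply/spdP; split; first exact: tr_fcalc.
by move=> x /(eigenvalue_fcalc symA)[y /h0 hy ->].
Qed.

Lemma spd_expmx A : A^T = A -> spd (expmx A).
Proof.
by move=> symA; rewrite expmx_fcalc //; apply: spd_fcalc => // x _; apply: expR_gt0.
Qed.

Lemma spd_eigenvalue A x : spd A -> eigenvalue A x -> 0 < x.
Proof. by move=> /spdP[_]; apply. Qed.

Lemma fcalc_ln_expmx A : A^T = A -> fcalc (@ln R) (expmx A) = A.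
Proof.
move=> symA; rewrite expmx_fcalc // fcalc_comp // -[RHS]fcalc_id //.
by apply: eq_fcalc => // x _; rewrite /= expRK.
Qed.

Lemma logmx_expmx A : A^T = A -> logmx (expmx A) = A.
Proof.
move=> symA; rewrite /logmx.
have /getPex : exists X, [set X | symset X /\ expmx X = expmx A] X.
  by exists A; split=> //; apply/symsetE.
case=> /symsetE sX /(congr1 (fcalc (@ln R))).
by rewrite !fcalc_ln_expmx.
Qed.

Lemma expmx_ln A : spd A -> expmx (fcalc (@ln R) A) = A.
Proof.
move=> pA; have symA := spd_sym pA; rewrite expmx_fcalc ?tr_fcalc //.
rewrite fcalc_comp // -[RHS]fcalc_id //; apply: eq_fcalc => // x evx /=.
by rewrite lnK // posrE; apply: spd_eigenvalue evx.
Qed.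

Lemma logmx_fcalc A : spd A -> logmx A = fcalc (@ln R) A.
Proof.
by move=> pA; rewrite -{1}(expmx_ln pA) logmx_expmx // tr_fcalc.
Qed.

Lemma logmxK A : spd A -> expmx (logmx A) = A.
Proof. by move=> pA; rewrite logmx_fcalc // expmx_ln. Qed.

Lemma tr_logmx A : spd A -> (logmx A)^T = logmx A.
Proof. by move=> pA; rewrite logmx_fcalc // tr_fcalc. Qed.

Lemma sqrtmx_unique A X : spd X -> X *m X = A -> X = fcalc Num.sqrt A.
Proof.
move=> pX XA; have symX := spd_sym pX.
have <- : fcalc (fun x => x * x) X = A.
  by rewrite -XA -fcalcM // !fcalc_id.
rewrite fcalc_comp // -[LHS]fcalc_id //; apply: eq_fcalc => // x evx /=.
by rewrite -expr2 sqrtr_sqr gtr0_norm // (spd_eigenvalue pX).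
Qed.

Lemma spd_sqrt A : spd A -> spd (fcalc Num.sqrt A).
Proof.
move=> pA; apply: spd_fcalc; first exact: spd_sym.
by move=> x evx; rewrite sqrtr_gt0 (spd_eigenvalue pA).
Qed.

Lemma sqrt_sqr A : spd A -> fcalc Num.sqrt A *m fcalc Num.sqrt A = A.
Proof.
move=> pA; have symA := spd_sym pA; rewrite fcalcM // -[RHS]fcalc_id //.
by apply: eq_fcalc => // x /(spd_eigenvalue pA) x0; rewrite -expr2 sqr_sqrtr // ltW.
Qed.

Lemma sqrtmx_fcalc A : spd A -> sqrtmx A = fcalc Num.sqrt A.
Proof.
move=> pA; have /getPex [] : exists X, [set X | spd X /\ X *m X = A] X.
  by exists (fcalc Num.sqrt A); split; [exact: spd_sqrt|exact: sqrt_sqr].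
exact: sqrtmx_unique.
Qed.

Lemma sqrtmx_eq A X : spd X -> X *m X = A -> spd A -> sqrtmx A = X.
Proof. by move=> pX XA pA; rewrite sqrtmx_fcalc // -(sqrtmx_unique pX XA). Qed.

Lemma spd_sqrtmx A : spd A -> spd (sqrtmx A).
Proof. by move=> pA; rewrite sqrtmx_fcalc //; apply: spd_sqrt. Qed.

Lemma sqrtmxK A : spd A -> sqrtmx A *m sqrtmx A = A.
Proof. by move=> pA; rewrite sqrtmx_fcalc // sqrt_sqr. Qed.

Lemma fcalc_inv A : spd A -> A *m fcalc (fun x => x^-1) A = 1%:M.
Proof.
move=> pA; have symA := spd_sym pA.
rewrite -{1}(fcalc_id symA) fcalcM // -(fcalc_cst 1 symA).
by apply: eq_fcalc => // x /(spd_eigenvalue pA) x0; rewrite mulfV // gt_eqF.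
Qed.

Lemma spd_unit A : spd A -> A \in unitmx.
Proof. by move=> /fcalc_inv /mulmx1_unit[]. Qed.

Lemma invmx_fcalc A : spd A -> invmx A = fcalc (fun x => x^-1) A.
Proof.
move=> pA; rewrite -[LHS]mulmx1 -(fcalc_inv pA) mulmxA mulVmx ?mul1mx //.
exact: spd_unit.
Qed.

Lemma spd_invmx A : spd A -> spd (invmx A).
Proof.
move=> pA; rewrite invmx_fcalc //; apply: spd_fcalc; first exact: spd_sym.
by move=> x /(spd_eigenvalue pA); rewrite invr_gt0.
Qed.

Lemma spd_congr A T : T \in unitmx -> spd A -> spd (T *m A *m T^T).
Proof.
move=> uT [/symsetE symA posA]; split.
  by apply/symsetE; rewrite !trmx_mul trmxK symA mulmxA.
move=> x x0; rewrite !mulmxA -mulmxA -[x^T *m T]trmxK trmx_mul trmxK.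
apply: posA; apply: contraNneq x0 => Tx.
by rewrite -[x]mul1mx -(mulVmx (_ : T^T \in unitmx)) ?unitmx_tr // -mulmxA Tx mulmx0.
Qed.

Lemma spd1 : spd (1%:M : 'M[R]_d).
Proof.
split; first by apply/symsetE; rewrite trmx1.
move=> x x0; rewrite mulmx1 -{2}[x]trmxK; apply: mulmx_tr_gt0.
by rewrite trmx_eq0.
Qed.

End exp_log_sqrt.

(** * Inequalities for the hyperbolic cosine *)

Section scalar_inequalities.
Variable R : realType.
Implicit Types (x y z t : R).

Global Instance is_derive_expRM c t :
  is_derive t 1 (fun s : R => expR (s * c)) (c * expR (t * c)).
Proof.
have h : is_derive t 1 (fun s : R => s * c) c.
  have -> : (fun s : R => s * c) = c \*: id.
    by apply/funext => s; rewrite -[RHS]/(c * s) mulrC.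
  by apply: is_derive_eq; rewrite -[LHS]/(c * 1) mulr1.
have := @is_derive1_comp R expR ( *%R^~ c) t _ _ (is_derive_expR (t * c)) h.
by rewrite mulrC.
Qed.

Lemma cosh_factor u : expR u + expR (- u) - 2 = expR u * (1 - expR (- u)) ^+ 2 :> R.
Proof.
have -> : (1 - expR (- u)) ^+ 2 = 1 - 2 * expR (- u) + expR (- u) * expR (- u) by ring.
by rewrite mulrDr mulrA expRxMexpNx_1 mulrBr mulrCA expRxMexpNx_1; ring.
Qed.

Lemma sinh_ge z : 0 <= z -> z *+ 2 <= expR z - expR (- z).
Proof.
move=> z0; pose g x : R := expR x - expR (- x) - x *+ 2.
have dg x : is_derive x 1 g (expR x + expR (- x) - 2).
  rewrite /g; have h : is_derive x 1 (fun y : R => expR (- y)) (- expR (- x)).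
    have -> : (fun y => expR (- y)) = (fun y : R => expR (y * -1)).
      by apply/funext => y; rewrite mulrN1.
    by apply: is_derive_eq; rewrite mulN1r mulrN1.
  have h2 : is_derive x 1 (fun y : R => y *+ 2) 2.
    have -> : (fun y : R => y *+ 2) = (fun y => 2 *: y).
      by apply/funext => y; rewrite -[RHS]/(2 * y) mulr_natl.
    by apply: is_derive_eq; rewrite -[LHS]/(2 * 1) mulr1.
  have := is_deriveB (is_deriveB (is_derive_expR x) h) h2.
  by rewrite opprK.
have : g 0 <= g z.
  apply: (@ger0_derive1_ndecry _ g 0) => //.
  - move=> x _; rewrite derive1E; rewrite derive_val.
    by rewrite cosh_factor mulr_ge0 ?expR_ge0 ?sqr_ge0.
  - by apply: derivable_within_continuous => x _; exact: ex_derive.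
by rewrite /g oppr0 subrr mul0rn subr0; lra.
Qed.

(** The left side is four times the square of [u / 2] and the right side four
    times the squared hyperbolic sine of [u / 2]. *)
Lemma cosh_ge u : u ^+ 2 <= expR u + expR (- u) - 2 :> R.
Proof.
wlog u0 : u / 0 <= u.
  move=> H; have [/H //|/ltW u0] := leP 0 u.
  by have := H (- u); rewrite sqrrN opprK (addrC (expR (- u))) oppr_ge0; apply.
have /sinh_ge h : 0 <= u / 2 by lra.
have e2 : expR u = expR (u / 2) ^+ 2.
  by rewrite -expRM_natl; congr expR; lra.
have e3 : expR (- u) = expR (- (u / 2)) ^+ 2.
  by rewrite -expRM_natl; congr expR; lra.
have -> : expR u + expR (- u) - 2 = (expR (u / 2) - expR (- (u / 2))) ^+ 2.
  by rewrite e2 e3 sqrrB expRxMexpNx_1; ring.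
have uE : u / 2 *+ 2 = u by rewrite mulr2n; lra.
by rewrite uE in h; rewrite ler_pXn2r // nnegrE // (le_trans u0 h).
Qed.

Lemma cosh_le u D : `|u| <= D -> expR u + expR (- u) - 2 <= u ^+ 2 * expR D :> R.
Proof.
wlog u0 : u / 0 <= u.
  move=> H; have [/H //|/ltW u0] := leP 0 u.
  by have := H (- u); rewrite sqrrN normrN opprK (addrC (expR (- u))) oppr_ge0; apply.
rewrite ger0_norm // => uD'; have uD : expR u <= expR D by rewrite ler_expR.
apply: (le_trans _ (ler_wpM2l (sqr_ge0 u) uD)); rewrite cosh_factor mulrC.
rewrite ler_wpM2r ?expR_ge0 // ler_pXn2r ?nnegrE //.
  by have := expR_ge1Dx (- u); lra.
by rewrite subr_ge0 expR_le1; lra.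
Qed.

(** This is [cosh_ge] at [u = ln x - ln y]. *)
Lemma ln_diff_sqr x y : 0 < x -> 0 < y ->
  (ln x - ln y) ^+ 2 <= x^-1 * y + x * y^-1 - 2.
Proof.
move=> x0 y0; have := cosh_ge (ln x - ln y).
by rewrite opprB !expRB !lnK ?posrE // (addrC (x / y)) (mulrC y).
Qed.

End scalar_inequalities.

(** * Congruence by square roots *)

Section congruence.
Variables (R : realType) (d : nat).
Implicit Types (G M Z W Y : 'M[R]_d).

Lemma spd_isqrtmx G : spd G -> spd (isqrtmx G).
Proof. by move=> pG; apply: spd_invmx; exact: spd_sqrtmx. Qed.

Lemma isqrtmxK G : spd G -> isqrtmx G *m sqrtmx G = 1%:M.
Proof. by move=> pG; rewrite mulVmx // spd_unit //; exact: spd_sqrtmx. Qed.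

Lemma sqrtmxVK G : spd G -> sqrtmx G *m isqrtmx G = 1%:M.
Proof. by move=> pG; rewrite mulmxV // spd_unit //; exact: spd_sqrtmx. Qed.

Lemma tr_sqrtmx G : spd G -> (sqrtmx G)^T = sqrtmx G.
Proof. by move=> /spd_sqrtmx/spd_sym. Qed.

Lemma tr_isqrtmx G : spd G -> (isqrtmx G)^T = isqrtmx G.
Proof. by move=> /spd_isqrtmx/spd_sym. Qed.

Lemma isqrtmx_sqr G : spd G -> isqrtmx G *m isqrtmx G = invmx G.
Proof.
move=> pG; have e : isqrtmx G *m isqrtmx G *m G = 1%:M.
  rewrite -[X in _ *m X](sqrtmxK pG) mulmxA -(mulmxA (isqrtmx G)).
  by rewrite isqrtmxK // mulmx1 isqrtmxK.
by rewrite -[RHS]mul1mx -e -(mulmxA _ G) mulmxV ?mulmx1 // spd_unit.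
Qed.

Lemma whitenK G Z : spd G -> unwhiten G (whiten G Z) = Z.
Proof.
move=> pG; rewrite /unwhiten /whiten !mulmxA sqrtmxVK // mul1mx -mulmxA.
by rewrite isqrtmxK // mulmx1.
Qed.

Lemma unwhitenK G Z : spd G -> whiten G (unwhiten G Z) = Z.
Proof.
move=> pG; rewrite /unwhiten /whiten !mulmxA isqrtmxK // mul1mx -mulmxA.
by rewrite sqrtmxVK // mulmx1.
Qed.

Lemma tr_whiten G Z : spd G -> (whiten G Z)^T = whiten G Z^T.
Proof. by move=> pG; rewrite /whiten !trmx_mul tr_isqrtmx // mulmxA. Qed.

Lemma tr_unwhiten G Z : spd G -> (unwhiten G Z)^T = unwhiten G Z^T.
Proof. by move=> pG; rewrite /unwhiten !trmx_mul tr_sqrtmx // mulmxA. Qed.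

Lemma spd_whiten G M : spd G -> spd M -> spd (whiten G M).
Proof.
move=> pG pM; rewrite /whiten -{2}(tr_isqrtmx pG); apply: spd_congr => //.
by apply: spd_unit; exact: spd_isqrtmx.
Qed.

Lemma spd_unwhiten G M : spd G -> spd M -> spd (unwhiten G M).
Proof.
move=> pG pM; rewrite /unwhiten -{2}(tr_sqrtmx pG); apply: spd_congr => //.
by apply: spd_unit; exact: spd_sqrtmx.
Qed.

Lemma unwhiten1 G : spd G -> unwhiten G 1%:M = G.
Proof. by move=> pG; rewrite /unwhiten mulmx1 sqrtmxK. Qed.

Lemma whiten1 G : spd G -> whiten G G = 1%:M.
Proof. by move=> pG; rewrite -{2}(unwhiten1 pG) unwhitenK. Qed.

Lemma unwhitenN G W : unwhiten G (- W) = - unwhiten G W.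
Proof. by rewrite /unwhiten mulmxN mulNmx. Qed.

Lemma whitenN G W : whiten G (- W) = - whiten G W.
Proof. by rewrite /whiten mulmxN mulNmx. Qed.

Lemma whitenB G W Z : whiten G (W - Z) = whiten G W - whiten G Z.
Proof. by rewrite /whiten mulmxBr mulmxBl. Qed.

Lemma whiten_eq0 G W : spd G -> whiten G W = 0 -> W = 0.
Proof.
by move=> pG w0; rewrite -(whitenK W pG) w0 /unwhiten mulmx0 mul0mx.
Qed.

Lemma ai_norm0_eq0 G W : spd G -> ai_dot G W W = 0 -> W = 0.
Proof.
move=> pG; rewrite /ai_dot -frobn_sqr => /eqP; rewrite sqrf_eq0 => /eqP.
by move=> /frobn0_eq0; exact: whiten_eq0.
Qed.

Lemma ai_dotBl G W Z Y : ai_dot G (W - Z) Y = ai_dot G W Y - ai_dot G Z Y.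
Proof. by rewrite /ai_dot whitenB frobBl. Qed.

Lemma ai_dotBr G W Z Y : ai_dot G Y (W - Z) = ai_dot G Y W - ai_dot G Y Z.
Proof. by rewrite /ai_dot whitenB frobBr. Qed.

(** Up to inversion, whitening [M] by [G] and [G] by [M] are the two products
    of one matrix with its transpose, hence similar. This transfers spectral
    information between the two. *)
Lemma whiten_factor G M : spd G -> spd M ->
  let Y := isqrtmx G *m sqrtmx M in
  whiten G M = Y *m Y^T /\ invmx (whiten M G) = Y^T *m Y.
Proof.
move=> pG pM Y; have pB := spd_whiten pM pG.
have YT : Y^T = sqrtmx M *m isqrtmx G.
  by rewrite trmx_mul tr_sqrtmx // tr_isqrtmx.
split; first by rewrite YT /Y /whiten -[in LHS](sqrtmxK pM) !mulmxA.
have e : whiten M G *m (Y^T *m Y) = 1%:M.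
  rewrite YT /Y /whiten !mulmxA -(mulmxA _ (isqrtmx M) (sqrtmx M)) isqrtmxK // mulmx1.
  rewrite -(mulmxA _ (isqrtmx G) (isqrtmx G)) isqrtmx_sqr // -(mulmxA _ G).
  by rewrite mulmxV ?mulmx1 ?isqrtmxK // spd_unit.
by rewrite -[RHS]mul1mx -(mulVmx (spd_unit pB)) -mulmxA e mulmx1.
Qed.

End congruence.

(** * The affine-invariant distance *)

Section distance.
Variables (R : realType) (d : nat).
Implicit Types (A B G M Z W Y : 'M[R]_d) (s t : R).

Lemma tr_fcalc_le A h k : A^T = A ->
  (forall x, eigenvalue A x -> h x <= k x) ->
  \tr (fcalc h A) <= \tr (fcalc k A).
Proof.
move=> symA hk; have [a [b [w [w0 eva _ wE]]]] := spectral_overlap symA symA.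
rewrite -!(frob_trl _ symA) !wE; apply: ler_sum => p _.
by rewrite ler_wpM2l // ler_pM2r ?ltr01 // hk.
Qed.

Lemma frobn_fcalc_sqr A h : A^T = A ->
  frobn (fcalc h A) ^+ 2 = \tr (fcalc (fun x => h x ^+ 2) A).
Proof. by move=> symA; rewrite frobn_sqr frob_fcalcM. Qed.

Lemma tr_fcalc_similar A B S h : A^T = A -> B^T = B -> S \in unitmx ->
  S *m A = B *m S -> \tr (fcalc h A) = \tr (fcalc h B).
Proof.
move=> symA symB uS /(fcalc_intertwine h symA symB) SAB.
transitivity (\tr (S *m fcalc h A *m invmx S)).
  by rewrite [RHS]mxtrace_mulC mulmxA mulVmx // mul1mx.
by rewrite SAB mulmxK.
Qed.

Lemma ai_dist_sqr A B : spd A -> spd B ->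
  ai_dist A B ^+ 2 = \tr (fcalc (fun x => ln x ^+ 2) (whiten A B)).
Proof.
move=> pA pB; have pw := spd_whiten pA pB.
by rewrite /ai_dist logmx_fcalc // frobn_fcalc_sqr //; exact: spd_sym.
Qed.

(** By [whiten_factor] the two whitened matrices are similar up to inversion,
    and the squared logarithm is invariant under inversion. *)
Lemma ai_distC A B : spd A -> spd B -> ai_dist A B = ai_dist B A.
Proof.
move=> pA pB; apply/eqP; rewrite -(eqrXn2 (isT : (0 < 2)%N)) ?frobn_ge0 //.
apply/eqP; rewrite !ai_dist_sqr //.
have pw := spd_whiten pB pA.
have [YY YY'] := whiten_factor pA pB.
set Y := isqrtmx A *m sqrtmx B in YY YY'.
have uY : Y \in unitmx.
  rewrite unitmx_mul !spd_unit //; [exact: spd_sqrtmx|exact: spd_isqrtmx].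
have pi := spd_invmx pw.
have -> : \tr (fcalc (fun x => ln x ^+ 2) (whiten B A)) =
          \tr (fcalc (fun x => ln x ^+ 2) (invmx (whiten B A))).
  rewrite invmx_fcalc // fcalc_comp ?(spd_sym pw) //; congr (\tr _).
  apply: eq_fcalc => [|x /(spd_eigenvalue pw) x0]; first exact: spd_sym.
  by rewrite /= lnV ?posrE // sqrrN.
apply/esym/(@tr_fcalc_similar _ _ Y) => //; [exact: spd_sym| |].
  by apply/spd_sym; exact: spd_whiten.
by rewrite YY' YY mulmxA.
Qed.

Lemma expmx_scale W t : W^T = W -> expmx (t *: W) = fcalc (fun x => expR (t * x)) W.
Proof.
move=> symW; rewrite expmx_fcalc; last by rewrite linearZ /= symW.
by rewrite -[W in LHS](fcalc_id symW) fcalcZ // fcalc_comp.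
Qed.

Lemma expmxD W s t : W^T = W ->
  expmx (s *: W) *m expmx (t *: W) = expmx ((s + t) *: W).
Proof.
move=> symW; rewrite !expmx_scale // fcalcM //.
by apply: eq_fcalc => // x _; rewrite -expRD mulrDl.
Qed.

Lemma expmx0 : expmx (0 : 'M[R]_d) = 1%:M.
Proof.
have sym0 : (0 : 'M[R]_d)^T = 0 by rewrite trmx0.
rewrite -(scale0r (0 : 'M[R]_d)) expmx_scale // -(fcalc_cst 1 sym0).
by apply: eq_fcalc => // x _; rewrite mul0r expR0.
Qed.

(** The geodesic starting at [G] whose whitened initial velocity is [W]; see
    [geodesic_geod]. *)
Definition ai_geod G W t : 'M[R]_d := unwhiten G (expmx (t *: W)).

Lemma spd_geod G W t : spd G -> W^T = W -> spd (ai_geod G W t).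
Proof.
by move=> pG symW; apply/spd_unwhiten/spd_expmx => //; rewrite linearZ /= symW.
Qed.

Lemma ai_geod0 G W : spd G -> ai_geod G W 0 = G.
Proof. by move=> pG; rewrite /ai_geod scale0r expmx0 unwhiten1. Qed.

Lemma ai_geod_log G M : spd G -> spd M ->
  ai_geod G (logmx (whiten G M)) 1 = M.
Proof.
move=> pG pM; rewrite /ai_geod scale1r logmxK ?whitenK //.
exact: spd_whiten.
Qed.

Lemma ai_dist_geod G W t : spd G -> W^T = W ->
  ai_dist G (ai_geod G W t) = `|t| * frobn W.
Proof.
move=> pG symW; rewrite /ai_dist unwhitenK // logmx_expmx ?frobnZ //.
by rewrite linearZ /= symW.
Qed.

Lemma invmx_geod G W t : spd G -> W^T = W ->
  invmx (ai_geod G W t) = isqrtmx G *m expmx ((- t) *: W) *m isqrtmx G.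
Proof.
move=> pG symW; have pg := spd_geod t pG symW.
rewrite -[RHS]mulmx1 -(mulmxV (spd_unit pg)) mulmxA -[LHS]mul1mx.
congr (_ *m _); rewrite /ai_geod /unwhiten !mulmxA -(mulmxA _ (isqrtmx G)).
rewrite isqrtmxK // mulmx1 -(mulmxA (isqrtmx G)) expmxD // addNr scale0r expmx0.
by rewrite mulmx1 isqrtmxK.
Qed.

Lemma trace_geod G W s t : spd G -> W^T = W ->
  \tr (invmx (ai_geod G W s) *m ai_geod G W t) = \tr (expmx ((t - s) *: W)).
Proof.
move=> pG symW; rewrite invmx_geod // /ai_geod /unwhiten !mulmxA.
rewrite -(mulmxA _ (isqrtmx G)) isqrtmxK // mulmx1 mxtrace_mulC !mulmxA.
by rewrite sqrtmxVK // mul1mx expmxD // addrC.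
Qed.

(** In the overlap of the two spectra this is the scalar bound [ln_diff_sqr].
    The right side depends on [invmx A *m B] alone, hence is invariant under
    congruence, and to second order it is the squared Riemannian distance. *)
Lemma log_dist_trace A B : spd A -> spd B ->
  frobn (logmx A - logmx B) ^+ 2 <=
  \tr (invmx A *m B) + \tr (invmx B *m A) - 2 * \tr (1%:M : 'M[R]_d).
Proof.
move=> pA pB; have symA := spd_sym pA; have symB := spd_sym pB.
have [a [b [w [w0 eva evb wF wE]]]] := spectral_overlap_dist symA symB.
rewrite !logmx_fcalc // wE.
have -> : \tr (invmx A *m B) = frob (fcalc (fun x => x^-1) A) (fcalc id B).
  by rewrite fcalc_id // /frob tr_fcalc invmx_fcalc.
have -> : \tr (invmx B *m A) = frob (fcalc id A) (fcalc (fun x => x^-1) B).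
  by rewrite fcalc_id // /frob symA invmx_fcalc // mxtrace_mulC.
rewrite -(fcalc_cst 1 symA) -(frob_trl _ symB) !wF mulr_sumr -big_split -sumrB /=.
apply: ler_sum => p _.
have -> : w p * ((a p.1)^-1 * b p.2) + w p * (a p.1 * (b p.2)^-1)
    - 2 * (w p * (1 * 1)) =
    w p * ((a p.1)^-1 * b p.2 + a p.1 * (b p.2)^-1 - 2) by ring.
rewrite ler_wpM2l // ln_diff_sqr //.
  exact: spd_eigenvalue pA (eva _).
exact: spd_eigenvalue pB (evb _).
Qed.

(** The logarithm stretches a short piece of geodesic by a factor tending to 1
    with the length of the piece, uniformly along the geodesic. *)
Lemma log_geod_step G W s t : spd G -> W^T = W ->
  frobn (logmx (ai_geod G W s) - logmx (ai_geod G W t)) <=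
  `|t - s| * frobn W * expR (`|t - s| * frobn W).
Proof.
move=> pG symW; set D := frobn W.
rewrite -(ler_pXn2r (isT : (0 < 2)%N)) ?nnegrE ?mulr_ge0 ?frobn_ge0 ?expR_ge0 //.
apply: le_trans (log_dist_trace (spd_geod s pG symW) (spd_geod t pG symW)) _.
rewrite !trace_geod // !expmx_scale //.
have -> : 2 * \tr (1%:M : 'M[R]_d) = \tr (fcalc (fun=> 2) W).
  by rewrite fcalc_cst // !mxtrace_scalar mulr_natr -mulrnA mulnC mulrnA.
rewrite -raddfD /= fcalcD // -raddfB /=.
have -> : fcalc (fun=> 2) W = - fcalc (fun=> -2) W.
  by rewrite !fcalc_cst // raddfN opprK.
rewrite opprK fcalcD //.
apply: le_trans (tr_fcalc_le (k := fun x => (t - s) ^+ 2 * expR (`|t - s| * D) * (x ^+ 2)) symW _) _.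
  move=> x /(eigenvalue_le_frobn symW) xD.
  have := @cosh_le R ((t - s) * x) (`|t - s| * D).
  rewrite normrM ler_wpM2l // => /(_ isT); rewrite exprMn -mulNr opprB.
  by move=> h; apply: le_trans h _; rewrite le_eqVlt; apply/orP; left; apply/eqP; ring.
rewrite -fcalcZ // linearZ /= -(@frobn_fcalc_sqr W id) // fcalc_id // -/D.
rewrite exprMn exprMn real_normK ?num_real // [leLHS]mulrAC.
rewrite ler_wpM2l //.
  by rewrite mulr_ge0 ?sqr_ge0.
rewrite expr2 ler_peMr ?expR_ge0 //.
by rewrite -expR0 ler_expR mulr_ge0 ?frobn_ge0.
Qed.

(** The geodesic from [A] to [B] is cut into [N] equal pieces; [log_geod_step]
    bounds the length of the image of each under the logarithm, the triangle
    inequality adds them up, and the excess factor tends to 1 as [N] grows. *)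
Lemma exponential_metric_increasing A B : spd A -> spd B ->
  frobn (logmx A - logmx B) <= ai_dist A B.
Proof.
move=> pA pB; set W := logmx (whiten A B).
have symW : W^T = W by apply: tr_logmx; exact: spd_whiten.
rewrite -{1}(ai_geod_log pA pB) -/W -{1}(ai_geod0 W pA) /ai_dist -/W.
set D := frobn W.
have D0 : 0 <= D := frobn_ge0 W.
have step N k : frobn (logmx (ai_geod A W 0) -
    logmx (ai_geod A W (k%:R / N.+1%:R))) <= k%:R / N.+1%:R * D * expR (D / N.+1%:R).
  elim: k => [|k IH]; first by rewrite !mul0r subrr frobn0.
  apply: le_trans (frobn_triangle (logmx (ai_geod A W (k%:R / N.+1%:R))) _ _) _.
  apply: le_trans (lerD IH (log_geod_step _ _ pA symW)) _.
  rewrite -/D -mulrBl -natrB // subSnn ger0_norm ?mulr_ge0 ?invr_ge0 //.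
  rewrite [D / _]mulrC mul1r le_eqVlt; apply/orP; left; apply/eqP.
  by rewrite -[in RHS]natr1; ring.
have bound N : frobn (logmx (ai_geod A W 0) - logmx (ai_geod A W 1)) <=
    D + (D ^+ 2 * expR D) / N.+1%:R.
  have := step N N.+1; rewrite divff ?mul1r ?pnatr_eq0 // => h.
  apply: le_trans h _; set u := D / N.+1%:R.
  have u0 : 0 <= u by rewrite /u divr_ge0.
  have uD : expR u <= expR D.
    rewrite ler_expR /u ler_pdivrMr ?ltr0n //.
    by rewrite ler_peMr // ler1n.
  have : expR u <= 1 + u * expR u.
    have h1 := expR_ge1Dx (- u); have e1 := expRxMexpNx_1 u.
    have : expR u * (1 - u) <= expR u * expR (- u).
      by rewrite ler_wpM2l ?expR_ge0.
    by rewrite e1 mulrBr mulr1 (mulrC _ u); lra.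
  move=> h2; apply: le_trans (ler_wpM2l D0 h2) _.
  rewrite mulrDr mulr1 lerD2l.
  have -> : D ^+ 2 * expR D / N.+1%:R = D * (u * expR D) by rewrite /u; ring.
  by rewrite ler_wpM2l // ler_wpM2l.
apply/ler_addgt0Pr => e e0.
set K := D ^+ 2 * expR D in bound.
have K0 : 0 <= K by rewrite mulr_ge0 ?sqr_ge0 ?expR_ge0.
(* [N] is chosen so that the excess term [K / N.+1] is at most [e]. *)
pose N := Num.truncn (K / e).
apply: le_trans (bound N) _; rewrite lerD2l ler_pdivrMr ?ltr0n //.
rewrite mulrC -ler_pdivrMr //; apply/ltW.
exact: truncnS_gt.
Qed.

End distance.

(** * Derivatives of matrix curves *)

Section matrix_derivatives.
Variables (R : realType) (d : nat).
Implicit Types (c e : R -> 'M[R]_d) (A D E : 'M[R]_d) (t : R).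

Lemma is_derive_mxP c D t : is_derive t 1 c D <->
  forall i j, is_derive t 1 (fun s => c s i j) (D i j).
Proof.
split=> [cD i j|cD].
  have dc : derivable c t 1 by exact: ex_derive.
  apply: DeriveDef; first by move/derivable_mxP: dc; apply.
  by rewrite -(@derive_val _ _ _ _ _ _ _ cD) derive_mx // mxE.
have dc : derivable c t 1 by apply/derivable_mxP => i j; exact: ex_derive.
apply: DeriveDef => //; rewrite derive_mx //; apply/matrixP => i j.
by rewrite mxE derive_val.
Qed.

Lemma is_derive_mulmx c e D E t : is_derive t 1 c D -> is_derive t 1 e E ->
  is_derive t 1 (fun s => c s *m e s) (D *m e t + c t *m E).
Proof.
move=> /is_derive_mxP cD /is_derive_mxP eE; apply/is_derive_mxP => i j.
have -> : (fun s => (c s *m e s) i j) =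
    \sum_(k < d) ((fun s => c s i k) * (fun s => e s k j)).
  by apply/funext => s; rewrite mxE fct_sumE.
have h := (is_derive_sum (fun k => is_deriveM (cD i k) (eE k j))).
refine (is_derive_eq h _).
rewrite !mxE -big_split; apply: eq_bigr => k _ /=.
by rewrite [RHS]addrC [X in _ + X = _]mulrC.
Qed.

Lemma is_derive_mulmxl A c D t : is_derive t 1 c D ->
  is_derive t 1 (fun s => A *m c s) (A *m D).
Proof.
move=> cD; have := is_derive_mulmx (is_derive_cst A t 1) cD.
by rewrite mul0mx add0r.
Qed.

Lemma is_derive_mulmxr A c D t : is_derive t 1 c D ->
  is_derive t 1 (fun s => c s *m A) (D *m A).
Proof.
move=> cD; have := is_derive_mulmx cD (is_derive_cst A t 1).
by rewrite mulmx0 addr0.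
Qed.

Lemma is_derive_trmx c D t : is_derive t 1 c D ->
  is_derive t 1 (fun s => (c s)^T) D^T.
Proof.
move=> /is_derive_mxP cD; apply/is_derive_mxP => i j; rewrite mxE.
by under eq_fun do rewrite mxE.
Qed.

Lemma is_derive_mxtrace c D t : is_derive t 1 c D ->
  is_derive t 1 (fun s => \tr (c s)) (\tr D).
Proof.
move=> /is_derive_mxP cD; rewrite /mxtrace.
have -> : (fun s => \sum_i c s i i) = \sum_(i < d) (fun s => c s i i).
  by apply/funext => s; rewrite fct_sumE.
exact: is_derive_sum.
Qed.

End matrix_derivatives.

Section inverse_derivative.
Variable R : realType.
Implicit Type t : R.

Lemma derivable_big_sum (I : Type) (r : seq I) (f : I -> R -> R) t :
  (forall i, derivable (f i) t 1) ->
  derivable (fun s => \sum_(i <- r) f i s) t 1.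
Proof.
move=> df; elim: r => [|i r IH].
  by under eq_fun do rewrite big_nil; exact: derivable_cst.
by under eq_fun do rewrite big_cons; exact: derivableD.
Qed.

Lemma derivable_big_prod (I : Type) (r : seq I) (f : I -> R -> R) t :
  (forall i, derivable (f i) t 1) ->
  derivable (fun s => \prod_(i <- r) f i s) t 1.
Proof.
move=> df; elim: r => [|i r IH].
  by under eq_fun do rewrite big_nil; exact: derivable_cst.
by under eq_fun do rewrite big_cons; exact: derivableM.
Qed.

Lemma derivable_det n (c : R -> 'M[R]_n) t :
  (forall i j, derivable (fun s => c s i j) t 1) ->
  derivable (fun s => \det (c s)) t 1.
Proof.
move=> dc; apply: derivable_big_sum => p.
have h : derivable (fun s => \prod_(i < n) c s i (p i)) t 1.
  exact: (@derivable_big_prod _ _ (fun i s => c s i (p i))).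
pose e := (-1) ^+ p : R; exact: (derivableM (derivable_cst e t 1) h).
Qed.

Lemma near_unitmx d (c : R -> 'M[R]_d) t :
  c t \in unitmx -> derivable c t 1 -> \forall s \near t, c s \in unitmx.
Proof.
rewrite unitmxE unitfE => ut /derivable_mxP/(@derivable_det _ c t) dc.
have cc : {for t, continuous (fun s => \det (c s))}.
  by apply: differentiable_continuous; apply: (derivable1_diffP _ _).1.
have near_det := cvgr_neq0 (\det (c t)) cc ut.
near=> s; rewrite unitmxE unitfE; near: s; exact: near_det.
Unshelve. all: by end_near. Qed.

(** Cramer's rule: near [t] the entries of the inverse are quotients of
    polynomials in the entries of [c]. *)
Lemma derivable_invmx d (c : R -> 'M[R]_d) t :
  c t \in unitmx -> derivable c t 1 ->
  derivable (fun s => invmx (c s)) t 1.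
Proof.
move=> ut dc; have near_u := near_unitmx ut dc.
move/derivable_mxP: dc => dc; apply/derivable_mxP => i j.
pose g : R -> R := (fun s => (\det (c s))^-1) * (fun s => cofactor (c s) j i).
apply: (@near_eq_derivable _ _ _ g).
  by near=> s; rewrite /g /invmx (near near_u s) // !mxE.
apply: derivableM.
  apply: derivableV; last exact: derivable_det.
  by rewrite unitmxE unitfE in ut.
have h : derivable (fun s => \det (row' j (col' i (c s)))) t 1.
  by apply: derivable_det => k l; under eq_fun do rewrite !mxE; exact: dc.
pose e := (-1) ^+ (j + i) : R; exact: (derivableM (derivable_cst e t 1) h).
Unshelve. all: by end_near. Qed.

(** The product [c s *m invmx (c s)] is constant near [t]; solve the Leibniz
    rule. *)
Lemma is_derive_invmx d (c : R -> 'M[R]_d) D t :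
  c t \in unitmx -> is_derive t 1 c D ->
  is_derive t 1 (fun s => invmx (c s)) (- (invmx (c t) *m D *m invmx (c t))).
Proof.
move=> ut cD; have dc : derivable c t 1 by exact: ex_derive.
have iE := derivableP (derivable_invmx ut dc).
have h := is_derive_mulmx cD iE.
have near_u := near_unitmx ut dc.
have e1 : 'D_1 (fun s => c s *m invmx (c s)) t = 0.
  rewrite (near_eq_derive _ _ (g := cst 1%:M)) ?derive_cst //.
  by near=> s; rewrite mulmxV // (near near_u s).
have e : c t *m 'D_1 (fun s => invmx (c s)) t = - (D *m invmx (c t)).
  apply/eqP; rewrite -addr_eq0 addrC; apply/eqP.
  by rewrite -e1 (@derive_val _ _ _ _ _ _ _ h).
suff <- : 'D_1 (fun s => invmx (c s)) t = - (invmx (c t) *m D *m invmx (c t)) by [].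
by rewrite -[LHS](mulKmx ut) e mulmxN mulmxA.
Unshelve. all: by end_near. Qed.

Lemma is_derive0_cst d (c : R -> 'M[R]_d) :
  (forall t, is_derive t 1 c 0) -> forall t, c t = c 0.
Proof.
move=> c0 t; apply/matrixP => i j.
have h (s : R) : is_derive s 1 (fun s : R => c s i j) (0 : R).
  by have /is_derive_mxP/(_ i j) := c0 s; rewrite mxE.
exact: (@is_derive_0_is_cst R (fun s => c s i j) t 0 h).
Qed.

End inverse_derivative.

Section geodesic_derivative.
Variables (R : realType) (d : nat).
Implicit Types (G W : 'M[R]_d) (t : R).

Lemma is_derive_expmx W t : W^T = W ->
  is_derive t 1 (fun s => expmx (s *: W)) (W *m expmx (t *: W)).
Proof.
move=> symW; have [a [P [_ hP]]] := fcalc_projections symW.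
have -> : (fun s => expmx (s *: W)) =
    \sum_(i < d) (fun s : R => expR (s * a i) *: P i).
  by apply/funext => s; rewrite expmx_scale // hP fct_sumE.
have -> : W *m expmx (t *: W) = \sum_i (a i * expR (t * a i)) *: P i.
  by rewrite expmx_scale // -{1}(fcalc_id symW) fcalcM // hP.
apply: is_derive_sum => i.
apply/is_derive_mxP => k l; rewrite mxE.
have -> : (fun s => (expR (s * a i) *: P i) k l) = P i k l \*: (fun s => expR (s * a i)).
  by apply/funext => s; rewrite mxE mulrC.
have h := is_deriveZ (P i k l) (is_derive_expRM (a i) t).
by refine (is_derive_eq h _); rewrite -[LHS]/(_ * _) mulrC.
Qed.

Lemma is_derive_geod G W t : W^T = W ->
  is_derive t 1 (ai_geod G W) (unwhiten G (W *m expmx (t *: W))).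
Proof.
by move=> symW; apply/is_derive_mulmxr/is_derive_mulmxl/is_derive_expmx.
Qed.

End geodesic_derivative.

(** * The objective: strong convexity and gradient *)

Section objective.
Variables (R : realType) (d : nat).
Implicit Types (A B G M Z W T : 'M[R]_d) (s t : R).

(** The two whitened matrices are conjugate by the orthogonal matrix [isqrtmx
    A' *m T *m sqrtmx A]. *)
Lemma ai_dist_congr T A B : T \in unitmx -> spd A -> spd B ->
  ai_dist (T *m A *m T^T) (T *m B *m T^T) = ai_dist A B.
Proof.
move=> uT pA pB.
have pA' := spd_congr uT pA; have pB' := spd_congr uT pB.
set A' := T *m A *m T^T in pA' *; set B' := T *m B *m T^T in pB' *.
apply/eqP; rewrite -(eqrXn2 (isT : (0 < 2)%N)) ?frobn_ge0 //.
apply/eqP; rewrite !ai_dist_sqr //; apply/esym.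
pose Q := isqrtmx A' *m T *m sqrtmx A.
have QT : Q^T = sqrtmx A *m T^T *m isqrtmx A'.
  by rewrite !trmx_mul tr_sqrtmx // tr_isqrtmx // mulmxA.
have QQ : Q *m Q^T = 1%:M.
  rewrite QT /Q !mulmxA -(mulmxA _ (sqrtmx A) (sqrtmx A)) sqrtmxK //.
  by rewrite -(whiten1 pA') /whiten /A' !mulmxA.
have [uQ _] := mulmx1_unit QQ.
apply: (@tr_fcalc_similar _ _ _ _ Q) => //.
- by apply/spd_sym; exact: spd_whiten.
- by apply/spd_sym; exact: spd_whiten.
rewrite -[LHS]mulmx1 -(mulmx1C QQ) mulmxA; congr (_ *m _).
rewrite QT /Q /whiten /B' !mulmxA -(mulmxA _ (sqrtmx A) (isqrtmx A)) sqrtmxVK // mulmx1.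
by rewrite -(mulmxA _ (isqrtmx A) (sqrtmx A)) isqrtmxK // mulmx1.
Qed.

Lemma ai_dist_unwhiten G A B : spd G -> spd A -> spd B ->
  ai_dist (unwhiten G A) (unwhiten G B) = ai_dist A B.
Proof.
move=> pG pA pB; rewrite /unwhiten -{2 4}(tr_sqrtmx pG) ai_dist_congr //.
by apply: spd_unit; exact: spd_sqrtmx.
Qed.

(** Whitening by [G] moves [G] to the identity, where the metric increasing
    property compares [ai_dist] with the Euclidean distance between
    logarithms; expanding the square gives the bound. The linear term is minus
    the inner product with the gradient, so this is strong convexity with
    constant 1. *)
Lemma objective_strongly_convex M G W : spd M -> spd G -> W^T = W ->
  objective M G - frob (logmx (whiten G M)) W + 2^-1 * frob W W
    <= objective M (unwhiten G (expmx W)).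
Proof.
move=> pM pG symW; have pw := spd_whiten pG pM.
set H := logmx (whiten G M).
have symH : H^T = H by exact: tr_logmx.
have -> : objective M (unwhiten G (expmx W)) =
    2^-1 * ai_dist (expmx W) (expmx H) ^+ 2.
  rewrite /objective -{1}(whitenK M pG) ai_dist_unwhiten ?logmxK //.
  exact: spd_expmx.
have -> : objective M G = 2^-1 * frob H H by rewrite -frobn_sqr.
have := exponential_metric_increasing (spd_expmx symW) (spd_expmx symH).
rewrite !logmx_expmx // -(ler_pXn2r (isT : (0 < 2)%N)) ?nnegrE ?frobn_ge0 //.
rewrite frobn_sqr frobBl !frobBr (frobC W H); lra.
Qed.

(** The first-order expansion of half the squared logarithm, with a remainder
    uniform in [y] away from 0. *)
Lemma log_sqr_taylor (x y ep La : R) : 0 < ep -> ep <= x -> ep <= y -> `|ln x| <= La ->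
  `|2^-1 * ln y ^+ 2 - 2^-1 * ln x ^+ 2 - ln x / x * (y - x)|
    <= (2^-1 + La) / ep ^+ 2 * (x - y) ^+ 2.
Proof.
move=> ep0 xe ye lx; have x0 := lt_le_trans ep0 xe; have y0 := lt_le_trans ep0 ye.
set u := ln x; set v := ln y; set q := (x - y) ^+ 2 / ep ^+ 2.
have La0 : 0 <= La := le_trans (normr_ge0 _) lx.
have q1 : (x - y) ^+ 2 / (x * y) <= q.
  rewrite ler_wpM2l ?sqr_ge0 // lef_pV2 ?posrE ?mulr_gt0 ?exprn_gt0 //.
  by rewrite expr2 ler_pM // ltW.
(* The remainder is controlled through [ln z <= z - 1] at [x / y] and
   [y / x]. *)
have lnB (z : R) : 0 < z -> ln z <= z - 1.
  by move=> z0; have := expR_ge1Dx (ln z); rewrite lnK ?posrE //; lra.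
have uv : u - v <= x / y - 1 by rewrite -ln_div ?posrE // lnB ?divr_gt0.
have vu : v - u <= y / x - 1 by rewrite -ln_div ?posrE // lnB ?divr_gt0.
have r2 : `|v - u - (y - x) / x| <= q.
  have -> : (y - x) / x = y / x - 1 by rewrite mulrBl divff ?gt_eqF.
  rewrite ler0_norm; last by lra.
  apply: le_trans q1.
  have -> : (x - y) ^+ 2 / (x * y) = x / y + y / x - 2.
    by field; rewrite !gt_eqF.
  by lra.
have r1 : (v - u) ^+ 2 <= q.
  have := ln_diff_sqr y0 x0; rewrite -/u -/v => h; apply: le_trans h _.
  apply: le_trans q1; rewrite le_eqVlt; apply/orP; left; apply/eqP.
  by field; rewrite !gt_eqF.
have -> : 2^-1 * v ^+ 2 - 2^-1 * u ^+ 2 - u / x * (y - x) =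
    2^-1 * (v - u) ^+ 2 + u * (v - u - (y - x) / x).
  by field; rewrite gt_eqF.
have -> : (2^-1 + La) / ep ^+ 2 * (x - y) ^+ 2 = 2^-1 * q + La * q.
  by rewrite /q; ring.
apply: le_trans (ler_normD _ _) _; rewrite ger0_norm; last first.
  by apply: mulr_ge0; [rewrite invr_ge0|exact: sqr_ge0].
apply: lerD; first by rewrite ler_wpM2l.
by rewrite normrM ler_pM.
Qed.

Lemma spdD A B : spd A -> spd B -> spd (A + B).
Proof.
move=> [/symsetE sA pA] [/symsetE sB pB]; split.
  by apply/symsetE; rewrite linearD /= sA sB.
by move=> x x0; rewrite mulmxDr mulmxDl mxE addr_gt0 ?pA ?pB.
Qed.

Lemma spd_fcalc_addr A c : A^T = A -> (forall x, eigenvalue A x -> 0 < x + c) ->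
  spd (A + c%:M).
Proof.
move=> symA h; rewrite -{1}(fcalc_id symA) -(fcalc_cst c symA) fcalcD //.
exact: spd_fcalc.
Qed.

Lemma eigenvalue_subr A c x : eigenvalue A x -> eigenvalue (A - c%:M) (x - c).
Proof.
move=> /eigenvalueP[v vA v0]; apply/eigenvalueP; exists v => //.
by rewrite mulmxBr vA mul_mx_scalar scalerBl.
Qed.

(** [B - ep%:M] is the sum of two positive definite matrices, [A] minus a
    multiple of the identity and [B - A] plus a smaller one. Besides openness
    this gives a lower bound on the spectrum that is uniform near [A]. *)
Lemma spd_open A : spd A -> exists2 ep, 0 < ep &
  forall B, B^T = B -> frobn (B - A) <= ep ->
    forall x, eigenvalue B x -> ep <= x.
Proof.
move=> pA; have symA := spd_sym pA.
(* A quarter of the smallest of 1 and the eigenvalues of [A]: three quarters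
   are taken from [A], and two are given to [B - A]. *)
have [ep ep0 epA] : exists2 ep, 0 < ep & forall x, eigenvalue A x -> ep *+ 4 <= x.
  have [U [a [UU AE _ eva]]] := sym_spectral symA.
  pose m := \big[Num.min/1]_i a 0 i.
  have m0 : 0 < m.
    rewrite /m; elim/big_ind: _ => // [x y x0 y0|i _].
      by rewrite lt_min x0.
    exact: spd_eigenvalue pA (eva i).
  exists (m / 4); first by rewrite divr_gt0.
  move=> x; rewrite {1}AE => evx; case: ((eigenvalue_diag _ x UU).1 evx) => i ->.
  have -> : m / 4 *+ 4 = m by rewrite -mulr_natr mulfVK ?pnatr_eq0.
  exact: bigmin_le.
exists ep => // B symB BA x evx.
have p1 : spd (A + (- (ep *+ 3))%:M).
  by apply: spd_fcalc_addr => // y /epA; rewrite !mulrS mulr0n; lra.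
have symBA : (B - A)^T = B - A by rewrite linearB /= symA symB.
have p2 : spd (B - A + (ep *+ 2)%:M).
  apply: spd_fcalc_addr => // y /(eigenvalue_le_frobn symBA) h.
  by have := le_trans h BA; rewrite ler_norml mulr2n; lra.
have p3 : spd (B - ep%:M).
  suff -> : B - ep%:M = (B - A + (ep *+ 2)%:M) + (A + (- (ep *+ 3))%:M) by exact: spdD.
  rewrite -addrA (addrCA _ A) addrA subrK -raddfD -raddfN /=; congr (_ + _%:M).
  by rewrite !mulrS mulr0n; ring.
by have := spd_eigenvalue p3 (eigenvalue_subr ep evx); lra.
Qed.

Lemma fcalc_eigenvalue A h x : A^T = A -> eigenvalue A x ->
  eigenvalue (fcalc h A) (h x).
Proof.
move=> symA evx; have [U [a [UU AE hA _]]] := sym_spectral symA.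
rewrite hA; apply/(eigenvalue_diag _ _ UU).
rewrite AE in evx; case: ((eigenvalue_diag _ x UU).1 evx) => i ->.
by exists i; rewrite mxE.
Qed.

Lemma objectiveE M G : spd M -> spd G ->
  objective M G = \tr (fcalc (fun x => 2^-1 * ln x ^+ 2) (whiten M G)).
Proof.
move=> pM pG; have pw := spd_whiten pM pG.
by rewrite /objective ai_distC // ai_dist_sqr // -fcalcZ ?linearZ //; exact: spd_sym.
Qed.

(** [log_sqr_taylor] produces the gradient as a function of [whiten M G]; by
    [whiten_factor] it can be rewritten through [whiten G M], the matrix from
    which the search direction is computed. *)
Lemma frob_whiten_log M G D : spd M -> spd G ->
  frob (fcalc (fun x => ln x / x) (whiten M G)) (whiten M D) =
  - frob (logmx (whiten G M)) (whiten G D).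
Proof.
move=> pM pG; have pB := spd_whiten pM pG; have pC := spd_whiten pG pM.
have [CE BE] := whiten_factor pG pM.
pose Y := isqrtmx G *m sqrtmx M; rewrite -/Y in CE BE.
have YT : Y^T = sqrtmx M *m isqrtmx G.
  by rewrite trmx_mul tr_sqrtmx // tr_isqrtmx.
have symB := spd_sym pB; have symC := spd_sym pC.
have -> : fcalc (fun x => ln x / x) (whiten M G) =
    - (Y^T *m (logmx (whiten G M) *m Y)).
  have symI := spd_sym (spd_invmx pB).
  rewrite logmx_fcalc // -(fcalc_intertwine _ symI symC); last first.
    by rewrite BE CE mulmxA.
  rewrite mulmxA -BE -[X in X *m _](fcalc_id symI) fcalcM //.
  rewrite -scaleN1r fcalcZ // invmx_fcalc // fcalc_comp //.
  apply: eq_fcalc => // x /(spd_eigenvalue pB) x0 /=.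
  by rewrite lnV ?posrE //; ring.
have YTi : Y *m isqrtmx M = isqrtmx G by rewrite /Y -mulmxA sqrtmxVK // mulmx1.
have TiY : isqrtmx M *m Y^T = isqrtmx G by rewrite YT mulmxA isqrtmxK // mul1mx.
clearbody Y; rewrite frobNl; congr (- _); rewrite /frob !trmx_mul trmxK (tr_logmx pC) /whiten.
set L := logmx _.
transitivity (\tr (Y^T *m (L *m (Y *m isqrtmx M) *m D *m isqrtmx M))).
  by congr (\tr _); rewrite !mulmxA.
by rewrite YTi mxtrace_mulC mulmxA -(mulmxA _ (isqrtmx M)) TiY !mulmxA.
Qed.

(** The objective is a spectral trace of [whiten M G], so [trace_fcalc_taylor]
    applies with the scalar expansion [log_sqr_taylor]; [spd_open] keeps the
    spectra away from 0. *)
Lemma objective_taylor M G : spd M -> spd G -> exists K delta : R,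
  [/\ 0 <= K, 0 < delta & forall G', spd G' -> frobn (G' - G) <= delta ->
  `|objective M G' - objective M G + frob (logmx (whiten G M)) (whiten G (G' - G))|
     <= K * frobn (G' - G) ^+ 2].
Proof.
move=> pM pG; set B := whiten M G.
have pB : spd B by exact: spd_whiten.
have [ep ep0 epB] := spd_open pB.
set c := frobn (isqrtmx M); have c0 : 0 <= c := frobn_ge0 _.
have wc Z : frobn (whiten M Z) <= c ^+ 2 * frobn Z.
  rewrite /whiten; apply: le_trans (frobn_mul _ _) _.
  rewrite -/c mulrC expr2 -mulrA ler_wpM2l //.
  exact: frobn_mul.
set La := frobn (logmx B); have La0 : 0 <= La := frobn_ge0 _.
set K0 := (2^-1 + La) / ep ^+ 2.
have K00 : 0 <= K0 by rewrite divr_ge0 ?sqr_ge0 // addr_ge0.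
exists (K0 * (c ^+ 2) ^+ 2), (ep / (c ^+ 2 + 1)).
have c1 : 0 < c ^+ 2 + 1 by rewrite ltr_wpDl ?sqr_ge0.
split; [by rewrite mulr_ge0 ?sqr_ge0|by rewrite divr_gt0|].
move=> G' pG' Gd; have pB' := spd_whiten pM pG'.
have wB : whiten M G' - B = whiten M (G' - G).
  by rewrite /B /whiten mulmxBr mulmxBl.
have BB : frobn (whiten M G' - B) <= ep.
  rewrite wB; apply: le_trans (wc _) _.
  rewrite ler_pdivlMr // in Gd; apply: le_trans Gd.
  by rewrite mulrC ler_wpM2l ?frobn_ge0 // lerDl.
have symB := spd_sym pB; have symB' := spd_sym pB'.
rewrite !objectiveE // -[X in `|_ + X|]opprK -frob_whiten_log // -/B -wB.
have := @trace_fcalc_taylor _ _ _ _ (fun x => 2^-1 * ln x ^+ 2) (fun x => ln x / x) K0 symB symB' _.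
move=> /(_ _)/le_trans; apply.
  move=> x y evx evy; apply: log_sqr_taylor => //.
  - by apply: (epB B) => //; rewrite subrr frobn0 ltW.
  - exact: (epB (whiten M G')).
  - have symL : (logmx B)^T = logmx B by exact: tr_logmx.
    apply: (eigenvalue_le_frobn symL).
    by rewrite /= logmx_fcalc // fcalc_eigenvalue.
rewrite -(mulrA K0) ler_wpM2l // frobnB -exprMn ler_pXn2r ?nnegrE ?mulr_ge0 ?frobn_ge0 ?sqr_ge0 //.
by rewrite wB.
Qed.

End objective.

Section derivative_of_objective.
Variables (R : realType) (d : nat).
Implicit Types (M G D N : 'M[R]_d) (t : R).

Lemma is_derive_locally_lipschitz (c : R -> 'M[R]_d) D t : is_derive t 1 c D ->
  exists K delta : R, [/\ 0 <= K, 0 < delta & forall s, `|s - t| < delta ->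
    frobn (c s - c t) <= K * `|s - t|].
Proof.
move=> cD; have dc : derivable c t 1 by exact: ex_derive.
have : h^-1 *: (c (h *: 1 + t) - c t) @[h --> 0^'] --> D.
  by rewrite -(@derive_val _ _ _ _ _ _ _ cD).
move=> /cvgrPdist_le/(_ 1 ltr01)[/= delta delta0 hd].
exists (d%:R * (`|D| + 1)), delta; split=> // s sd.
have [->|st] := eqVneq s t; first by rewrite !subrr frobn0 normr0 mulr0.
have st0 : s - t != 0 by rewrite subr_eq0.
have := hd (s - t); rewrite /= sub0r normrN => /(_ sd st0).
rewrite -[_ *: 1]/(_ * 1) mulr1 subrK => h.
have {}h : `|(s - t)^-1 *: (c s - c t)| <= `|D| + 1.
  rewrite -[X in `|X|](subrK D) addrC; apply: le_trans (ler_normD _ _) _.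
  by rewrite lerD2l distrC.
apply: le_trans (frobn_le_norm _) _; rewrite -mulrA ler_wpM2l //.
by rewrite normrZ normfV mulrC ler_pdivrMr ?normr_gt0 // in h.
Qed.

Lemma is_derive_quadratic (g : R -> R) t K delta : 0 < delta -> g t = 0 ->
  (forall s, `|s - t| < delta -> `|g s| <= K * `|s - t| ^+ 2) ->
  is_derive t 1 g 0.
Proof.
move=> delta0 gt0 gK.
have cv : h^-1 *: (g (h *: 1 + t) - g t) @[h --> 0^'] --> (0 : R).
  apply/cvgrPdist_le => /= e e0; near=> h.
  rewrite sub0r normrN gt0 subr0 -[h *: 1]/(h * 1) mulr1.
  have hd : `|h + t - t| < delta.
    by rewrite addrK; near: h; exact: dnbhs0_lt.
  have h0 : h != 0 by near: h; exact: nbhs_dnbhs_neq.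
  have := gK _ hd; rewrite addrK => gh.
  rewrite -[_ *: _]/(_ * _) normrM normfV mulrC ler_pdivrMr ?normr_gt0 //.
  apply: le_trans gh _; rewrite expr2 mulrA ler_wpM2r //.
  have hK : `|h| < e / (`|K| + 1).
    by near: h; apply: dnbhs0_lt; rewrite divr_gt0 // ltr_wpDl.
  rewrite ltr_pdivlMr ?ltr_wpDl // in hK; apply: le_trans (ltW hK).
  rewrite mulrC ler_wpM2l // (le_trans (ler_norm _)) // lerDl //.
apply: DeriveDef; first by apply/cvg_ex; exists 0.
exact: cvg_lim cv.
Unshelve. all: by end_near. Qed.

Lemma is_derive_frob (c : R -> 'M[R]_d) D N t : is_derive t 1 c D ->
  is_derive t 1 (fun s => frob N (c s)) (frob N D).
Proof. by move=> cD; apply/is_derive_mxtrace/is_derive_mulmxl. Qed.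

(** The remainder in [objective_taylor] is quadratic, so differentiability of
    [c] at the single time [t] suffices. *)
Lemma is_derive_objective M (c : R -> 'M[R]_d) D t : spd M ->
  (forall s, spd (c s)) -> is_derive t 1 c D ->
  is_derive t 1 (fun s => objective M (c s))
    (- frob (logmx (whiten (c t) M)) (whiten (c t) D)).
Proof.
move=> pM pc cD; set G := c t; set H := logmx (whiten G M).
have [K [delta [K0 delta0 hK]]] := objective_taylor pM (pc t).
have [C [rho [C0 rho0 hC]]] := is_derive_locally_lipschitz cD.
pose g s := objective M (c s) - objective M G + frob H (whiten G (c s - G)).
pose eps := Num.min rho (delta / (C + 1)).
have g0 : is_derive t 1 g 0.
  apply: (@is_derive_quadratic _ _ (K * C ^+ 2) eps).
  - by rewrite lt_min rho0 divr_gt0 // ltr_wpDl.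
  - by rewrite /g subrr add0r subrr /whiten mulmx0 mul0mx /frob mulmx0 mxtrace0.
  - move=> s; rewrite lt_min => /andP[s1 s2].
    have h := hC s s1.
    apply: le_trans (hK _ (pc s) _) _.
      apply: le_trans h _; rewrite ltr_pdivlMr ?ltr_wpDl // in s2.
      apply: le_trans (ltW s2); rewrite mulrC ler_wpM2l // lerDl //.
    rewrite -mulrA ler_wpM2l // -exprMn ler_pXn2r ?nnegrE ?frobn_ge0 //.
    by rewrite mulr_ge0.
have w0 : is_derive t 1 (fun s => frob H (whiten G (c s - G))) (frob H (whiten G D)).
  apply: is_derive_frob; apply: is_derive_mulmxr; apply: is_derive_mulmxl.
  by have := is_deriveB cD (is_derive_cst G t 1); rewrite subr0.
have := is_deriveB g0 w0; rewrite sub0r.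
have -> : (fun s => objective M (c s)) = cst (objective M G) +
    (g - (fun s => frob H (whiten G (c s - G)))).
  by apply/funext => s; rewrite /g !fctE /=; ring.
by move=> h; have := is_deriveD (is_derive_cst (objective M G) t 1) h; rewrite add0r.
Qed.

End derivative_of_objective.

(** * The Kronecker family and its logarithms *)

Section kronecker.
Variables (R : realType) (m n : nat).
Implicit Types (X A U : 'M[R]_m) (Y B Q : 'M[R]_n) (G W Z V : 'M[R]_(n * m)).

Local Notation K := (@kronecker_family R m n).
Local Notation L := (@log_kronecker R m n).

Lemma tens1 : (1%:M : 'M[R]_n) *t (1%:M : 'M[R]_m) = 1%:M.
Proof.
apply/matrixP => i j; case: (mxtens_indexP i) => i0 i1.
case: (mxtens_indexP j) => j0 j1; rewrite tensmxE !mxE -natrM mulnb.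
by rewrite (can_eq (@mxtens_indexK n m)).
Qed.

Definition tens_row (f : R -> R -> R) (b : 'rV[R]_n) (a : 'rV[R]_m) :
    'rV[R]_(n * m) :=
  \row_k f (b 0 (mxtens_unindex k).1) (a 0 (mxtens_unindex k).2).

Lemma tens_diag b a :
  diag_mx b *t diag_mx a = diag_mx (tens_row *%R b a) :> 'M[R]_(n * m).
Proof.
apply/matrixP => i j; case: (mxtens_indexP i) => i0 i1.
case: (mxtens_indexP j) => j0 j1; rewrite tensmxE !mxE mxtens_indexK /=.
rewrite (can_eq (@mxtens_indexK n m)) xpair_eqE.
by case: (i0 == j0); case: (i1 == j1); rewrite ?mulr0n ?mul0r ?mulr0.
Qed.

Lemma tens_diag_add b a :
  (1%:M : 'M[R]_n) *t diag_mx a + diag_mx b *t (1%:M : 'M[R]_m) =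
  diag_mx (tens_row +%R b a) :> 'M[R]_(n * m).
Proof.
apply/matrixP => i j; case: (mxtens_indexP i) => i0 i1.
case: (mxtens_indexP j) => j0 j1; rewrite mxE !tensmxE !mxE mxtens_indexK /=.
rewrite (can_eq (@mxtens_indexK n m)) xpair_eqE.
case: (i0 == j0); case: (i1 == j1);
  by rewrite /= ?mulr0n ?mulr1n ?mul0r ?mulr0 ?mul1r ?mulr1 ?addr0 // addrC.
Qed.

Lemma tens_orthogonal Q U : Q^T *m Q = 1%:M -> U^T *m U = 1%:M ->
  (Q *t U)^T *m (Q *t U) = 1%:M.
Proof. by move=> QQ UU; rewrite trmx_tens tensmx_mul QQ UU tens1. Qed.

(** The tensor products of eigenvectors diagonalize the sum with sums of
    eigenvalues, which the exponential turns into products. *)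
Lemma expmx_tens X Y : X^T = X -> Y^T = Y ->
  expmx ((1%:M : 'M[R]_n) *t X + Y *t (1%:M : 'M[R]_m)) = expmx Y *t expmx X.
Proof.
move=> symX symY; have [U [a [UU XE hX _]]] := sym_spectral symX.
have [Q [b [QQ YE hY _]]] := sym_spectral symY.
have QU := tens_orthogonal QQ UU.
have E : (1%:M : 'M[R]_n) *t X + Y *t (1%:M : 'M[R]_m) =
    (Q *t U) *m diag_mx (tens_row +%R b a) *m (Q *t U)^T.
  rewrite -tens_diag_add mulmxDr mulmxDl trmx_tens !tensmx_mul !mulmx1.
  by rewrite (mulmx1C QQ) (mulmx1C UU) -XE -YE.
rewrite expmx_fcalc; last by rewrite E tr_diag_form.
rewrite E fcalc_diag // !expmx_fcalc // hX hY -!tensmx_mul -trmx_tens tens_diag.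
by congr (_ *m diag_mx _ *m _); apply/rowP => k; rewrite !mxE expRD.
Qed.

Lemma log_kronecker_sym W : L W -> W^T = W.
Proof.
case=> X [Y [/symsetE sX /symsetE sY ->]].
by rewrite linearD /= !trmx_tens !trmx1 sX sY.
Qed.

(** With [kronecker_log], the exponential maps the linear space [L] onto the
    Kronecker family. *)
Lemma log_kronecker_exp W : L W -> K (expmx W).
Proof.
case=> X [Y [/symsetE sX /symsetE sY ->]]; exists (expmx X), (expmx Y).
by rewrite expmx_tens //; split=> //; exact: spd_expmx.
Qed.

Lemma kronecker_log G : K G -> exists2 W, L W & G = expmx W.
Proof.
case=> A [B [pA pB ->]].
have sA := tr_logmx pA; have sB := tr_logmx pB.
exists ((1%:M : 'M[R]_n) *t logmx A + logmx B *t (1%:M : 'M[R]_m)).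
  by exists (logmx A), (logmx B); split=> //; exact/symsetE.
by rewrite expmx_tens // !logmxK.
Qed.

Lemma kronecker_spd G : K G -> spd G.
Proof. by move=> /kronecker_log[W /log_kronecker_sym sW ->]; exact: spd_expmx. Qed.

Lemma kronecker_logmx G : K G -> L (logmx G).
Proof.
by move=> /kronecker_log[W LW ->]; rewrite logmx_expmx //; exact: log_kronecker_sym.
Qed.

Lemma tensDl (p q : nat) (A1 A2 : 'M[R]_p) (B1 : 'M[R]_q) :
  (A1 + A2) *t B1 = A1 *t B1 + A2 *t B1.
Proof. by apply/matrixP => i j; rewrite !mxE mulrDl. Qed.

Lemma tensDr (p q : nat) (A1 : 'M[R]_p) (B1 B2 : 'M[R]_q) :
  A1 *t (B1 + B2) = A1 *t B1 + A1 *t B2.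
Proof. by apply/matrixP => i j; rewrite !mxE mulrDr. Qed.

Lemma tensZl (p q : nat) t (A1 : 'M[R]_p) (B1 : 'M[R]_q) :
  (t *: A1) *t B1 = t *: (A1 *t B1).
Proof. by apply/matrixP => i j; rewrite !mxE mulrA. Qed.

Lemma tensZr (p q : nat) t (A1 : 'M[R]_p) (B1 : 'M[R]_q) :
  A1 *t (t *: B1) = t *: (A1 *t B1).
Proof. by apply/matrixP => i j; rewrite !mxE mulrCA. Qed.

Lemma log_kroneckerD W V : L W -> L V -> L (W + V).
Proof.
case=> X [Y [/symsetE sX /symsetE sY ->]].
case=> X' [Y' [/symsetE sX' /symsetE sY' ->]].
exists (X + X'), (Y + Y'); split; [apply/symsetE|apply/symsetE|].
- by rewrite linearD /= sX sX'.
- by rewrite linearD /= sY sY'.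
by rewrite tensDr tensDl addrACA.
Qed.

Lemma log_kroneckerZ t W : L W -> L (t *: W).
Proof.
case=> X [Y [/symsetE sX /symsetE sY ->]].
exists (t *: X), (t *: Y); split; [apply/symsetE|apply/symsetE|].
- by rewrite linearZ /= sX.
- by rewrite linearZ /= sY.
by rewrite tensZr tensZl scalerDr.
Qed.

Lemma log_kroneckerN W : L W -> L (- W).
Proof. by rewrite -scaleN1r; exact: log_kroneckerZ. Qed.

Lemma log_kroneckerB W V : L W -> L V -> L (W - V).
Proof. by move=> LW LV; apply: log_kroneckerD => //; exact: log_kroneckerN. Qed.

Lemma log_kronecker1 : L 1%:M.
Proof.
exists 1%:M, 0; split; [apply/symsetE; exact: trmx1|apply/symsetE; exact: trmx0|].
by rewrite tens0mx addr0 tens1.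
Qed.

Lemma log_kronecker0 : L 0.
Proof. by rewrite -(subrr 1%:M); apply: log_kroneckerB; exact: log_kronecker1. Qed.

(** Congruence by members of the family is what whitening, geodesics and
    parallel transport are made of, so all of them stay in the family. *)
Lemma kronecker_congr S G : K S -> K G -> K (S *m G *m S).
Proof.
case=> A [B [pA pB ->]] [A' [B' [pA' pB' ->]]].
exists (A *m A' *m A), (B *m B' *m B); rewrite !tensmx_mul; split=> //.
  by rewrite -{2}(spd_sym pA); apply: spd_congr => //; exact: spd_unit.
by rewrite -{2}(spd_sym pB); apply: spd_congr => //; exact: spd_unit.
Qed.

Lemma sqrtmx_exp (d : nat) (G : 'M[R]_d) : spd G ->
  sqrtmx G = expmx (2^-1 *: logmx G).
Proof.
move=> pG; have sL := tr_logmx pG; apply: sqrtmx_eq => //.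
  by apply: spd_expmx; rewrite linearZ /= sL.
rewrite expmxD // (_ : 2^-1 + 2^-1 = 1) ?scale1r ?logmxK //.
by rewrite [RHS](splitr 1) mul1r.
Qed.

Lemma isqrtmx_exp (d : nat) (G : 'M[R]_d) : spd G ->
  isqrtmx G = expmx ((- 2^-1) *: logmx G).
Proof.
move=> pG; have sL := tr_logmx pG.
rewrite -[LHS]mulmx1 -expmx0 -(scale0r (logmx G)) -(subrr 2^-1) -expmxD //.
by rewrite -sqrtmx_exp // mulmxA isqrtmxK // mul1mx.
Qed.

Lemma kronecker_sqrtmx G : K G -> K (sqrtmx G).
Proof.
move=> KG; rewrite sqrtmx_exp; last exact: kronecker_spd.
by apply/log_kronecker_exp/log_kroneckerZ/kronecker_logmx.
Qed.

Lemma kronecker_isqrtmx G : K G -> K (isqrtmx G).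
Proof.
move=> KG; rewrite isqrtmx_exp; last exact: kronecker_spd.
by apply/log_kronecker_exp/log_kroneckerZ/kronecker_logmx.
Qed.

Lemma kronecker_whiten G G' : K G -> K G' -> K (whiten G G').
Proof. by move=> KG KG'; apply: kronecker_congr => //; exact: kronecker_isqrtmx. Qed.

Lemma kronecker_unwhiten G G' : K G -> K G' -> K (unwhiten G G').
Proof. by move=> KG KG'; apply: kronecker_congr => //; exact: kronecker_sqrtmx. Qed.

Lemma kronecker_geod G W t : K G -> L W -> K (ai_geod G W t).
Proof.
by move=> KG LW; apply/kronecker_unwhiten/log_kronecker_exp/log_kroneckerZ.
Qed.

End kronecker.

(** * Projection onto the log-Kronecker subspace *)

Section projection.
Variables (R : realType) (m n : nat).
Hypotheses (hm : (1 <= m)%N) (hn : (1 <= n)%N).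
Implicit Types (X A : 'M[R]_m) (Y B : 'M[R]_n) (G W Z V : 'M[R]_(n * m)).

Local Notation K := (@kronecker_family R m n).
Local Notation L := (@log_kronecker R m n).

(** The adjoint of the embedding of [X] as the tensor product with the
    identity, see [frob_tens1l]; the other partial trace is adjoint to the
    other embedding. *)
Definition ptrace_l Z : 'M[R]_m :=
  \matrix_(i, j) \sum_k Z (mxtens_index (k, i)) (mxtens_index (k, j)).

Definition ptrace_r Z : 'M[R]_n :=
  \matrix_(k, l) \sum_i Z (mxtens_index (k, i)) (mxtens_index (l, i)).

Lemma sum_mxtens (F : 'I_(n * m) -> R) :
  \sum_p F p = \sum_k \sum_i F (mxtens_index (k, i)).
Proof.
rewrite pair_big /= (reindex (@mxtens_index n m)) /=; last first.
  by exists (@mxtens_unindex n m) => p _; rewrite ?mxtens_indexK ?mxtens_unindexK.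
by apply: eq_bigr => -[k i] _.
Qed.

Lemma frob_tens1l Z X : frob Z ((1%:M : 'M[R]_n) *t X) = frob (ptrace_l Z) X.
Proof.
rewrite !frobE -!(pair_bigA _ (fun i j => _ i j * _ i j)) sum_mxtens /=.
rewrite exchange_big; apply: eq_bigr => i _ /=.
under eq_bigr do rewrite sum_mxtens.
transitivity (\sum_k \sum_j Z (mxtens_index (k, i)) (mxtens_index (k, j)) * X i j).
  apply: eq_bigr => k _; rewrite (bigD1 k) //= [X in _ + X]big1 ?addr0 => [|l lk].
    by apply: eq_bigr => j _; rewrite tensmxE mxE eqxx mul1r.
  by apply: big1 => j _; rewrite tensmxE mxE eq_sym (negbTE lk) mul0r mulr0.
by rewrite exchange_big; apply: eq_bigr => j _; rewrite mxE mulr_suml.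
Qed.

Lemma frob_tens1r Z Y : frob Z (Y *t (1%:M : 'M[R]_m)) = frob (ptrace_r Z) Y.
Proof.
rewrite !frobE -!(pair_bigA _ (fun i j => _ i j * _ i j)) sum_mxtens /=.
apply: eq_bigr => k _; under eq_bigr do rewrite sum_mxtens.
rewrite exchange_big; apply: eq_bigr => l _ /=; rewrite mxE mulr_suml.
apply: eq_bigr => i _; rewrite (bigD1 i) //= big1 ?addr0 => [|j ji].
  by rewrite tensmxE mxE eqxx mulr1.
by rewrite tensmxE mxE eq_sym (negbTE ji) !mulr0.
Qed.

Lemma ptrace_l_tens B A : ptrace_l (B *t A) = \tr B *: A.
Proof.
by apply/matrixP => i j; rewrite !mxE mulr_suml; apply: eq_bigr => k _; rewrite tensmxE.
Qed.

Lemma ptrace_r_tens B A : ptrace_r (B *t A) = \tr A *: B.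
Proof.
apply/matrixP => i j; rewrite !mxE mulr_suml; apply: eq_bigr => k _.
by rewrite tensmxE mulrC.
Qed.

Lemma ptrace_lD Z V : ptrace_l (Z + V) = ptrace_l Z + ptrace_l V.
Proof.
by apply/matrixP => i j; rewrite !mxE -big_split; apply: eq_bigr => k _; rewrite mxE.
Qed.

Lemma ptrace_rD Z V : ptrace_r (Z + V) = ptrace_r Z + ptrace_r V.
Proof.
by apply/matrixP => i j; rewrite !mxE -big_split; apply: eq_bigr => k _; rewrite mxE.
Qed.

Lemma tr_ptrace_l Z : (ptrace_l Z)^T = ptrace_l Z^T.
Proof. by apply/matrixP => i j; rewrite !mxE; apply: eq_bigr => k _; rewrite mxE. Qed.

Lemma tr_ptrace_r Z : (ptrace_r Z)^T = ptrace_r Z^T.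
Proof. by apply/matrixP => i j; rewrite !mxE; apply: eq_bigr => k _; rewrite mxE. Qed.

Lemma frobC1 (d : nat) (C : 'M[R]_d) : frob C 1%:M = \tr C.
Proof. by rewrite frobC frob_tr. Qed.

Lemma trace_ptrace_l Z : \tr (ptrace_l Z) = \tr Z.
Proof. by rewrite -frobC1 -frob_tens1l tens1 frobC1. Qed.

Lemma trace_ptrace_r Z : \tr (ptrace_r Z) = \tr Z.
Proof. by rewrite -frobC1 -frob_tens1r tens1 frobC1. Qed.

Definition sym_part Z : 'M[R]_(n * m) := 2^-1 *: (Z + Z^T).

(** The orthogonal projection onto [L]. Both embedded partial traces contain
    the projection onto the line of the identity, which is therefore
    subtracted once. *)
Definition kproj Z : 'M[R]_(n * m) :=
  let S := sym_part Z in
  (1%:M : 'M[R]_n) *t (n%:R^-1 *: ptrace_l S) +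
  (m%:R^-1 *: ptrace_r S - (\tr S / (n%:R * m%:R)) *: 1%:M) *t (1%:M : 'M[R]_m).

Lemma tr_sym_part Z : (sym_part Z)^T = sym_part Z.
Proof. by rewrite /sym_part linearZ linearD /= trmxK addrC. Qed.

Lemma frob_sym_part Z W : W^T = W -> frob (sym_part Z) W = frob Z W.
Proof.
move=> symW; rewrite frobZl frobDl /frob trmxK.
have -> : \tr (Z *m W) = \tr (Z^T *m W).
  by rewrite -mxtrace_tr trmx_mul symW mxtrace_mulC.
by rewrite -[X in _ * (X + _)]mul1r -{2}[\tr _]mul1r -mulrDl mulrA mulVf ?mul1r // pnatr_eq0.
Qed.

Lemma kproj_log_kronecker Z : L (kproj Z).
Proof.
have sS := tr_sym_part Z; eexists; eexists; split; last by [].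
  by apply/symsetE; rewrite linearZ /= tr_ptrace_l sS.
apply/symsetE; rewrite linearB /= linearZ /= tr_ptrace_r sS.
by rewrite [(_ *: _)^T]linearZ /= trmx1.
Qed.

Lemma frob_kproj Z W : L W -> frob (kproj Z) W = frob Z W.
Proof.
move=> LW; have symW := log_kronecker_sym LW.
rewrite -(frob_sym_part Z symW) /kproj; move: (sym_part Z) => S /=.
have n0 : (n%:R : R) != 0 by rewrite pnatr_eq0 -lt0n.
have m0 : (m%:R : R) != 0 by rewrite pnatr_eq0 -lt0n.
case: LW => X [Y [_ _ ->]]; rewrite !frobDr !frob_tens1l !frob_tens1r.
rewrite ptrace_lD ptrace_rD !ptrace_l_tens !ptrace_r_tens !mxtrace_scalar.
have -> : \tr (m%:R^-1 *: ptrace_r S - (\tr S / (n%:R * m%:R)) *: 1%:M) = 0 :> R.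
  rewrite [LHS]raddfB /= !mxtraceZ trace_ptrace_r mxtrace_scalar.
  by field; rewrite n0 m0.
rewrite mxtraceZ trace_ptrace_l !frobDl !frobZl frobBl !frobZl !frob_tr.
by field; rewrite n0 m0.
Qed.

Lemma proj_log_kroneckerE Z : proj_log_kronecker Z = kproj Z.
Proof.
have Lk := kproj_log_kronecker Z.
have /getPex [] : exists V, [set V | L V /\
    forall W, L W -> frob (Z - V) W = 0] V.
  exists (kproj Z); split=> // W LW.
  by rewrite frobBl (frob_kproj _ LW) subrr.
rewrite -/(proj_log_kronecker Z); set V := proj_log_kronecker Z => LV orth.
have LD := log_kroneckerB LV Lk.
apply/eqP; rewrite -subr_eq0; apply/eqP/frobn0_eq0/eqP.
rewrite -sqrf_eq0 frobn_sqr {1}(_ : V - kproj Z = (Z - kproj Z) - (Z - V)).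
  by rewrite frobBl orth // frobBl (frob_kproj _ LD) subrr subr0.
by rewrite opprB [RHS]addrC subrKA.
Qed.

(** An orthogonal projection does not increase norms. *)
Lemma frobn_kproj Z : frobn (kproj Z) <= frobn Z.
Proof.
have Lk := kproj_log_kronecker Z.
have h : frobn (kproj Z) ^+ 2 <= frobn Z * frobn (kproj Z).
  rewrite frobn_sqr (frob_kproj _ Lk).
  exact: le_trans (ler_norm _) (frob_le _ _).
have [->|k0] := eqVneq (frobn (kproj Z)) 0; first exact: frobn_ge0.
by rewrite expr2 ler_pM2r // lt0r k0 frobn_ge0 in h.
Qed.

Lemma kprojB Z V : kproj (Z - V) = kproj Z - kproj V.
Proof.
apply/eqP; rewrite -subr_eq0; apply/eqP/frobn0_eq0/eqP.
have LD : L (kproj (Z - V) - (kproj Z - kproj V)).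
  by apply: log_kroneckerB; [|apply: log_kroneckerB]; exact: kproj_log_kronecker.
rewrite -sqrf_eq0 frobn_sqr !frobBl !(frob_kproj _ LD) frobBl.
by rewrite subrr.
Qed.

Lemma kproj_id W : L W -> kproj W = W.
Proof.
move=> LW; apply/eqP; rewrite -subr_eq0; apply/eqP/frobn0_eq0/eqP.
have LD : L (kproj W - W).
  by apply: log_kroneckerB => //; exact: kproj_log_kronecker.
by rewrite -sqrf_eq0 frobn_sqr frobBl (frob_kproj _ LD) subrr.
Qed.

End projection.

(** * Tangent vectors and the restricted gradient *)

Section tangent_space.
Variables (R : realType) (m n : nat).
Hypotheses (hm : (1 <= m)%N) (hn : (1 <= n)%N).
Implicit Types (M G W N V : 'M[R]_(n * m)).

Local Notation K := (@kronecker_family R m n).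
Local Notation L := (@log_kronecker R m n).

Lemma fcalcB (d : nat) (A : 'M[R]_d) h k : A^T = A ->
  fcalc h A - fcalc k A = fcalc (fun x => h x - k x) A.
Proof.
move=> symA; rewrite -[- _]scaleN1r fcalcZ // fcalcD //.
by apply: eq_fcalc => // x _; rewrite mulN1r.
Qed.

(** The exponential agrees with [x + 1] to first order, with a remainder
    controlled by a lower bound on the spectrum. *)
Lemma log_remainder (d : nat) (B : 'M[R]_d) ep : 0 < ep -> spd B ->
  (forall x, eigenvalue B x -> ep <= x) ->
  frobn (B - 1%:M - logmx B) <= ep^-1 * frobn (B - 1%:M) ^+ 2.
Proof.
move=> ep0 pB epB; have symB := spd_sym pB.
have BE : B - 1%:M = fcalc (fun x => x - 1) B.
  by rewrite -{1}(fcalc_id symB) -(fcalc_cst 1 symB) fcalcB.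
have RE : B - 1%:M - logmx B = fcalc (fun x => x - 1 - ln x) B.
  by rewrite logmx_fcalc // BE fcalcB.
set k := ep^-1 * frobn (B - 1%:M).
have k0 : 0 <= k by rewrite mulr_ge0 ?invr_ge0 ?frobn_ge0 // ltW.
rewrite expr2 mulrA -/k -(ler_pXn2r (isT : (0 < 2)%N)) ?nnegrE ?frobn_ge0 //; last first.
  by rewrite (mulr_ge0 k0) ?frobn_ge0.
rewrite RE exprMn BE !frobn_fcalc_sqr // -[leRHS]mxtraceZ fcalcZ //.
apply: tr_fcalc_le => // x evx; have epx := epB _ evx.
have x0 : 0 < x := lt_le_trans ep0 epx.
rewrite -exprMn -[leLHS]real_normK ?num_real // -[leRHS]real_normK ?num_real //.
rewrite ler_pXn2r ?nnegrE // normrM (ger0_norm k0).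
have lnx : 1 - x^-1 <= ln x.
  by have := expR_ge1Dx (- ln x); rewrite expRN lnK ?posrE //; lra.
have lnx' : ln x <= x - 1.
  by have := expR_ge1Dx (ln x); rewrite lnK ?posrE //; lra.
have symB1 : (B - 1%:M)^T = B - 1%:M by rewrite linearB /= trmx1 symB.
have ev1 := eigenvalue_le_frobn symB1 (eigenvalue_subr 1 evx).
rewrite ger0_norm; last by lra.
apply: (@le_trans _ _ ((x - 1) ^+ 2 / x)).
  have -> : (x - 1) ^+ 2 / x = x - 2 + x^-1 by field; rewrite gt_eqF.
  by lra.
rewrite -[(x - 1) ^+ 2]real_normK ?num_real // expr2 mulrAC ler_wpM2r //.
by rewrite mulrC ler_pM ?invr_ge0 ?(ltW x0) ?(ltW ep0) ?lef_pV2.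
Qed.

(** Whitened velocities of curves in the family lie in [L]: a matrix
    orthogonal to [L] is orthogonal to the logarithms of the whitened points,
    and these agree to first order with the points themselves minus the
    identity. *)
Lemma tangent_orthogonal G c N : curve_through K G c ->
  (forall W, L W -> frob N W = 0) ->
  frob N (whiten G (derive1 c 0)) = 0.
Proof.
case=> Kc c0 dc N0; have KG : K G by rewrite -c0.
have pG := kronecker_spd KG.
have cD : is_derive (0 : R) (1 : R) c (derive1 c 0).
  by rewrite derive1E; exact: derivableP.
pose w t := whiten G (c t).
have wD : is_derive (0 : R) (1 : R) w (whiten G (derive1 c 0)).
  by apply/is_derive_mulmxr/is_derive_mulmxl.
have Kw t : K (w t) by apply: kronecker_whiten.
have w0 : w 0 = 1%:M by rewrite /w c0 whiten1.
have [ep ep0 epP] := spd_open (@spd1 R (n * m)).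
have [C [rho [C0 rho0 hC]]] := is_derive_locally_lipschitz wD.
rewrite w0 in hC.
have g0 : is_derive (0 : R) (1 : R) (fun t => frob N (w t)) 0.
  apply: (@is_derive_quadratic _ _ _ (frobn N * (ep^-1 * C ^+ 2))
    (Num.min rho (ep / (C + 1)))).
  - by rewrite lt_min rho0 divr_gt0 // ltr_wpDl.
  - by rewrite w0 N0 //; exact: log_kronecker1.
  - move=> s; rewrite lt_min => /andP[s1 s2]; have h := hC s s1.
    have pw := kronecker_spd (Kw s).
    have -> : frob N (w s) = frob N (w s - 1%:M - logmx (w s)).
      rewrite !frobBr (N0 1%:M); last exact: log_kronecker1.
      by rewrite (N0 (logmx _)) ?subr0 //; exact: kronecker_logmx.
    apply: le_trans (frob_le _ _) _; rewrite -mulrA ler_wpM2l ?frobn_ge0 //.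
    apply: le_trans (log_remainder ep0 pw _) _.
      apply: epP; first exact: spd_sym.
      apply: le_trans h _; rewrite ltr_pdivlMr ?ltr_wpDl // in s2.
      by apply: le_trans (ltW s2); rewrite mulrC ler_wpM2l // lerDl.
    rewrite -mulrA ler_wpM2l ?invr_ge0 ?(ltW ep0) // -exprMn.
    by rewrite ler_pXn2r ?nnegrE ?frobn_ge0 // mulr_ge0.
have := is_derive_frob N wD; move=> h.
by rewrite -(@derive_val _ _ _ _ _ _ _ h) (@derive_val _ _ _ _ _ _ _ g0).
Qed.

Lemma curve_geod G W : K G -> L W -> curve_through K G (ai_geod G W) /\
  derive1 (ai_geod G W) 0 = unwhiten G W.
Proof.
move=> KG LW; have symW := log_kronecker_sym LW; have pG := kronecker_spd KG.
have dg := is_derive_geod G 0 symW.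
split; first split; first by move=> t; exact: kronecker_geod.
- exact: ai_geod0.
- exact: ex_derive.
by rewrite derive1E derive_val scale0r expmx0 mulmx1.
Qed.

(** Identified with [restricted_grad] by [restricted_gradE]. *)
Definition kgrad M G : 'M[R]_(n * m) := - unwhiten G (direction M G).

Lemma directionE M G : direction M G = kproj (logmx (whiten G M)).
Proof. by rewrite /direction proj_log_kroneckerE. Qed.

Lemma direction_log_kronecker M G : L (direction M G).
Proof. by rewrite directionE; exact: kproj_log_kronecker. Qed.

Lemma frob_direction M G W : L W ->
  frob (direction M G) W = frob (logmx (whiten G M)) W.
Proof. by rewrite directionE; exact: frob_kproj. Qed.

(** The derivative along a curve pairs the whitened velocity with [- logmx
    (whiten G M)]; the velocity is in the whitened tangent space [L], so only
    the projection of the logarithm contributes. Geodesics realize every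
    element of [L] as a velocity, which makes the gradient unique. *)
Lemma restricted_gradE M G : spd M -> K G ->
  restricted_grad K (objective M) G = kgrad M G.
Proof.
move=> pM KG; have pG := kronecker_spd KG.
have LV := direction_log_kronecker M G.
set P := [set Z | tangent K G Z /\ forall c, curve_through K G c ->
    is_derive (0 : R) (1 : R) (fun t => objective M (c t) : R^o)
      (ai_dot G Z (derive1 c 0))].
have PZ : P (kgrad M G).
  split.
    have [h1 h2] := curve_geod KG (log_kroneckerN LV).
    by exists (ai_geod G (- direction M G)); rewrite // h2 unwhitenN.
  move=> c cG; have [Kc c0 dc] := cG.
  have cD : is_derive (0 : R) (1 : R) c (derive1 c 0).
    by rewrite derive1E; exact: derivableP.
  have := is_derive_objective pM (fun s => kronecker_spd (Kc s)) cD.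
  rewrite c0; suff -> : - frob (logmx (whiten G M)) (whiten G (derive1 c 0)) =
    ai_dot G (kgrad M G) (derive1 c 0) by [].
  rewrite /ai_dot /kgrad whitenN unwhitenK // frobNl; congr (- _).
  apply/eqP; rewrite -subr_eq0 -frobBl; apply/eqP.
  apply: (tangent_orthogonal cG) => W LW.
  by rewrite frobBl (frob_direction _ _ LW) subrr.
have := getPex (ex_intro P _ PZ); rewrite -/(restricted_grad K (objective M) G).
set X := restricted_grad _ _ _ => -[tX gX]; case: PZ => tZ gZ.
have same c : curve_through K G c ->
    ai_dot G X (derive1 c 0) = ai_dot G (kgrad M G) (derive1 c 0).
  move=> cG; have h1 := gX c cG; have h2 := gZ c cG.
  by rewrite -(@derive_val _ _ _ _ _ _ _ h1) (@derive_val _ _ _ _ _ _ _ h2).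
case: tX => cX /same h1 h1'; case: tZ => cZ /same h2 h2'.
rewrite h1' in h1; rewrite h2' in h2.
apply/eqP; rewrite -subr_eq0; apply/eqP/(ai_norm0_eq0 pG).
by rewrite ai_dotBl !ai_dotBr h1 h2 subrr.
Qed.

End tangent_space.

(** * The Levi-Civita connection *)

Section levi_civita.
Variables (R : realType) (d : nat).
Implicit Types (S X Y W C G : 'M[R]_d) (t : R).

(** The trilinear form in which all derivatives of the metric are expressed;
    by [ai_dotE] the metric itself is the analogous bilinear form. *)
Definition koszul_form S X Y W : R :=
  \tr (invmx S *m X *m invmx S *m Y *m invmx S *m W).

Lemma ai_dotE S Y W : spd S -> Y^T = Y ->
  ai_dot S Y W = \tr (invmx S *m Y *m invmx S *m W).
Proof.
move=> pS symY; rewrite /ai_dot /frob tr_whiten // symY /whiten !mulmxA.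
rewrite [LHS]mxtrace_mulC !mulmxA isqrtmx_sqr // -(mulmxA _ (isqrtmx S) (isqrtmx S)).
by rewrite isqrtmx_sqr.
Qed.

Lemma derive_ai_dot S X Y W : spd S -> X^T = X -> Y^T = Y ->
  'D_X (fun T : 'M[R]_d => ai_dot T Y W : R^o) S =
  - (koszul_form S X Y W + koszul_form S Y X W).
Proof.
move=> pS symX symY; pose c (h : R) := h *: X + S.
have c0 : c 0 = S by rewrite /c scale0r add0r.
have cX : is_derive (0 : R) (1 : R) c X.
  have h : is_derive (0 : R) (1 : R) (fun h : R => h *: X) X.
    apply/is_derive_mxP => i j.
    have -> : (fun h : R => (h *: X) i j) = X i j \*: id.
      by apply/funext => h; rewrite mxE mulrC.
    by apply: is_derive_eq; rewrite -[LHS]/(_ * 1) mulr1.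
  by have := is_deriveD h (is_derive_cst S (0 : R) (1 : R)); rewrite addr0.
have uS : c 0 \in unitmx by rewrite c0; exact: spd_unit.
have iE := is_derive_invmx uS cX; rewrite c0 in iE.
pose F h := \tr (invmx (c h) *m Y *m (invmx (c h) *m W)).
have FE := is_derive_mxtrace
  (is_derive_mulmx (is_derive_mulmxr Y iE) (is_derive_mulmxr W iE)).
have cv : h^-1 *: (F (h *: 1 + 0) - F 0) @[h --> 0^'] -->
    - (koszul_form S X Y W + koszul_form S Y X W).
  have -> : - (koszul_form S X Y W + koszul_form S Y X W) = 'D_1 F (0 : R).
    rewrite (@derive_val _ _ _ _ _ _ _ FE) c0 /koszul_form.
    rewrite !mulNmx mulmxN -raddfD -raddfN /=; congr (\tr _).
    by rewrite !mulmxA -opprD; congr (- (_ + _)); rewrite !mulmxA.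
  by have : derivable F 0 1 by exact: ex_derive.
apply: cvg_lim => //; apply: cvg_trans cv; apply: near_eq_cvg.
have [ep ep0 epP] := spd_open pS.
have X1 : 0 < frobn X + 1 by rewrite ltr_wpDl ?frobn_ge0.
have bnd : 0 < ep / (frobn X + 1) by exact: divr_gt0.
near=> h; rewrite -[h *: 1]/(h * 1) mulr1 addr0 /F c0.
have pc : spd (c h).
  apply/spdP; split; first by rewrite /c linearD linearZ /= symX (spd_sym pS).
  move=> x evx; apply: lt_le_trans ep0 _; apply: epP evx.
    by rewrite /c linearD linearZ /= symX (spd_sym pS).
  rewrite /c addrK frobnZ; apply: (@le_trans _ _ (`|h| * (frobn X + 1))).
    by rewrite ler_wpM2l // lerDl.
  rewrite -ler_pdivlMr //; apply/ltW.
  by near: h; exact: dnbhs0_lt.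
by rewrite /= -/(c h) !ai_dotE // !mulmxA.
Unshelve. all: by end_near. Qed.

Lemma koszul_cyclic S X Y W : koszul_form S W X Y = koszul_form S X Y W.
Proof.
rewrite /koszul_form; apply/esym.
have -> : invmx S *m X *m invmx S *m Y *m invmx S *m W =
    invmx S *m X *m invmx S *m Y *m (invmx S *m W) by rewrite !mulmxA.
by rewrite mxtrace_mulC !mulmxA.
Qed.

(** By [derive_ai_dot] Koszul's formula is a sum of six values of
    [koszul_form], and cyclic invariance of the trace cancels four of them. *)
Lemma christoffelE S X Y : spd S -> X^T = X -> Y^T = Y ->
  christoffel S X Y = - 2^-1 *: (X *m invmx S *m Y + Y *m invmx S *m X).
Proof.
move=> pS symX symY; have symI := spd_sym (spd_invmx pS).
set C0 := _ *: _.
have symC0 : C0^T = C0.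
  by rewrite /C0 linearZ /= linearD /= !trmx_mul symI symX symY addrC !mulmxA.
have C0E W : W^T = W -> 2 * ai_dot S C0 W =
    'D_X (fun T : 'M[R]_d => ai_dot T Y W : R^o) S
    + 'D_Y (fun T : 'M[R]_d => ai_dot T X W : R^o) S
    - 'D_W (fun T : 'M[R]_d => ai_dot T X Y : R^o) S.
  move=> symW; rewrite !derive_ai_dot // ai_dotE //.
  have -> : \tr (invmx S *m C0 *m invmx S *m W) =
      - 2^-1 * (koszul_form S X Y W + koszul_form S Y X W).
    rewrite /C0 -scalemxAr -!scalemxAl mxtraceZ; congr (_ * _).
    by rewrite mulmxDr !mulmxDl mxtraceD !mulmxA.
  by rewrite (koszul_cyclic S X Y W) (koszul_cyclic S W Y X) (koszul_cyclic S Y X W); field.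
set P := [set C | symset C /\ forall W, symset W ->
    2 * ai_dot S C W =
      'D_X (fun T : 'M[R]_d => ai_dot T Y W : R^o) S
      + 'D_Y (fun T : 'M[R]_d => ai_dot T X W : R^o) S
      - 'D_W (fun T : 'M[R]_d => ai_dot T X Y : R^o) S].
have PC0 : P C0 by split; [exact/symsetE|move=> W /symsetE; exact: C0E].
have := getPex (ex_intro P _ PC0); rewrite -/(christoffel S X Y).
set C := christoffel S X Y => -[/symsetE symC CE].
have symD : (C - C0)^T = C - C0 by rewrite linearB /= symC symC0.
apply/eqP; rewrite -subr_eq0; apply/eqP/(ai_norm0_eq0 pS).
have := CE _ (iffRL (symsetE _) symD); rewrite -(C0E _ symD) => e.
rewrite ai_dotBl; apply/eqP; rewrite subr_eq0; apply/eqP.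
by apply: (mulfI (_ : 2 != 0)).
Qed.

End levi_civita.

(** * Geodesics and parallel fields *)

Section geodesics.
Variables (R : realType) (d : nat).
Implicit Types (S X Y W C G : 'M[R]_d) (t s : R) (c Z : R -> 'M[R]_d).

Lemma half_double C : 2^-1 *: (C + C) = C.
Proof. by rewrite -mulr2n -[C *+ 2]scaler_nat scalerA mulVf ?scale1r ?pnatr_eq0. Qed.

Lemma derive1_val c D t : is_derive t 1 c D -> derive1 c t = D.
Proof. by move=> cD; rewrite derive1E derive_val. Qed.

Lemma derivable_is_derive c t : derivable c t 1 -> is_derive t 1 c (derive1 c t).
Proof. by move=> dc; rewrite derive1E; exact: derivableP. Qed.

Lemma tr_derive1 c t : derivable c t 1 -> (forall s, (c s)^T = c s) ->
  (derive1 c t)^T = derive1 c t.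
Proof.
move=> /derivable_is_derive cD symc; rewrite -[LHS](derive1_val (is_derive_trmx cD)).
by congr (derive1 _ t); apply/funext => s; rewrite symc.
Qed.

Definition velocity G W t : 'M[R]_d := unwhiten G (W *m expmx (t *: W)).

Lemma expmx_comm W t : W^T = W -> W *m expmx (t *: W) = expmx (t *: W) *m W.
Proof.
move=> symW; rewrite expmx_scale // -{1 4}(fcalc_id symW) !fcalcM //.
by apply: eq_fcalc => // x _; rewrite mulrC.
Qed.

Lemma tr_velocity G W t : spd G -> W^T = W -> (velocity G W t)^T = velocity G W t.
Proof.
move=> pG symW; rewrite /velocity tr_unwhiten // trmx_mul symW.
by rewrite tr_expmx ?linearZ /= ?symW // expmx_comm.
Qed.

Lemma derive1_geod G W : W^T = W -> derive1 (ai_geod G W) = velocity G W.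
Proof.
by move=> symW; apply/funext => t; exact: derive1_val (is_derive_geod G t symW).
Qed.

Lemma is_derive_velocity G W t : W^T = W ->
  is_derive t 1 (velocity G W) (unwhiten G (W *m (W *m expmx (t *: W)))).
Proof.
move=> symW; apply/is_derive_mulmxr/is_derive_mulmxl/is_derive_mulmxl.
exact: is_derive_expmx.
Qed.

Lemma velocity_inv_geod G W t : spd G -> W^T = W ->
  velocity G W t *m invmx (ai_geod G W t) = sqrtmx G *m W *m isqrtmx G.
Proof.
move=> pG symW; rewrite invmx_geod // /velocity /unwhiten !mulmxA.
rewrite -(mulmxA _ (sqrtmx G) (isqrtmx G)) sqrtmxVK // mulmx1.
rewrite -(mulmxA _ (expmx _) (expmx _)) expmxD // subrr scale0r expmx0.
by rewrite mulmx1.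
Qed.

Lemma inv_geod_velocity G W t : spd G -> W^T = W ->
  invmx (ai_geod G W t) *m velocity G W t = isqrtmx G *m W *m sqrtmx G.
Proof.
move=> pG symW; rewrite -[LHS]trmxK trmx_mul tr_velocity //.
rewrite (spd_sym (spd_invmx (spd_geod t pG symW))) velocity_inv_geod //.
by rewrite !trmx_mul tr_sqrtmx // tr_isqrtmx // symW mulmxA.
Qed.

Lemma covariant_geod G W Z t : spd G -> W^T = W -> (Z t)^T = Z t ->
  covariant (ai_geod G W) Z t = derive1 Z t
    - 2^-1 *: (sqrtmx G *m W *m isqrtmx G *m Z t + Z t *m isqrtmx G *m W *m sqrtmx G).
Proof.
move=> pG symW symZ; rewrite /covariant derive1_geod // christoffelE //.
- by rewrite velocity_inv_geod // -(mulmxA (Z t)) inv_geod_velocity // scaleNr !mulmxA.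
- exact: spd_geod.
- exact: tr_velocity.
Qed.

Lemma geodesic_geod G W : spd G -> W^T = W -> geodesic (ai_geod G W).
Proof.
move=> pG symW t; have dg := is_derive_geod G t symW.
have dv := is_derive_velocity G t symW.
have symv := tr_velocity t pG symW.
split; [exact: spd_geod|exact: ex_derive|rewrite derive1_geod //; exact: ex_derive|].
rewrite derive1_geod // covariant_geod // (derive1_val dv) /velocity /unwhiten.
rewrite !mulmxA -(mulmxA _ (isqrtmx G) (sqrtmx G)) isqrtmxK // mulmx1.
rewrite -(mulmxA _ (sqrtmx G) (isqrtmx G)) sqrtmxVK // mulmx1.
rewrite -(mulmxA _ (expmx _) W) -expmx_comm // !mulmxA.
by rewrite half_double subrr.
Qed.

Lemma parallel_velocity G W k : spd G -> W^T = W ->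
  parallel (ai_geod G W) (fun t => k *: velocity G W t).
Proof.
move=> pG symW t; have dv := is_derive_velocity G t symW.
have dk := is_deriveZ k dv.
have symk : (k *: velocity G W t)^T = k *: velocity G W t.
  by rewrite linearZ /= tr_velocity.
split; [exact/symsetE|exact: ex_derive|].
have [_ _ _] := geodesic_geod pG symW t.
rewrite (derive1_geod G symW) (covariant_geod pG symW (tr_velocity t pG symW)).
rewrite (derive1_val dv) => h.
rewrite (@covariant_geod _ _ (fun s => k *: velocity G W s) _ pG symW symk).
rewrite (derive1_val dk) -[RHS](scaler0 _ k) -h scalerBr scalerA (mulrC k) -scalerA.
by rewrite -scalemxAr -!scalemxAl -scalerDr.
Qed.

(** Along a geodesic [invmx (c t) *m c' t] is constant, so the curve is
    determined by its initial position and velocity. *)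
Lemma geodesic_form c : geodesic c ->
  exists2 W, W^T = W & c = ai_geod (c 0) W.
Proof.
move=> gc; have pc t : spd (c t) by case: (gc t).
have uc t := spd_unit (pc t).
have dc t : is_derive t 1 c (derive1 c t).
  by apply: derivable_is_derive; case: (gc t).
have dc' t : is_derive t 1 (derive1 c) (derive1 (derive1 c) t).
  by apply: derivable_is_derive; case: (gc t).
have symc' t : (derive1 c t)^T = derive1 c t.
  by apply: tr_derive1 => [|s]; [case: (gc t)|exact: spd_sym].
have ode t : derive1 (derive1 c) t = derive1 c t *m invmx (c t) *m derive1 c t.
  have [_ _ _] := gc t; rewrite /covariant christoffelE // scaleNr half_double.
  by move/eqP; rewrite subr_eq0 => /eqP.
(* The geodesic equation says that this logarithmic derivative is constant,
   so the curve solves a linear equation with constant coefficients. *)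
pose A t := invmx (c t) *m derive1 c t.
have A0 t : A t = A 0.
  apply: is_derive0_cst => s.
  have := is_derive_mulmx (is_derive_invmx (uc s) (dc s)) (dc' s).
  by rewrite ode mulNmx !mulmxA addNr.
have c'E t : derive1 c t = c t *m A 0 by rewrite -(A0 t) mulKVmx.
set S := sqrtmx (c 0); set T := isqrtmx (c 0).
have ST : S *m T = 1%:M by exact: sqrtmxVK.
have TS : T *m S = 1%:M by exact: isqrtmxK.
pose W := whiten (c 0) (derive1 c 0).
have symW : W^T = W by rewrite tr_whiten // symc'.
exists W => //; apply/funext => t.
have AT : A 0 *m T = T *m W.
  by rewrite /A /W /whiten -/T -isqrtmx_sqr // -/T !mulmxA.
(* The candidate geodesic has inverse [T *m expmx (t *: (- W)) *m T]; its
   product with [c t] is constant. *)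
pose u t := c t *m (T *m expmx (t *: (- W)) *m T).
have u0 : u t = u 0.
  apply: is_derive0_cst => s.
  have symNW : (- W)^T = - W by rewrite linearN /= symW.
  have e := is_derive_mulmx (dc s)
    (is_derive_mulmxr T (is_derive_mulmxl T (is_derive_expmx s symNW))).
  suff <- : derive1 c s *m (T *m expmx (s *: - W) *m T) +
      c s *m (T *m (- W *m expmx (s *: - W)) *m T) = 0 by [].
  rewrite c'E -(mulmxA (c s)) -mulmxDr !mulmxA AT mulmxN !mulNmx.
  by rewrite subrr mulmx0.
have u1 : u 0 = 1%:M.
  rewrite /u scale0r expmx0 mulmx1 -{1}(sqrtmxK (pc 0)) -/S -mulmxA (mulmxA S T).
  by rewrite ST mul1mx ST.
rewrite /ai_geod /unwhiten -/S -[LHS]mulmx1.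
have E1 : T *m expmx (t *: - W) *m T *m (S *m expmx (t *: W) *m S) = 1%:M.
  rewrite !mulmxA -(mulmxA _ T S) TS mulmx1 scalerN -scaleNr.
  rewrite -(mulmxA _ (expmx _) (expmx _)) expmxD // addNr scale0r expmx0 mulmx1.
  by rewrite TS.
by rewrite -E1 mulmxA -/(u t) u0 u1 mul1mx.
Qed.

(** After whitening by the initial point, parallel transport is the linear
    equation [z' = (W z + z W) / 2], solved by two exponentials. *)
Lemma parallel_form G W Z t : spd G -> W^T = W -> parallel (ai_geod G W) Z ->
  whiten G (Z t) =
  expmx ((t / 2) *: W) *m whiten G (Z 0) *m expmx ((t / 2) *: W).
Proof.
move=> pG symW pZ.
have dZ s : is_derive s 1 Z (derive1 Z s).
  by apply: derivable_is_derive; case: (pZ s).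
pose z s := whiten G (Z s).
have dz s : is_derive s 1 z (2^-1 *: (W *m z s + z s *m W)).
  have -> : 2^-1 *: (W *m z s + z s *m W) = whiten G (derive1 Z s).
    have [/symsetE symZ _] := pZ s; rewrite covariant_geod // => /eqP.
    rewrite subr_eq0 => /eqP ->.
    rewrite /whiten -scalemxAr -scalemxAl; congr (_ *: _).
    rewrite mulmxDr mulmxDl !mulmxA isqrtmxK // mul1mx.
    by rewrite -(mulmxA _ (sqrtmx G) (isqrtmx G)) sqrtmxVK // mulmx1.
  by apply/is_derive_mulmxr/is_derive_mulmxl.
pose V := (- 2^-1) *: W.
have symV : V^T = V by rewrite linearZ /= symW.
pose u s := expmx (s *: V) *m z s *m expmx (s *: V).
have u0 : u t = u 0.
  apply: is_derive0_cst => s; have e := is_derive_expmx s symV.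
  have h := is_derive_mulmx (is_derive_mulmx e (dz s)) e.
  suff <- : (V *m expmx (s *: V) *m z s +
      expmx (s *: V) *m (2^-1 *: (W *m z s + z s *m W))) *m expmx (s *: V) +
      expmx (s *: V) *m z s *m (V *m expmx (s *: V)) = 0 by [].
  set E := expmx _; have EV : V *m E = E *m V by exact: expmx_comm.
  have -> : (V *m E *m z s + E *m (2^-1 *: (W *m z s + z s *m W))) *m E +
      E *m z s *m (V *m E) =
      E *m (V *m z s + 2^-1 *: (W *m z s + z s *m W) + z s *m V) *m E.
    by rewrite {1}EV !mulmxDr !mulmxDl !mulmxA.
  rewrite /V -scalemxAl -scalemxAr !scaleNr (addrC (- _)) -addrA -opprD -scalerDr.
  rewrite subrr mulmx0 mul0mx.
  by [].
have z0 : u 0 = z 0 by rewrite /u scale0r expmx0 mul1mx mulmx1.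
have VE : (t / 2) *: W = (- t) *: V by rewrite /V scalerA mulrNN mulrC.
rewrite -/(z t) -/(z 0) -z0 -u0 /u VE !mulmxA.
rewrite expmxD // addNr scale0r expmx0 mul1mx -mulmxA.
by rewrite expmxD // subrr scale0r expmx0 mulmx1.
Qed.

End geodesics.

(** * Convexity along geodesics *)

Section convexity.
Variables (R : realType) (d : nat).
Implicit Types (A G M W Q : 'M[R]_d) (t s : R).

Lemma objective_ge0 M G : 0 <= objective M G.
Proof. by rewrite mulr_ge0 ?invr_ge0 ?sqr_ge0. Qed.

Lemma orthogonal_fcalc Q A h : Q^T *m Q = 1%:M -> A^T = A ->
  fcalc h (Q *m A *m Q^T) = Q *m fcalc h A *m Q^T.
Proof.
move=> QQ symA; have QQ' : Q *m Q^T = 1%:M by exact: mulmx1C.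
have symQ : (Q *m A *m Q^T)^T = Q *m A *m Q^T.
  by rewrite !trmx_mul trmxK symA mulmxA.
rewrite (@fcalc_intertwine _ _ Q A _ h symA symQ); first by rewrite -[RHS]mulmxA QQ' mulmx1.
by rewrite -!mulmxA QQ mulmx1.
Qed.

Lemma frobn_orthogonal Q A : Q^T *m Q = 1%:M -> frobn (Q *m A *m Q^T) = frobn A.
Proof.
move=> QQ; rewrite /frobn /frob !trmx_mul trmxK; congr (Num.sqrt _).
transitivity (\tr (Q *m (A^T *m A *m Q^T))).
  by congr (\tr _); rewrite !mulmxA -(mulmxA _ Q^T Q) QQ mulmx1.
by rewrite mxtrace_mulC -(mulmxA _ Q^T Q) QQ mulmx1.
Qed.

(** Two factors of [ai_geod G W t] as a product of a matrix with its
    transpose, the symmetric root and [sqrtmx G *m expmx ((t / 2) *: W)],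
    differ by this orthogonal matrix: it is parallel transport read in
    whitened coordinates at both ends, by [whiten_geod]. *)
Definition transport G W t : 'M[R]_d :=
  isqrtmx (ai_geod G W t) *m sqrtmx G *m expmx ((t / 2) *: W).

Lemma geod_factor G W t : W^T = W -> ai_geod G W t =
  sqrtmx G *m expmx ((t / 2) *: W) *m expmx ((t / 2) *: W) *m sqrtmx G.
Proof.
move=> symW; rewrite /ai_geod /unwhiten -(mulmxA _ (expmx _) (expmx _)) expmxD //.
by rewrite -splitr.
Qed.

Lemma tr_expmxZ W t : W^T = W -> (expmx (t *: W))^T = expmx (t *: W).
Proof. by move=> symW; rewrite tr_expmx // linearZ /= symW. Qed.

Lemma tr_transport G W t : spd G -> W^T = W -> (transport G W t)^T =
  expmx ((t / 2) *: W) *m sqrtmx G *m isqrtmx (ai_geod G W t).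
Proof.
move=> pG symW; rewrite /transport !trmx_mul tr_expmxZ // tr_sqrtmx //.
by rewrite tr_isqrtmx ?mulmxA //; exact: spd_geod.
Qed.

Lemma transport_orthogonal G W t : spd G -> W^T = W ->
  (transport G W t)^T *m transport G W t = 1%:M.
Proof.
move=> pG symW; have pg := spd_geod t pG symW; apply: mulmx1C.
rewrite tr_transport // /transport !mulmxA.
have -> : isqrtmx (ai_geod G W t) *m sqrtmx G *m expmx ((t / 2) *: W) *m
    expmx ((t / 2) *: W) *m sqrtmx G *m isqrtmx (ai_geod G W t) =
    whiten (ai_geod G W t) (ai_geod G W t).
  rewrite /whiten; set g := isqrtmx _; clearbody g.
  by rewrite (geod_factor G t symW) !mulmxA.
exact: whiten1.
Qed.

Lemma whiten_geod G W t Z : spd G -> W^T = W ->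
  whiten (ai_geod G W t) (unwhiten G (expmx ((t / 2) *: W) *m Z *m expmx ((t / 2) *: W)))
  = transport G W t *m Z *m (transport G W t)^T.
Proof. by move=> pG symW; rewrite tr_transport // /transport /whiten /unwhiten !mulmxA. Qed.

Lemma whiten_velocity G W t : spd G -> W^T = W ->
  whiten (ai_geod G W t) (velocity G W t) =
  transport G W t *m W *m (transport G W t)^T.
Proof.
move=> pG symW; rewrite -(whiten_geod t W pG symW) /velocity.
congr (whiten _ (unwhiten _ _)).
by rewrite -(expmx_comm _ symW) -mulmxA (expmxD _ _ symW) -splitr.
Qed.

(** Moving the base point to time [t] makes that point the identity, where
    [objective_strongly_convex] reads simply. *)
Lemma ai_dist_factor M G W t s : spd M -> spd G -> W^T = W ->
  ai_dist (ai_geod G W s) M =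
  ai_dist (expmx ((s - t) *: W))
    (expmx (- (t / 2) *: W) *m whiten G M *m expmx (- (t / 2) *: W)).
Proof.
move=> pM pG symW; set E := expmx ((t / 2) *: W).
set E' := expmx (- (t / 2) *: W).
have EE' : E *m E' = 1%:M by rewrite expmxD // subrr scale0r expmx0.
have E'E : E' *m E = 1%:M by exact: mulmx1C.
have symE' : E'^T = E' by exact: tr_expmxZ.
have symE : E^T = E by exact: tr_expmxZ.
have pw := spd_whiten pG pM.
have ps : spd (expmx (s *: W)) by apply: spd_expmx; rewrite linearZ /= symW.
have uE' : E' \in unitmx by case: (mulmx1_unit EE').
rewrite -{1}(whitenK M pG) /ai_geod (ai_dist_unwhiten pG ps pw).
rewrite -(ai_dist_congr uE' ps pw) symE' /E' !(expmxD _ _ symW).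
have -> : - (t / 2) + s + - (t / 2) = s - t by lra.
exact: erefl.
Qed.

(** The first-order lower bound at time [t], evaluated at times 0 and 1 and
    averaged. *)
Lemma objective_geod_convex M G W t : spd M -> spd G -> W^T = W ->
  0 <= t <= 1 ->
  objective M (ai_geod G W t) <=
  (1 - t) * objective M (ai_geod G W 0) + t * objective M (ai_geod G W 1).
Proof.
move=> pM pG symW /andP[t0 t1].
pose M' := expmx (- (t / 2) *: W) *m whiten G M *m expmx (- (t / 2) *: W).
have pM' : spd M'.
  rewrite /M' -[X in _ *m _ *m X]tr_expmxZ //; apply: spd_congr.
    by apply/spd_unit/spd_expmx; rewrite linearZ /= symW.
  exact: spd_whiten.
have fE s : objective M (ai_geod G W s) = objective M' (expmx ((s - t) *: W)).
  by rewrite /objective (ai_dist_factor t s pM pG symW).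
have symZ s : ((s - t) *: W)^T = (s - t) *: W by rewrite linearZ /= symW.
have lower s : objective M' 1%:M - (s - t) * frob (logmx M') W <=
    objective M' (expmx ((s - t) *: W)).
  have := objective_strongly_convex pM' (spd1 R d) (symZ s).
  have u1 Z : unwhiten (1%:M : 'M[R]_d) Z = Z.
    by rewrite /unwhiten (sqrtmx_eq (spd1 R d)) ?mul1mx ?mulmx1 //; exact: spd1.
  have w1 Z : whiten (1%:M : 'M[R]_d) Z = Z.
    by rewrite -(u1 (whiten _ Z)) whitenK //; exact: spd1.
  rewrite u1 w1 frobZr => h; apply: le_trans h.
  by rewrite lerDl mulr_ge0 ?invr_ge0 ?frob_ge0.
rewrite !fE subrr scale0r expmx0.
have h0 := lower 0; have h1 := lower 1.
have t1' : 0 <= 1 - t by rewrite subr_ge0.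
have {}h0 := ler_wpM2l t1' h0; have {}h1 := ler_wpM2l t0 h1.
apply: le_trans (lerD h0 h1).
by rewrite le_eqVlt; apply/orP; left; apply/eqP; ring.
Qed.

End convexity.

(** * Transport within the Kronecker family *)

Section kronecker_transport.
Variables (R : realType) (m n : nat).
Hypotheses (hm : (1 <= m)%N) (hn : (1 <= n)%N).
Implicit Types (M G W N V P Z : 'M[R]_(n * m)) (t : R).

Local Notation K := (@kronecker_family R m n).
Local Notation L := (@log_kronecker R m n).

Lemma tr_conj (d : nat) (Q V : 'M[R]_d) : V^T = V ->
  (Q *m V *m Q^T)^T = Q *m V *m Q^T.
Proof. by move=> symV; rewrite !trmx_mul trmxK symV mulmxA. Qed.

Lemma tr_conjV (d : nat) (Q V : 'M[R]_d) : V^T = V ->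
  (Q^T *m V *m Q)^T = Q^T *m V *m Q.
Proof. by move=> symV; rewrite !trmx_mul trmxK symV mulmxA. Qed.

Lemma frob_conj (d : nat) (Q X D : 'M[R]_d) :
  frob (Q^T *m X *m Q) D = frob X (Q *m D *m Q^T).
Proof.
rewrite /frob !trmx_mul trmxK -!mulmxA mxtrace_mulC.
by rewrite -!mulmxA.
Qed.

(** Conjugation by [transport G W t] amounts to successive congruences by
    members of the family, hence preserves the family, hence its logarithms:
    [L] is invariant under parallel transport, that is, the family is totally
    geodesic. *)
Lemma transport_log_kronecker G W t V : K G -> L W -> L V ->
  L (transport G W t *m V *m (transport G W t)^T).
Proof.
move=> KG LW LV; have pG := kronecker_spd KG; have symW := log_kronecker_sym LW.
have symV := log_kronecker_sym LV.
have QQ := transport_orthogonal t pG symW.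
have Kg := kronecker_geod t KG LW.
set Q := transport G W t in QQ *.
suff KE : K (expmx (Q *m V *m Q^T)).
  have symQ := tr_conj Q symV.
  by rewrite -(logmx_expmx symQ); exact: kronecker_logmx.
rewrite (expmx_fcalc (tr_conj Q symV)).
rewrite (orthogonal_fcalc _ QQ symV) -(expmx_fcalc symV).
rewrite /Q (tr_transport t pG symW) /transport.
have -> (A B C D : 'M[R]_(n * m)) : A *m B *m C *m D *m (C *m B *m A) =
    A *m (B *m (C *m D *m C) *m B) *m A by rewrite !mulmxA.
apply: kronecker_congr; first exact: kronecker_isqrtmx.
apply: kronecker_congr; first exact: kronecker_sqrtmx.
by apply: kronecker_congr; apply: log_kronecker_exp => //; exact: log_kroneckerZ.
Qed.

Lemma transport_trV G W t V : K G -> L W -> L V ->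
  L ((transport G W t)^T *m V *m transport G W t).
Proof.
move=> KG LW LV; have pG := kronecker_spd KG; have symW := log_kronecker_sym LW.
have symV := log_kronecker_sym LV.
have QQ := mulmx1C (transport_orthogonal t pG symW).
have Kg := kronecker_geod t KG LW.
set Q := transport G W t in QQ *.
have QQ' : (Q^T)^T *m Q^T = 1%:M by rewrite trmxK.
suff KE : K (expmx (Q^T *m V *m Q)).
  have symQ := tr_conjV Q symV.
  by rewrite -(logmx_expmx symQ); exact: kronecker_logmx.
rewrite (expmx_fcalc (tr_conjV Q symV)).
rewrite -{2}[Q]trmxK (orthogonal_fcalc _ QQ' symV) -(expmx_fcalc symV) trmxK.
rewrite /Q (tr_transport t pG symW) /transport.
have -> (A B C D : 'M[R]_(n * m)) : C *m B *m A *m D *m (A *m B *m C) =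
    C *m (B *m (A *m D *m A) *m B) *m C by rewrite !mulmxA.
apply: kronecker_congr; first by apply: log_kronecker_exp; exact: log_kroneckerZ.
apply: kronecker_congr; first exact: kronecker_sqrtmx.
by apply: kronecker_congr; [exact: kronecker_isqrtmx|exact: log_kronecker_exp].
Qed.

(** An orthogonal map preserving [L] commutes with the orthogonal projection
    onto [L]. *)
Lemma kproj_transport G W t Z : K G -> L W ->
  kproj ((transport G W t)^T *m Z *m transport G W t) =
  (transport G W t)^T *m kproj Z *m transport G W t.
Proof.
move=> KG LW; set Q := transport G W t.
have LQ V : L V -> L (Q^T *m V *m Q) by exact: transport_trV.
have LQ' V : L V -> L (Q *m V *m Q^T) by exact: transport_log_kronecker.
have Lk := @kproj_log_kronecker R m n.
apply/eqP; rewrite -subr_eq0; apply/eqP/frobn0_eq0/eqP.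
have LD := log_kroneckerB (Lk (Q^T *m Z *m Q)) (LQ _ (Lk Z)).
rewrite -sqrf_eq0 frobn_sqr frobBl (frob_kproj hm hn _ LD).
set D := _ - _ in LD *.
by rewrite !frob_conj (frob_kproj hm hn _ (LQ' _ LD)) subrr.
Qed.

Lemma whiten_geod_factor M G W t : spd M -> spd G -> W^T = W ->
  (transport G W t)^T *m whiten (ai_geod G W t) M *m transport G W t =
  expmx (- (t / 2) *: W) *m whiten G M *m expmx (- (t / 2) *: W).
Proof.
move=> pM pG symW; set Q := transport G W t.
have QQ := transport_orthogonal t pG symW; rewrite -/Q in QQ.
set E := expmx (- (t / 2) *: W); set E1 := expmx ((t / 2) *: W).
have EE : E1 *m E = 1%:M by rewrite /E1 /E (expmxD _ _ symW) subrr scale0r expmx0.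
have EE' := mulmx1C EE.
have ME : whiten (ai_geod G W t) M = Q *m (E *m whiten G M *m E) *m Q^T.
  have : whiten (ai_geod G W t) (unwhiten G (E1 *m (E *m whiten G M *m E) *m E1)) =
    Q *m (E *m whiten G M *m E) *m Q^T by exact: whiten_geod.
  suff -> : E1 *m (E *m whiten G M *m E) *m E1 = whiten G M by rewrite (whitenK M pG).
  by rewrite !mulmxA EE mul1mx -mulmxA EE' mulmx1.
clearbody Q; rewrite ME.
by rewrite !mulmxA QQ mul1mx -(mulmxA _ Q^T Q) QQ mulmx1.
Qed.

(** Strong convexity towards [P], whose logarithm at [G] lies in [L],
    minimized over [L]: the minimum of [W |-> - frob V W + frob W W / 2] is
    reached at the direction [V]. *)
Lemma gradient_dominance M G P : spd M -> K G -> K P ->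
  objective M G - objective M P <= 2^-1 * frobn (direction M G) ^+ 2.
Proof.
move=> pM KG KP; have pG := kronecker_spd KG; have pP := kronecker_spd KP.
set W := logmx (whiten G P).
have LW : L W by apply/kronecker_logmx/kronecker_whiten.
have symW := log_kronecker_sym LW.
have := objective_strongly_convex pM pG symW.
have -> : unwhiten G (expmx W) = P.
  by have := ai_geod_log pG pP; rewrite /ai_geod scale1r.
rewrite -(frob_direction hm hn _ _ LW) frobn_sqr; set V := direction M G.
have := frob_ge0 (W - V); rewrite frobBl !frobBr (frobC W V).
lra.
Qed.

(** A zero direction removes the linear term of the strong convexity
    inequality, so the critical point is the unique minimizer, with quadratic
    growth. *)
Lemma direction0_min M G P : spd M -> K G -> K P -> direction M G = 0 ->
  objective M G + 2^-1 * ai_dist G P ^+ 2 <= objective M P.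
Proof.
move=> pM KG KP V0; have pG := kronecker_spd KG; have pP := kronecker_spd KP.
set W := logmx (whiten G P).
have LW : L W by apply/kronecker_logmx/kronecker_whiten.
have symW := log_kronecker_sym LW.
have := objective_strongly_convex pM pG symW.
have -> : unwhiten G (expmx W) = P.
  by have := ai_geod_log pG pP; rewrite /ai_geod scale1r.
rewrite -(frob_direction hm hn _ _ LW) V0.
have -> : frob (0 : 'M[R]_(n * m)) W = 0 by rewrite -(scale0r W) frobZl mul0r.
by rewrite subr0 /ai_dist frobn_sqr.
Qed.

Lemma is_derive_objective_geod M G t : spd M -> K G ->
  let V := direction M G in
  is_derive t 1 (fun s => objective M (ai_geod G V s))
    (ai_dot (ai_geod G V t) (kgrad M (ai_geod G V t)) (velocity G V t)).
Proof.
move=> pM KG V; have LV : L V by exact: direction_log_kronecker.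
have pG := kronecker_spd KG; have symV := log_kronecker_sym LV.
have := is_derive_objective pM (fun s => spd_geod s pG symV) (is_derive_geod G t symV).
suff -> : - frob (logmx (whiten (ai_geod G V t) M))
    (whiten (ai_geod G V t) (unwhiten G (V *m expmx (t *: V)))) =
    ai_dot (ai_geod G V t) (kgrad M (ai_geod G V t)) (velocity G V t) by [].
rewrite -/(velocity G V t) /ai_dot /kgrad whitenN (unwhitenK _ (spd_geod t pG symV)).
rewrite frobNl (whiten_velocity _ pG symV).
by rewrite (frob_direction hm hn _ _ (transport_log_kronecker t KG LV LV)).
Qed.

(** Along the geodesic in the direction [V] the derivative of the objective at
    time 0 is minus the squared norm of [V]; at a minimizer it vanishes. *)
Lemma min_direction0 M P : spd M -> K P ->
  (forall G, K G -> objective M P <= objective M G) -> direction M P = 0.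
Proof.
move=> pM KP Pmin; set V := direction M P.
have LV : L V by exact: direction_log_kronecker.
have pP := kronecker_spd KP; have symV := log_kronecker_sym LV.
have d0 := is_derive_objective_geod 0 pM KP; rewrite -/V /= in d0.
pose phi (s : R) := objective M (ai_geod P V s).
have dphi s : derivable phi s 1.
  by have := is_derive_objective_geod s pM KP; rewrite -/V /= => h; exact: ex_derive.
have ab : (- 1 : R) <= 1 by lra.
have c01 : (0 : R) \in `](- 1), 1[%R by rewrite in_itv /=; apply/andP; split; lra.
have phi0 s : s \in `](- 1), 1[%R -> phi 0 <= phi s.
  by move=> _; rewrite /phi (ai_geod0 V pP); apply: Pmin; exact: kronecker_geod.
have := derive1_at_min ab (fun s _ => dphi s) c01 phi0.
move=> h; apply: frobn0_eq0; apply/eqP; rewrite -sqrf_eq0 frobn_sqr.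
have := @derive_val _ _ _ _ _ _ _ d0; rewrite (@derive_val _ _ _ _ _ _ _ h).
rewrite (ai_geod0 V pP) /kgrad /ai_dot whitenN !(unwhitenK _ pP) frobNl.
by rewrite scale0r expmx0 mulmx1 -/V => /esym/eqP; rewrite oppr_eq0.
Qed.

End kronecker_transport.

(** * Continuity, compactness and existence of the projection *)

Section continuity.
Variables (R : realType).

Lemma expR_lipschitz (x y rho : R) : `|x| <= rho -> `|y| <= rho ->
  `|expR x - expR y| <= expR rho * `|x - y|.
Proof.
wlog yx : x y / y <= x.
  move=> H hx hy; have [yx|/ltW xy] := leP y x; first exact: H.
  by rewrite distrC (distrC x); exact: H.
move=> hx hy; rewrite !ger0_norm ?subr_ge0 ?ler_expR //.
have e : expR y = expR x * expR (y - x) by rewrite -expRD; congr expR; lra.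
rewrite e -{1}[expR x]mulr1 -mulrBr ler_pM ?expR_ge0 //.
- by rewrite subr_ge0 -expR0 ler_expR; lra.
- by rewrite ler_expR (le_trans (ler_norm _)).
by have := expR_ge1Dx (y - x); lra.
Qed.

Lemma expmx_lipschitz (d : nat) (A B : 'M[R]_d) rho : A^T = A -> B^T = B ->
  frobn A <= rho -> frobn B <= rho ->
  frobn (expmx A - expmx B) <= expR rho * frobn (A - B).
Proof.
move=> symA symB hA hB; rewrite !expmx_fcalc //.
apply: fcalc_lipschitz; rewrite ?expR_ge0 //.
move=> x y /(eigenvalue_le_frobn symA) hx /(eigenvalue_le_frobn symB) hy.
by apply: expR_lipschitz; [exact: le_trans hA|exact: le_trans hB].
Qed.

Lemma objective_continuous (d : nat) (M G : 'M[R]_d) e : spd M -> spd G -> 0 < e ->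
  exists2 delta, 0 < delta & forall G', spd G' -> frobn (G' - G) <= delta ->
    `|objective M G' - objective M G| <= e.
Proof.
move=> pM pG e0; have [K [delta [K0 delta0 hK]]] := objective_taylor pM pG.
set H := logmx (whiten G M) in hK; set s := frobn (isqrtmx G).
pose C := frobn H * s ^+ 2 + K + 1.
have C0 : 0 < C.
  by rewrite ltr_wpDl // addr_ge0 // mulr_ge0 ?sqr_ge0 ?frobn_ge0.
exists (Num.min delta (Num.min 1 (e / C))).
  by rewrite !lt_min delta0 ltr01 divr_gt0.
move=> G' pG'; rewrite !le_min => /and3P[h1 h2]; rewrite ler_pdivlMr // => h3.
set x := frobn (G' - G) in h1 h2 h3; have x0 : 0 <= x by exact: frobn_ge0.
have hw : `|frob H (whiten G (G' - G))| <= frobn H * s ^+ 2 * x.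
  apply: le_trans (frob_le _ _) _; rewrite -mulrA ler_wpM2l ?frobn_ge0 //.
  apply: le_trans (frobn_mul _ _) _; rewrite -/s expr2 -mulrA mulrC.
  by rewrite ler_wpM2l ?frobn_ge0 // frobn_mul.
have := hK _ pG' h1; rewrite -/x => hT.
have : K * x ^+ 2 <= K * x.
  by rewrite ler_wpM2l // expr2 ler_piMl.
move=> h4; apply: le_trans h3; rewrite -[X in `|X|](addrK (frob H (whiten G (G' - G)))).
apply: le_trans (ler_normB _ _) _; apply: le_trans (lerD hT hw) _.
have -> : x * C = frobn H * s ^+ 2 * x + K * x + x by rewrite /C; ring.
by lra.
Qed.

Lemma continuous_rV k (g : 'rV[R]_k -> R) :
  (forall v e, 0 < e -> exists2 delta, 0 < delta &
     forall w, `|v - w| < delta -> `|g v - g w| <= e) -> continuous g.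
Proof.
move=> hg v; apply: (iffRL (cvgrPdist_le (FF := nbhs_filter v) _ _)) => e e0.
have [delta delta0 hd] := hg v e e0.
suff : nbhs (v : 'rV[R]_k) [set w | `|g v - g w| <= e] by [].
apply/(@nbhs_normP R ('rV[R]_k : normedModType R)).
by exists delta => // w /= vw; exact: hd.
Qed.

Lemma continuous_rV_mx k d (g : 'rV[R]_k -> 'M[R]_d) :
  (forall v e, 0 < e -> exists2 delta, 0 < delta &
     forall w, `|v - w| < delta -> frobn (g v - g w) <= e) -> continuous g.
Proof.
move=> hg v; apply: (iffRL (cvgrPdist_le (FF := nbhs_filter v) _ _)) => e e0.
have [delta delta0 hd] := hg v e e0.
suff : nbhs (v : 'rV[R]_k) [set w | `|g v - g w| <= e] by [].
apply/(@nbhs_normP R ('rV[R]_k : normedModType R)); exists delta => // w /= vw.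
by apply: le_trans (norm_le_frobn _) _; exact: hd.
Qed.

Lemma norm_vec_mx d (v : 'rV[R]_(d * d)) : `|vec_mx v| <= `|v|.
Proof.
rewrite {1}/Num.norm /= mx_normrE bigmax_le // => -[i j] _ /=.
rewrite mxE {2}/Num.norm /= mx_normrE.
exact: (le_bigmax _ (fun p : 'I_1 * 'I_(d * d) => `|v p.1 p.2|) (ord0, mxvec_index i j)).
Qed.

Lemma norm_le_vec_mx d (v : 'rV[R]_(d * d)) : `|v| <= `|vec_mx v : 'M[R]_d|.
Proof.
rewrite {1}/Num.norm /= mx_normrE bigmax_le // => -[i j] _ /=.
rewrite ord1; case/mxvec_indexP: j => k l.
by have := entry_le_norm (vec_mx v) k l; rewrite mxE.
Qed.

Lemma frobn_vec_mx d (v w : 'rV[R]_(d * d)) :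
  frobn (vec_mx v - vec_mx w) <= d%:R * `|v - w|.
Proof.
rewrite -linearB /=; apply: le_trans (frobn_le_norm _) _.
by rewrite ler_wpM2l // norm_vec_mx.
Qed.

End continuity.

Section compactness.
Variables (R : realType) (m n : nat).
Hypotheses (hm : (1 <= m)%N) (hn : (1 <= n)%N).
Implicit Types (M G W N V P Z : 'M[R]_(n * m)) (t r : R).

Local Notation K := (@kronecker_family R m n).
Local Notation L := (@log_kronecker R m n).
Local Notation rvec := 'rV[R]_((n * m) * (n * m)).

Definition kexp (v : rvec) : 'M[R]_(n * m) := expmx (kproj (vec_mx v)).

Definition sublevel M r : set 'M[R]_(n * m) :=
  [set G | K G /\ objective M G <= r].

(** The preimage under [kexp] of a sublevel set, cut down to [L]: a closed
    set, bounded because the metric increasing property compares Euclidean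
    distances of logarithms with the objective. Row vectors carry the
    Heine-Borel property. *)
Definition log_sublevel M r : set rvec :=
  [set v | frobn (kproj (vec_mx v) - vec_mx v) <= 0 /\ objective M (kexp v) <= r].

Lemma sym_kproj Z : (kproj Z)^T = kproj Z.
Proof. exact: log_kronecker_sym (kproj_log_kronecker Z). Qed.

Lemma kronecker_kexp v : K (kexp v).
Proof. exact: log_kronecker_exp (kproj_log_kronecker _). Qed.

Lemma kexp_near v e : 0 < e -> exists2 delta, 0 < delta &
  forall w, `|v - w| < delta -> frobn (kexp v - kexp w) <= e.
Proof.
move=> e0; set A := kproj (vec_mx v); set rho := frobn A + 1.
set D : R := (n * m)%:R + 1; have D0 : 0 < D by rewrite ltr_wpDl.
have E0 := expR_gt0 rho.
exists (Num.min (D^-1) (e / (expR rho * D))).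
  by rewrite lt_min invr_gt0 D0 divr_gt0 // mulr_gt0.
move=> w; rewrite lt_min => /andP[h1 h2].
have AB : frobn (A - kproj (vec_mx w)) <= D * `|v - w|.
  rewrite -(kprojB hm hn); apply: le_trans (frobn_kproj hm hn _) _.
  by apply: le_trans (frobn_vec_mx v w) _; rewrite ler_wpM2r // lerDl.
have AB1 : frobn (A - kproj (vec_mx w)) <= 1.
  apply: le_trans AB _; rewrite -(@divff _ D) ?gt_eqF //.
  by rewrite ler_wpM2l ?(ltW D0) // ltW.
have hB : frobn (kproj (vec_mx w)) <= rho.
  rewrite -[kproj (vec_mx w)](subKr A); apply: le_trans (frobnD _ _) _.
  by rewrite frobnN lerD2l.
have hA : frobn A <= rho by rewrite lerDl.
apply: le_trans (expmx_lipschitz (sym_kproj _) (sym_kproj _) hA hB) _.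
apply: le_trans (ler_wpM2l (ltW E0) AB) _.
by rewrite ltr_pdivlMr ?mulr_gt0 // in h2; rewrite mulrA mulrC ltW.
Qed.

Lemma continuous_kexp : continuous kexp.
Proof. by apply: continuous_rV_mx => v e; exact: kexp_near. Qed.

Lemma continuous_objective_kexp M : spd M -> continuous (objective M \o kexp).
Proof.
move=> pM; apply: continuous_rV => v e e0.
have [d1 d10 h1] := objective_continuous pM (kronecker_spd (kronecker_kexp v)) e0.
have [d2 d20 h2] := kexp_near v d10.
exists d2 => // w vw; rewrite /= distrC; apply: h1.
  exact: kronecker_spd (kronecker_kexp w).
by rewrite frobnB h2.
Qed.

Lemma sqr_le_bound (x y : R) : 0 <= y -> x ^+ 2 <= y -> x <= 1 + y.
Proof. by move=> y0 h; have := sqr_ge0 (x - 1); rewrite sqrrB; lra. Qed.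

Lemma objective_log_bound M G r : spd M -> spd G -> objective M G <= r ->
  ai_dist G M <= 1 + 2 * r.
Proof.
move=> pM pG h; have r0 := le_trans (objective_ge0 M G) h.
by apply: sqr_le_bound; [lra|move: h; rewrite /objective; lra].
Qed.

Lemma compact_log_sublevel M r : spd M -> compact (log_sublevel M r).
Proof.
move=> pM; apply: bounded_closed_compact.
  exists (frobn (logmx M) + (1 + 2 * r)); split; first exact: num_real.
  move=> x hx v [v1 v2]; apply: le_trans (ltW hx).
  apply: le_trans (norm_le_vec_mx v) _; apply: le_trans (norm_le_frobn _) _.
  have -> : vec_mx v = kproj (vec_mx v).
    apply/esym/eqP; rewrite -subr_eq0; apply/eqP/frobn0_eq0/eqP.
    by rewrite eq_le v1 frobn_ge0.
  rewrite -[X in frobn X](subKr (logmx M)); apply: le_trans (frobnD _ _) _.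
  rewrite lerD2l frobnN frobnB.
  have := exponential_metric_increasing (spd_expmx (sym_kproj (vec_mx v))) pM.
  rewrite (logmx_expmx (sym_kproj _)) => h; apply: le_trans h _.
  by apply: objective_log_bound => //; exact/spd_expmx/sym_kproj.
have -> : log_sublevel M r =
    (fun v : rvec => frobn (kproj (vec_mx v) - vec_mx v)) @^-1` [set x | x <= 0] `&`
    (objective M \o kexp) @^-1` [set x | x <= r] by [].
apply: closedI; apply: closed_comp.
- move=> v _; apply: continuous_rV => {}v e e0.
  set D : R := (n * m)%:R + 1; have D0 : 0 < D by rewrite ltr_wpDl.
  exists (e / (2 * D)); first by rewrite divr_gt0 // mulr_gt0.
  move=> w; rewrite ltr_pdivlMr ?mulr_gt0 // => vw.
  have h := frobn_vec_mx v w.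
  set g := fun v : rvec => kproj (vec_mx v) - vec_mx v.
  have gB : frobn (g v - g w) <= e.
    have -> : g v - g w = kproj (vec_mx v - vec_mx w) - (vec_mx v - vec_mx w).
      rewrite /g (kprojB hm hn) !opprB [LHS]addrACA [RHS]addrACA.
      by congr (_ + _); exact: addrC.
    apply: le_trans (frobnD _ _) _; rewrite frobnN.
    apply: le_trans (lerD (frobn_kproj hm hn _) (lexx _)) _.
    apply: le_trans (ltW vw); apply: le_trans (lerD h h) _.
    have := normr_ge0 (v - w); rewrite /D; nra.
  have t1 : frobn (g v) <= frobn (g v - g w) + frobn (g w).
    by rewrite -{1}[g v](subrK (g w)) frobnD.
  have t2 : frobn (g w) <= frobn (g v - g w) + frobn (g v).
    by rewrite frobnB -{1}[g w](subrK (g v)) frobnD.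
  by rewrite ler_norml; apply/andP; split; rewrite -/(g v) -/(g w); lra.
- exact: closed_le.
- by move=> v _; exact: continuous_objective_kexp.
- exact: closed_le.
Qed.

Lemma sublevel_image M r : sublevel M r = kexp @` log_sublevel M r.
Proof.
apply/seteqP; split=> [G [KG fG]|G [v [v1 v2] <-]]; last first.
  by split=> //; exact: kronecker_kexp.
have LG := kronecker_logmx KG; have pG := kronecker_spd KG.
have e : kexp (mxvec (logmx G)) = G.
  by rewrite /kexp mxvecK (kproj_id hm hn LG) logmxK.
exists (mxvec (logmx G)) => //; split; last by rewrite e.
by rewrite mxvecK (kproj_id hm hn LG) subrr frobn0.
Qed.

Lemma compact_sublevel M r : spd M -> compact (sublevel M r).
Proof.
move=> pM; rewrite sublevel_image; apply: continuous_compact.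
  by apply: continuous_subspaceT; exact: continuous_kexp.
exact: compact_log_sublevel.
Qed.

(** Sublevel sets are images of compact sets, by [sublevel_image], on which
    the objective attains its minimum. *)
Lemma objective_min M : spd M -> exists2 P, K P &
  forall G, K G -> objective M P <= objective M G.
Proof.
move=> pM; set r := objective M (kexp 0).
have l0 : log_sublevel M r 0.
  split; last exact: lexx.
  have -> : vec_mx 0 = 0 :> 'M[R]_(n * m) by rewrite linear0.
  by rewrite (kproj_id hm hn (log_kronecker0 R m n)) subrr frobn0.
have r0 : log_sublevel M r !=set0 by exists 0.
have [v] := compact_EVT_min r0 (@compact_log_sublevel M r pM)
    (continuous_subspaceT (continuous_objective_kexp pM)).
move=> _ vmin; exists (kexp v); first exact: kronecker_kexp.
move=> G KG; have [Gr|/ltW rG] := leP (objective M G) r; last first.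
  by apply: le_trans rG; apply: (vmin 0); exact/mem_set.
have SG : sublevel M r G by split.
have SE := sublevel_image M r; rewrite SE in SG; case: SG => w wl <-.
by apply: vmin; exact/mem_set.
Qed.

Lemma proj_kroneckerP M : spd M -> K (proj_kronecker M) /\
  forall G, K G -> objective M (proj_kronecker M) <= objective M G.
Proof.
move=> pM.
have le_obj P G : K P -> K G ->
    (objective M P <= objective M G) = (ai_dist M P <= ai_dist M G).
  move=> KP KG; rewrite /objective ler_pM2l ?invr_gt0 //.
  rewrite ler_pXn2r ?nnegrE ?frobn_ge0 //.
  by rewrite !(ai_distC _ pM) //; exact: kronecker_spd.
have /getPex : exists P, [set P | K P /\
    forall G, K G -> ai_dist M P <= ai_dist M G] P.
  have [P KP Pmin] := objective_min pM; exists P; split=> // G KG.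
  by rewrite -le_obj // Pmin.
rewrite -/(proj_kronecker M) => -[KP Pmin]; split=> // G KG.
by rewrite le_obj // Pmin.
Qed.

Lemma within_sublevel M G r r' : spd M -> sublevel M r G -> r < r' ->
  within K (nbhs G) (sublevel M r').
Proof.
move=> pM [KG fG] rr'; have pG := kronecker_spd KG.
have e0 : 0 < r' - r by rewrite subr_gt0.
have [delta delta0 hd] := objective_continuous pM pG e0.
set D : R := (n * m)%:R + 1; have D0 : 0 < D by rewrite ltr_wpDl.
apply/(@nbhs_normP R ('M[R]_(n * m) : normedModType R)); exists (delta / D); first exact: divr_gt0.
move=> G' /=; rewrite ltr_pdivlMr // => GG' KG'; split=> //.
have := hd G' (kronecker_spd KG') _; rewrite ler_norml.
have : frobn (G' - G) <= delta.
  apply: le_trans (frobn_le_norm _) _; apply: le_trans (ltW GG').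
  by rewrite distrC mulrC ler_wpM2l // lerDl.
by move=> h1 /(_ h1)/andP[_]; lra.
Qed.

End compactness.

(** * Lipschitz continuity of the restricted gradient *)

Section lipschitz_gradient.
Variables (R : realType) (m n : nat).
Hypotheses (hm : (1 <= m)%N) (hn : (1 <= n)%N).
Implicit Types (M G W N V P Z : 'M[R]_(n * m)) (t r : R).

Local Notation K := (@kronecker_family R m n).
Local Notation L := (@log_kronecker R m n).

(** The whitened velocity is the logarithm of the whitened endpoint, which is
    in the family. *)
Lemma geodesic_kronecker (c : R -> 'M[R]_(n * m)) : geodesic c -> K (c 0) -> K (c 1) ->
  exists2 W, L W & c = ai_geod (c 0) W.
Proof.
move=> gc K0 K1; have [W symW cE] := geodesic_form gc; exists W => //.
have p0 := kronecker_spd K0; have p1 := kronecker_spd K1.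
suff -> : W = logmx (whiten (c 0) (c 1)) by exact/kronecker_logmx/kronecker_whiten.
by rewrite {2}cE (unwhitenK _ p0) scale1r logmx_expmx.
Qed.

Lemma sublevel_geodesically_convex M r : spd M -> geodesically_convex (sublevel M r).
Proof.
move=> pM c gc [K0 f0] [K1 f1] t t01.
have [W LW cE] := geodesic_kronecker gc K0 K1.
have symW := log_kronecker_sym LW; have p0 := kronecker_spd K0.
have := objective_geod_convex pM p0 symW t01; rewrite -cE => h.
split; first by rewrite cE; exact: kronecker_geod.
apply: le_trans h _; case/andP: t01 => t0 t1.
have t1' : 0 <= 1 - t by rewrite subr_ge0.
have := lerD (ler_wpM2l t1' f0) (ler_wpM2l t0 f1).
by move=> h; apply: le_trans h _; rewrite -mulrDl subrK mul1r.
Qed.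

Lemma ln_lipschitz (x y D : R) : expR (- D) <= x -> expR (- D) <= y ->
  `|ln x - ln y| <= expR D * `|x - y|.
Proof.
wlog yx : x y / y <= x.
  move=> H hx hy; have [yx|/ltW xy] := leP y x; first exact: H.
  by rewrite distrC (distrC x); exact: H.
move=> hx hy; have y0 : 0 < y := lt_le_trans (expR_gt0 _) hy.
have x0 : 0 < x := lt_le_trans y0 yx.
rewrite !ger0_norm ?subr_ge0 ?ler_ln ?posrE // -ln_div ?posrE //.
have xy0 : 0 < x / y by exact: divr_gt0.
have := expR_ge1Dx (ln (x / y)); rewrite lnK ?posrE // => h.
apply: (@le_trans _ _ ((x - y) / y)); first by rewrite mulrBl divff ?gt_eqF //; lra.
rewrite mulrC ler_wpM2r ?subr_ge0 //.
by rewrite -[D]opprK expRN lef_pV2 ?posrE ?expR_gt0.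
Qed.

Lemma eigenvalue_ge_log (d : nat) (B : 'M[R]_d) D x : spd B ->
  frobn (fcalc (@ln R) B) <= D -> eigenvalue B x -> expR (- D) <= x.
Proof.
move=> pB BD evx; have symB := spd_sym pB; have x0 := spd_eigenvalue pB evx.
have := eigenvalue_le_frobn (tr_fcalc B (@ln R)) (fcalc_eigenvalue (@ln R) symB evx).
move=> /le_trans/(_ BD); rewrite ler_norml => /andP[h _].
by rewrite -ler_expR lnK ?posrE // in h.
Qed.

(** The strong convexity inequality is quadratic in the length [frobn W], with
    a linear term bounded by the objective at [G]. *)
Lemma geodesic_length_bound M G W r : spd M -> spd G -> W^T = W ->
  objective M G <= r -> objective M (ai_geod G W 1) <= r ->
  frobn W <= 2 * r + 2 * (1 + 2 * r) + 1.
Proof.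
move=> pM pG symW fG fG'; have r0 := le_trans (objective_ge0 M G) fG.
have := objective_strongly_convex pM pG symW.
rewrite /ai_geod scale1r in fG' => h; have {}h := le_trans h fG'.
rewrite -frobn_sqr in h; set x := frobn W in h *.
have hD : frobn (logmx (whiten G M)) <= 1 + 2 * r by exact: objective_log_bound.
have hx := le_trans (ler_norm _) (frob_le (logmx (whiten G M)) W).
have x0 : 0 <= x by exact: frobn_ge0.
have hx' := le_trans hx (ler_wpM2r x0 hD).
have f0 := objective_ge0 M G.
have [x1|/ltW x1] := leP x 1; first by apply: le_trans x1 _; lra.
have : x * x <= (2 * r + 2 * (1 + 2 * r)) * x.
  have : 2 * r <= 2 * r * x by rewrite ler_peMr // mulr_ge0.
  by move: h hx'; rewrite expr2; lra.
rewrite ler_pM2r; last exact: lt_le_trans x1.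
by lra.
Qed.

Lemma conj_cancel (d : nat) (Q V V' : 'M[R]_d) : Q^T *m Q = 1%:M ->
  Q^T *m (Q *m (- V) *m Q^T + V') *m Q = Q^T *m V' *m Q - V.
Proof.
move=> QQ; rewrite mulmxDr mulmxDl !mulmxA QQ mul1mx -(mulmxA _ Q^T Q) QQ mulmx1.
exact: addrC.
Qed.

(** Both gradients are projections onto [L] of logarithms. Transporting the
    second back to the first point compares the logarithms of [H0] and [E *m
    H0 *m E], where [E] is the exponential of [- W / 2]. All spectra stay in a
    compact part of the positive half-line, where logarithm and exponential
    are Lipschitz, so the difference is bounded by a multiple of the length of
    [W]. *)
Lemma lipschitz_gradient M r : spd M ->
  exists L0, riemannian_lipschitz (sublevel M r) (restricted_grad K (objective M)) L0.
Proof.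
move=> pM; set D1 := 1 + 2 * r; set D2 := 2 * r + 2 * D1 + 1.
set o := frobn (1%:M : 'M[R]_(n * m)); have o0 : 0 <= o by exact: frobn_ge0.
pose B0 := o + expR D1 * D1.
pose B1 := o + expR D2 * D2 + 1.
have [r0|r0] := ltP r 0.
  exists 0; split=> // c Z _ [_ f0]; exfalso.
  by have := le_trans (objective_ge0 M (c 0)) f0; rewrite leNgt r0.
have D10 : 0 <= D1 by rewrite /D1; lra.
have D20 : 0 <= D2 by rewrite /D2; lra.
have B00 : 0 <= B0 by rewrite addr_ge0 ?mulr_ge0 ?expR_ge0.
have B10 : 0 <= B1 by rewrite !addr_ge0 ?mulr_ge0 ?expR_ge0.
exists (expR D1 * (expR D2 * B0 * B1)); split.
  by rewrite !mulr_ge0 ?expR_ge0.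
move=> c Z gc [K0 f0] [K1 f1] pZ Z0.
have [W LW cE] := geodesic_kronecker gc K0 K1.
have symW := log_kronecker_sym LW; have p0 := kronecker_spd K0.
have p1 := kronecker_spd K1.
set G := c 0 in K0 f0 p0 Z0 cE *.
have c1 : c 1 = ai_geod G W 1 by rewrite cE.
rewrite c1 in f1 K1 p1 *; rewrite cE in pZ.
rewrite (restricted_gradE hm hn pM K0) in Z0.
rewrite (restricted_gradE hm hn pM K1) (ai_dist_geod _ p0 symW) normr1 mul1r.
set G' := ai_geod G W 1 in f1 K1 p1 *; set x := frobn W.
have xD2 : x <= D2 := geodesic_length_bound pM p0 symW f0 f1.
set V := direction M G in Z0; set V' := direction M G'.
set Q := transport G W 1; have QQ := transport_orthogonal 1 p0 symW.
have QQ' : (Q^T)^T *m Q^T = 1%:M by rewrite trmxK; exact: mulmx1C.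
(* The defect is read in the frame transported from [G]: there the projection
   onto [L] is the same at both ends, and only two logarithms are compared. *)
have -> : ai_norm G' (Z 1 - kgrad M G') = frobn (Q^T *m V' *m Q - V).
  have Z1 : whiten G' (Z 1) = Q *m (- V) *m Q^T.
    rewrite -[Z 1](whitenK _ p0) (parallel_form 1 p0 symW pZ) Z0.
    rewrite /kgrad whitenN (unwhitenK _ p0).
    exact: whiten_geod.
  rewrite /ai_norm whitenB Z1 /kgrad whitenN (unwhitenK _ p1) opprK -/V'.
  by rewrite -(frobn_orthogonal _ QQ') trmxK (conj_cancel _ _ QQ).
set H0 := whiten G M; set B := whiten G' M.
set E := expmx (- (1 / 2) *: W).
have pB : spd B by exact: spd_whiten.
have pH0 : spd H0 by exact: spd_whiten.
have symB := spd_sym pB; have symH0 := spd_sym pH0.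
have BE : Q^T *m B *m Q = E *m H0 *m E by exact: whiten_geod_factor.
set H1 := E *m H0 *m E in BE.
have symH1 : H1^T = H1 by rewrite -BE; exact: tr_conjV.
have logH1 : fcalc (@ln R) H1 = Q^T *m logmx B *m Q.
  rewrite (logmx_fcalc pB) -BE.
  by have := orthogonal_fcalc (@ln R) QQ' symB; rewrite trmxK.
have -> : Q^T *m V' *m Q - V = kproj (fcalc (@ln R) H1 - fcalc (@ln R) H0).
  rewrite (kprojB hm hn) logH1 (kproj_transport hm hn _ _ K0 LW).
  by rewrite -(logmx_fcalc pH0) /V' /V !directionE.
apply: le_trans (frobn_kproj hm hn _) _.
have hB : frobn (logmx B) <= D1 by exact: objective_log_bound.
have hH0 : frobn (fcalc (@ln R) H0) <= D1.
  by rewrite -(logmx_fcalc pH0); exact: objective_log_bound.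
have hH1 : frobn (fcalc (@ln R) H1) <= D1.
  have := frobn_orthogonal (logmx B) QQ'; rewrite trmxK logH1 => ->.
  exact: hB.
have pE : spd E by apply: spd_expmx; rewrite linearZ /= symW.
have pH1 : spd H1.
  rewrite /H1 -{2}(spd_sym pE); apply: spd_congr => //; exact: spd_unit.
have lip : frobn (fcalc (@ln R) H1 - fcalc (@ln R) H0) <= expR D1 * frobn (H1 - H0).
  apply: (fcalc_lipschitz symH1 symH0 (expR_ge0 D1)).
  move=> a b eva evb; apply: ln_lipschitz.
    exact: eigenvalue_ge_log pH1 hH1 eva.
  exact: eigenvalue_ge_log pH0 hH0 evb.
apply: le_trans lip _; rewrite -mulrA ler_wpM2l ?expR_ge0 //.
have sym0 : (0 : 'M[R]_(n * m))^T = 0 by rewrite trmx0.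
have E1 : frobn (E - 1%:M) <= expR D2 * x.
  have symV1 : (- (1 / 2) *: W)^T = - (1 / 2) *: W by rewrite linearZ /= symW.
  have half : frobn (- (1 / 2) *: W) <= x.
    rewrite frobnZ normrN ger0_norm ?divr_ge0 // -/x ler_piMl ?frobn_ge0 //; lra.
  have := @expmx_lipschitz R _ _ _ D2 symV1 sym0 (le_trans half xD2) _.
  rewrite frobn0 subr0 expmx0 => /(_ D20) h; apply: le_trans h _.
  by rewrite ler_wpM2l ?expR_ge0.
have Eb : frobn E <= o + expR D2 * D2.
  rewrite -[E](subrK 1%:M) addrC; apply: le_trans (frobnD _ _) _.
  rewrite lerD2l; apply: le_trans E1 _.
  by rewrite ler_wpM2l ?expR_ge0.
have Hb : frobn H0 <= B0.
  rewrite -[H0](subrK 1%:M) addrC; apply: le_trans (frobnD _ _) _.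
  rewrite lerD2l; rewrite -(logmxK pH0) -expmx0.
  have symL := tr_logmx pH0; rewrite -(logmx_fcalc pH0) in hH0.
  have := @expmx_lipschitz R _ _ _ D1 symL sym0 hH0 _.
  rewrite frobn0 subr0 => /(_ D10) h; apply: le_trans h _.
  by rewrite ler_wpM2l ?expR_ge0.
have -> : H1 - H0 = E *m H0 *m (E - 1%:M) + (E - 1%:M) *m H0.
  by rewrite mulmxBr mulmxBl mulmx1 mul1mx addrA subrK.
apply: le_trans (frobnD _ _) _.
have b1 : frobn (E *m H0 *m (E - 1%:M)) <= (o + expR D2 * D2) * B0 * (expR D2 * x).
  apply: le_trans (frobn_mul _ _) _; rewrite ler_pM ?frobn_ge0 //.
  by apply: le_trans (frobn_mul _ _) _; rewrite ler_pM ?frobn_ge0.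
have b2 : frobn ((E - 1%:M) *m H0) <= expR D2 * x * B0.
  by apply: le_trans (frobn_mul _ _) _; rewrite ler_pM ?frobn_ge0.
apply: le_trans (lerD b1 b2) _; rewrite le_eqVlt; apply/orP; left; apply/eqP.
by rewrite /B1; ring.
Qed.

(** The sublevel set one unit higher is a compact, geodesically convex
    neighborhood. *)
Lemma grad_lipschitz_exists M G0 : spd M -> K G0 ->
  exists L0, grad_lipschitz_near K (sublevel_kronecker M G0) (objective M) L0.
Proof.
move=> pM KG0; have [L0 hL] := lipschitz_gradient (objective M G0 + 1) pM.
exists L0; exists (sublevel M (objective M G0 + 1)) => //; split.
- by move=> G [].
- exact: compact_sublevel.
- exact: sublevel_geodesically_convex.
- by move=> G QG; apply: within_sublevel QG _ => //; rewrite ltrDl.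
Qed.

End lipschitz_gradient.

(** * Sufficient decrease *)

Section descent.
Variables (R : realType) (m n : nat).
Hypotheses (hm : (1 <= m)%N) (hn : (1 <= n)%N).
Implicit Types (M G W V P Z : 'M[R]_(n * m)) (N Q : set 'M[R]_(n * m)) (t r : R).

Local Notation K := (@kronecker_family R m n).
Local Notation L := (@log_kronecker R m n).

Lemma ai_geodZ G W a t : ai_geod G (a *: W) t = ai_geod G W (t * a).
Proof. by rewrite /ai_geod scalerA. Qed.

Lemma velocityZ G W a t : velocity G (a *: W) t = a *: velocity G W (t * a).
Proof. by rewrite /velocity scalerA /unwhiten -!scalemxAl -scalemxAr -scalemxAl. Qed.

Lemma ai_dot_velocity G W t : spd G -> W^T = W ->
  ai_dot (ai_geod G W t) (velocity G W t) (velocity G W t) = frobn W ^+ 2.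
Proof.
move=> pG symW; rewrite /ai_dot (whiten_velocity t pG symW) -frobn_sqr.
by rewrite (frobn_orthogonal _ (transport_orthogonal t pG symW)).
Qed.

Lemma ai_dot_le (d : nat) (S X Y : 'M[R]_d) : ai_dot S X Y <= ai_norm S X * ai_norm S Y.
Proof. exact: le_trans (ler_norm _) (frob_le _ _). Qed.

Lemma ai_norm_velocity G W t : spd G -> W^T = W ->
  ai_norm (ai_geod G W t) (velocity G W t) = frobn W.
Proof.
move=> pG symW; rewrite /ai_norm (whiten_velocity t pG symW).
by rewrite (frobn_orthogonal _ (transport_orthogonal t pG symW)).
Qed.

(** The gradient at the start of the geodesic is minus its velocity, which is
    parallel: the Lipschitz condition bounds how far the gradient at time [t]
    is from minus the velocity at time [t]. *)
Lemma descent_slope M N (L0 : R) G t : spd M -> N `<=` K ->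
  riemannian_lipschitz N (restricted_grad K (objective M)) L0 ->
  let V := direction M G in
  0 < t -> N G -> N (ai_geod G V t) ->
  ai_dot (ai_geod G V t) (kgrad M (ai_geod G V t)) (velocity G V t) <=
  - (1 - L0 * t) * frobn V ^+ 2.
Proof.
move=> pM NK [L00 lip] V t0 NG NGt; have KG := NK _ NG; have KGt := NK _ NGt.
have pG := kronecker_spd KG; have LV : L V by exact: direction_log_kronecker.
have symV := log_kronecker_sym LV.
have symtV : (t *: V)^T = t *: V by rewrite linearZ /= symV.
pose c := ai_geod G (t *: V).
have c0 : c 0 = G by exact: ai_geod0.
have c1 : c 1 = ai_geod G V t by rewrite /c ai_geodZ mul1r.
pose Z s := (- t^-1) *: velocity G (t *: V) s.
have scale X : (- t^-1) *: (t *: X) = - X.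
  by rewrite scalerA mulNr mulVf ?gt_eqF // scaleN1r.
have Z0 : Z 0 = restricted_grad K (objective M) (c 0).
  rewrite c0 (restricted_gradE hm hn pM KG) /kgrad /Z velocityZ scale mul0r.
  by rewrite /velocity scale0r expmx0 mulmx1.
have Z1 : Z 1 = - velocity G V t by rewrite /Z velocityZ scale mul1r.
have NC0 : N (c 0) by rewrite c0.
have NC1 : N (c 1) by rewrite c1.
have := lip c Z (geodesic_geod pG symtV) NC0 NC1 (parallel_velocity _ pG symtV) Z0.
rewrite c0 Z1 c1 (restricted_gradE hm hn pM KGt).
rewrite -c1 /c (ai_dist_geod _ pG symtV) normr1 mul1r frobnZ (gtr0_norm t0) -/c c1.
set Gt := ai_geod G V t; set D := velocity G V t; set X := kgrad M Gt => h.
have DD : ai_dot Gt D D = frobn V ^+ 2 by exact: ai_dot_velocity.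
have := ai_dot_le Gt (- (- D - X)) D.
rewrite opprB opprK => h2.
have -> : ai_dot Gt X D = ai_dot Gt (X + D) D - frobn V ^+ 2.
  by rewrite -DD -ai_dotBl addrK.
have h3 : ai_norm Gt (X + D) <= L0 * (t * frobn V).
  by rewrite /ai_norm -frobnN -whitenN opprD addrC.
have h4 := le_trans h2 (ler_wpM2r (frobn_ge0 (whiten Gt D)) h3).
have nD : frobn (whiten Gt D) = frobn V by exact: ai_norm_velocity.
move: h4; rewrite nD mulNr mulrBl mul1r opprB lerD2r => h4; apply: le_trans h4 _.
by rewrite le_eqVlt; apply/orP; left; apply/eqP; ring.
Qed.

Lemma continuous_geod G W : W^T = W -> continuous (ai_geod G W).
Proof.
move=> symW t; apply: differentiable_continuous; apply/derivable1_diffP.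
by have h := is_derive_geod G t symW; exact: ex_derive.
Qed.

(** The mean value theorem applied to the objective minus its quadratic model,
    whose derivative is nonpositive by [descent_slope]. *)
Lemma descent_segment M N (L0 : R) G (T : R) : spd M -> N `<=` K ->
  riemannian_lipschitz N (restricted_grad K (objective M)) L0 ->
  let V := direction M G in
  N G -> 0 <= T -> (forall t, 0 <= t <= T -> N (ai_geod G V t)) ->
  objective M (ai_geod G V T) <=
  objective M G - T * (1 - L0 * T / 2) * frobn V ^+ 2.
Proof.
move=> pM NK lip V NG T0 NT; have KG := NK _ NG; have pG := kronecker_spd KG.
have [<-|T_neq0] := eqVneq 0 T; first by rewrite (ai_geod0 V pG) !mul0r subr0.
have {T_neq0}Tgt0 : 0 < T by rewrite lt0r eq_sym T_neq0.
set v2 := frobn V ^+ 2.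
pose phi (t : R) := objective M (ai_geod G V t).
pose dphi t := ai_dot (ai_geod G V t) (kgrad M (ai_geod G V t)) (velocity G V t).
have phiE t : is_derive t 1 phi (dphi t) by exact: is_derive_objective_geod.
pose q : {poly R} := (v2 / 2 * L0) *: 'X^2 - v2 *: 'X.
pose psi (t : R) := phi t - q.[t].
have psiE t : is_derive t 1 psi (dphi t - q^`().[t]).
  exact: (is_deriveB (phiE t) (is_derive_poly q t)).
have qE t : q.[t] = v2 / 2 * L0 * t ^+ 2 - v2 * t by rewrite /q !hornerE.
have q'E t : q^`().[t] = v2 * L0 * t - v2.
  by rewrite /q !poly.derivE !hornerE /=; field.
have psi_cont : {within `[0, T], continuous psi}.
  by apply: derivable_within_continuous => t _; have h := psiE t; exact: ex_derive.
have [c c0T cE] := MVT Tgt0 (fun t _ => psiE t) psi_cont.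
move: c0T; rewrite in_itv /= => /andP[c0 cT].
have slope : dphi c - q^`().[c] <= 0.
  have NC : N (ai_geod G V c) by apply: NT; rewrite !ltW.
  have := descent_slope pM NK lip c0 NG NC; rewrite -/V -/(dphi c) -/v2 q'E.
  by rewrite mulNr mulrBl mul1r; lra.
have : psi T - psi 0 <= 0.
  by rewrite cE subr0 pmulr_lle0.
rewrite /psi !qE /phi (ai_geod0 V pG) expr0n /= !mulr0 subrr subr0.
by move=> h; rewrite -subr_le0; apply: le_trans h; rewrite le_eqVlt; apply/orP; left; apply/eqP; field.
Qed.

(** The neighborhood is closed and geodesically convex, so the geodesic meets
    it in a closed interval of times starting at 0. As [l * T <= 2],
    [descent_segment] shows that the objective has not increased at the end of
    that interval; the point reached lies in the sublevel set, which is
    interior to the neighborhood, so the interval cannot stop before [T]. *)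
Lemma geodesic_stays M N (L0 l : R) G (T : R) : spd M ->
  compact_geodesic_nbhd K [set G' | K G' /\ objective M G' <= objective M G] N ->
  riemannian_lipschitz N (restricted_grad K (objective M)) L0 ->
  0 < l -> L0 <= l -> 0 <= T -> l * T <= 2 -> K G ->
  forall t, 0 <= t <= T -> N (ai_geod G (direction M G) t).
Proof.
move=> pM [NK Ncomp Nconv Nnbhs] lip l0 L0l T0 lT KG.
set V := direction M G.
have LV : L V by exact: direction_log_kronecker.
have pG := kronecker_spd KG; have symV := log_kronecker_sym LV.
have gcont := continuous_geod (G := G) symV.
have QG : N G.
  have := Nnbhs G (conj KG (lexx _)); rewrite /within /= => /nbhs_singleton.
  exact.
have convex s t : 0 <= t <= s -> N (ai_geod G V s) -> N (ai_geod G V t).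
  move=> /andP[t0 ts] Ns.
  have [s0|s_neq0] := eqVneq s 0.
    have -> : t = 0 by apply/eqP; rewrite eq_le t0 -s0 ts.
    by rewrite (ai_geod0 V pG).
  have sgt0 : 0 < s by rewrite lt0r s_neq0 (le_trans t0 ts).
  have symsV : (s *: V)^T = s *: V by rewrite linearZ /= symV.
  have := Nconv (ai_geod G (s *: V)) (geodesic_geod pG symsV).
  rewrite (ai_geod0 _ pG) ai_geodZ mul1r => /(_ QG Ns (t / s)).
  rewrite ai_geodZ divfK //; apply.
  by rewrite divr_ge0 ?(ltW sgt0) //= ler_pdivrMr // mul1r.
(* Times up to which the geodesic has not left the neighborhood. *)
pose A := `[0, T]%classic `&` ai_geod G V @^-1` N.
have Ac : compact A.
  apply: (subclosed_compact _ (@segment_compact _ 0 T)); last by move=> x [].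
  apply: closedI; first exact: itv_closed.
  apply: closed_comp => [x _|]; first exact: gcont.
  by apply: compact_closed => //; exact: norm_hausdorff.
have A0 : A !=set0.
  by exists 0; split; rewrite /= ?in_itv /= ?lexx ?T0 // (ai_geod0 V pG).
have [t0 /set_mem[t0T Nt0] t0max] := compact_EVT_max A0 Ac
  (continuous_subspaceT (fun x : R => @cvg_id _ (nbhs x))).
move: t0T; rewrite /= in_itv /= => /andP[t00 t0T].
suff t0E : t0 = T.
  by move=> t tT; apply: (convex T) => //; rewrite -t0E.
apply/eqP; rewrite eq_le t0T leNgt; apply/negP => t0_lt_T.
have Nup t : 0 <= t <= t0 -> N (ai_geod G V t) by move=> h; exact: convex h Nt0.
have desc := descent_segment pM NK lip QG t00 Nup; rewrite -/V in desc.
have Qt0 : objective M (ai_geod G V t0) <= objective M G.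
  apply: le_trans desc _; rewrite gerBl mulr_ge0 ?sqr_ge0 // mulr_ge0 //.
  have : L0 * t0 <= l * T by rewrite ler_pM //; case: lip.
  by lra.
have near_t0 : \forall t \near t0, N (ai_geod G V t).
  have h := Nnbhs _ (conj (NK _ Nt0) Qt0).
  have h2 : nbhs t0 (ai_geod G V @^-1` [set G' | K G' -> N G']).
    exact: (gcont t0 _ h).
  have sub : ai_geod G V @^-1` [set G' | K G' -> N G'] `<=` ai_geod G V @^-1` N.
    by move=> t /=; apply; exact: kronecker_geod.
  exact: (filterS sub h2).
have [e /= e0 he] := (iffLR (nbhs_ballP _ _)) near_t0.
pose t1 := Num.min T (t0 + e / 2).
have t01 : t0 < t1 by rewrite lt_min t0_lt_T ltrDl divr_gt0.
have At1 : A t1.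
  split; first by rewrite /= in_itv /= (le_trans t00 (ltW t01)) ge_min lexx.
  apply: he; rewrite /ball /= ltr0_norm ?subr_lt0 // opprB ltrBlDl.
  by rewrite gt_min; apply/orP; right; rewrite ltrD2l; lra.
by have := t0max t1 (mem_set At1); rewrite leNgt t01.
Qed.

(** For [t <= 2 * (1 - c) / L0] the factor [1 - L0 * t / 2] of
    [descent_segment] is at least [c]. The maximum with 1 covers [L0 = 0]. *)
Lemma armijo_small M Q (L0 c : R) G t : spd M -> 0 < c < 1 ->
  grad_lipschitz_near K Q (objective M) L0 ->
  [set G' | K G' /\ objective M G' <= objective M G] `<=` Q ->
  K G -> 0 < t <= 2 * (1 - c) / Num.max L0 1 -> armijo M c G t.
Proof.
move=> pM /andP[c0 c1] [N [NK Ncomp Nconv Nnbhs] lip] QQ KG /andP[t0 tl].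
set l := Num.max L0 1 in tl.
have l0 : 0 < l by rewrite lt_max ltr01 orbT.
have L0l : L0 <= l by rewrite le_max lexx.
rewrite ler_pdivlMr // mulrC in tl.
have lt2 : l * t <= 2 by apply: le_trans tl _; lra.
have nb : compact_geodesic_nbhd K [set G' | K G' /\ objective M G' <= objective M G] N.
  by split=> // G' /QQ; exact: Nnbhs.
have stay := geodesic_stays pM nb lip l0 L0l (ltW t0) lt2 KG.
have NG : N G.
  rewrite -(ai_geod0 (direction M G) (kronecker_spd KG)).
  by apply: stay; rewrite lexx ltW.
have := descent_segment pM NK lip NG (ltW t0) stay.
rewrite /armijo => h; apply: le_trans h _; rewrite lerD2l lerN2.
rewrite (mulrC c) ler_wpM2r ?sqr_ge0 // ler_wpM2l ?(ltW t0) //.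
have : L0 * t <= l * t by rewrite ler_wpM2r // ltW.
by lra.
Qed.

End descent.

(** * The iteration *)

Section iteration.
Variables (R : realType) (m n : nat).
Hypotheses (hm : (1 <= m)%N) (hn : (1 <= n)%N).
Implicit Types (M G W V P Z : 'M[R]_(n * m)).

Local Notation K := (@kronecker_family R m n).
Local Notation L := (@log_kronecker R m n).

Definition safe_step (L0 c : R) : R := 2 * (1 - c) / Num.max L0 1.

(** The three terms are: the first trial; a safe step shrunk by [gamma],
    because a rejected trial exceeds the safe step and the accepted one is at
    least [gamma] times it; and the bound that keeps the rate nonnegative. *)
Definition step_bound (Q : set 'M[R]_(n * m)) (L0 etabar gamma c : R) : R :=
  Num.min etabar (Num.min (gamma * safe_step L0 c) (2 * c)^-1).

Lemma kronecker_update M G eta : K G -> K (update M G eta).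
Proof. by move=> KG; apply: kronecker_geod => //; exact: direction_log_kronecker. Qed.

Lemma proj_kronecker_unique M G : spd M -> K G -> direction M G = 0 ->
  G = proj_kronecker M.
Proof.
move=> pM KG V0; have [KP Pmin] := proj_kroneckerP hm hn pM.
have pG := kronecker_spd KG; have pP := kronecker_spd KP.
have h := direction0_min hm hn pM KG KP V0; have h' := Pmin G KG.
have d0 : frobn (logmx (whiten G (proj_kronecker M))) = 0.
  apply/eqP; rewrite -sqrf_eq0 eq_le sqr_ge0 andbT.
  by have := le_trans h h'; rewrite /ai_dist; lra.
have := ai_geod_log pG pP; rewrite (frobn0_eq0 d0) /ai_geod scaler0 expmx0.
by rewrite (unwhiten1 pG).
Qed.

Lemma direction_proj_kronecker M : spd M -> direction M (proj_kronecker M) = 0.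
Proof.
move=> pM; have [KP Pmin] := proj_kroneckerP hm hn pM.
exact: min_direction0 hm hn _ _ pM KP Pmin.
Qed.

Variables (M G0 : 'M[R]_(n * m)) (etabar gamma c L0 : R).
Hypotheses (pM : spd M) (KG0 : K G0) (etabar0 : 0 < etabar).
Hypotheses (gamma01 : 0 < gamma < 1) (c01 : 0 < c < 1).
Let f := objective M.
Let Q0 := sublevel_kronecker M G0.
Let it := iterate M G0 etabar gamma c.
Let P := proj_kronecker M.
Hypothesis hL0 : grad_lipschitz_near K Q0 f L0.
Let tau := safe_step L0 c.
Let eta := step_bound Q0 L0 etabar gamma c.

Lemma tau_gt0 : 0 < tau.
Proof.
by case/andP: c01 => c0 c1; rewrite divr_gt0 ?lt_max ?ltr01 ?orbT // mulr_gt0 // subr_gt0.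
Qed.

Lemma eta_gt0 : 0 < eta.
Proof.
case/andP: c01 => c0 _; case/andP: gamma01 => g0 _.
by rewrite !lt_min etabar0 mulr_gt0 ?tau_gt0 ?invr_gt0 ?mulr_gt0.
Qed.

Lemma eta_le : eta <= (2 * c)^-1.
Proof. by rewrite /eta /step_bound !ge_min lexx !orbT. Qed.

Lemma armijo_tau G t : Q0 G -> 0 < t <= tau -> armijo M c G t.
Proof.
move=> [KG fG]; apply: (armijo_small hm hn pM c01 hL0) => //.
by move=> G' [KG' fG']; split=> //; exact: le_trans fG.
Qed.

Lemma trial_gt0 k : 0 < etabar * gamma ^+ k.
Proof. by case/andP: gamma01 => g0 _; rewrite mulr_gt0 ?exprn_gt0. Qed.

Lemma trial_mono k l : (k <= l)%N -> etabar * gamma ^+ l <= etabar * gamma ^+ k.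
Proof.
case/andP: gamma01 => g0 g1 kl.
by rewrite ler_wpM2l ?(ltW etabar0) // ler_wiXn2l // ltW.
Qed.

Lemma expr_small e : 0 < e -> exists k : nat, gamma ^+ k <= e.
Proof.
move=> e0; case/andP: gamma01 => g0 g1.
have g1' : `|gamma| < 1 by rewrite gtr0_norm.
have /cvgrPdist_le/(_ e e0)[k _ hk] := cvg_expr g1'.
exists k; have := hk k (leqnn k); rewrite /= sub0r normrN ger0_norm //.
by rewrite exprn_ge0 // ltW.
Qed.

Lemma step_size_exists G : Q0 G -> exists eta_r, step_size M etabar gamma c G eta_r.
Proof.
move=> QG.
have ex : exists k, `[< armijo M c G (etabar * gamma ^+ k) >].
  have [k hk] := expr_small (divr_gt0 tau_gt0 etabar0).
  exists k; apply/asboolP/armijo_tau => //; rewrite trial_gt0 /=.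
  by rewrite mulrC -ler_pdivlMr.
case: (ex_minnP ex) => k /asboolP ak kmin.
exists (etabar * gamma ^+ k); split=> // _ [l _ <-] al.
by apply/trial_mono/kmin/asboolP.
Qed.

Lemma step_size_unique G eta1 eta2 : step_size M etabar gamma c G eta1 ->
  step_size M etabar gamma c G eta2 -> eta1 = eta2.
Proof.
by move=> [t1 a1 m1] [t2 a2 m2]; apply/eqP; rewrite eq_le m1 // m2.
Qed.

Lemma step_size_ge G eta_r : Q0 G -> step_size M etabar gamma c G eta_r -> eta <= eta_r.
Proof.
move=> QG [[[|k] _ <-] ak kmax].
  by rewrite expr0 mulr1 /eta /step_bound ge_min lexx.
case/andP: gamma01 => g0 g1.
rewrite leNgt; apply/negP => small.
have h : gamma * (etabar * gamma ^+ k) < gamma * tau.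
  rewrite mulrCA -exprS; apply: lt_le_trans small _.
  by rewrite /eta /step_bound !ge_min lexx orbT.
rewrite ltr_pM2l // in h.
have ak' : armijo M c G (etabar * gamma ^+ k).
  by apply: armijo_tau => //; rewrite trial_gt0 ltW.
have := kmax _ (ex_intro2 _ _ k I erefl) ak'.
by rewrite exprS mulrCA leNgt gtr_pMl ?trial_gt0 // g1.
Qed.

Lemma iterate_Q0 r G : it r G -> Q0 G.
Proof.
elim=> {r G} [|r G eta_r _ [KG fG] _ [[k _ <-] ak _]]; first by split.
split; first exact: kronecker_update.
apply: le_trans ak _; apply: le_trans fG; rewrite gerBl.
case/andP: c01 => c0 _.
by rewrite mulr_ge0 ?sqr_ge0 // mulr_ge0 ?(ltW c0) // ltW ?trial_gt0.
Qed.

Let rho := 1 - 2 * c * eta.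

Lemma rho_ge0 : 0 <= rho.
Proof.
case/andP: c01 => c0 _; have := eta_le.
by rewrite -[_^-1]mul1r ler_pdivlMr ?mulr_gt0 // mulrC subr_ge0.
Qed.

Lemma rho_lt1 : rho < 1.
Proof.
by case/andP: c01 => c0 _; rewrite gtrBl !mulr_gt0 ?eta_gt0.
Qed.

(** The Armijo inequality with [eta <= eta_r], followed by
    [gradient_dominance], multiplies the gap by at most [1 - 2 * c * eta]. *)
Lemma iterate_rate r G : it r G -> f G - f P <= rho ^+ r * (f G0 - f P).
Proof.
elim=> {r G} [|r G eta_r itG IH _ st]; first by rewrite expr0 mul1r.
have QG := iterate_Q0 itG; have [KG _] := QG.
have [KP _] := proj_kroneckerP hm hn pM.
have eta_ge := step_size_ge QG st; have [_ ak _] := st.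
case/andP: c01 => c0 _.
have dom := gradient_dominance hm hn pM KG KP.
rewrite exprS -mulrA; apply: le_trans (ler_wpM2l rho_ge0 IH).
rewrite -/f in dom; rewrite -/P in dom.
apply: (@le_trans _ _ (f G - c * eta_r * frobn (direction M G) ^+ 2 - f P)).
  by rewrite lerD2r.
set v2 := frobn (direction M G) ^+ 2 in dom *.
have v20 : 0 <= v2 by exact: sqr_ge0.
have h1 : c * eta * v2 <= c * eta_r * v2 by rewrite ler_wpM2r // ler_wpM2l // ltW.
have h2 : c * eta * (2 * (f G - f P)) <= c * eta * v2.
  by rewrite ler_wpM2l ?mulr_ge0 ?(ltW c0) ?(ltW eta_gt0) //; lra.
have -> : rho * (f G - f P) = f G - f P - c * eta * (2 * (f G - f P)).
  by rewrite /rho; ring.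
lra.
Qed.

Lemma iterate_next r G : it r G -> direction M G <> 0 -> exists G', it r.+1 G'.
Proof.
move=> itG V0; have [e st] := step_size_exists (iterate_Q0 itG).
by exists (update M G e); exact: iterateS itG V0 st.
Qed.

(** Convergence in the Riemannian distance implies convergence of entries,
    because the exponential is Lipschitz on bounded sets. *)
Lemma ai_dist_cvg (e : R) : 0 < e -> exists2 delta, 0 < delta &
  forall G, K G -> ai_dist P G ^+ 2 <= delta -> frobn (G - P) <= e.
Proof.
move=> e0; have [KP _] := proj_kroneckerP hm hn pM.
rewrite -/P in KP; have pP := kronecker_spd KP.
set s := frobn (sqrtmx P); have s0 : 0 <= s by exact: frobn_ge0.
pose C := s * expR 1 * s + 1.
have C0 : 0 < C by rewrite ltr_wpDl // !mulr_ge0 ?expR_ge0.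
pose d := Num.min 1 (e / C).
have d0 : 0 < d by rewrite lt_min ltr01 divr_gt0.
exists (d ^+ 2); first by rewrite exprn_gt0.
move=> G KG; have pG := kronecker_spd KG.
rewrite ler_pXn2r ?nnegrE ?frobn_ge0 ?(ltW d0) // /ai_dist.
set W := logmx _ => Wd.
have symW : W^T = W by apply: tr_logmx; exact: spd_whiten.
have GE : G = unwhiten P (expmx W).
  by have := ai_geod_log pP pG; rewrite /ai_geod scale1r.
have -> : G - P = sqrtmx P *m (expmx W - expmx 0) *m sqrtmx P.
  by rewrite {1}GE expmx0 mulmxBr mulmxBl mulmx1 (sqrtmxK pP).
have sym0 : (0 : 'M[R]_(n * m))^T = 0 by rewrite trmx0.
have W1 : frobn W <= 1 by apply: le_trans Wd _; rewrite ge_min lexx.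
have := @expmx_lipschitz R _ _ _ 1 symW sym0 W1 _.
rewrite frobn0 subr0 => /(_ ler01) h.
apply: le_trans (frobn_mul _ _) _; rewrite -/s.
apply: (@le_trans _ _ (s * (expR 1 * frobn W) * s)).
  rewrite ler_wpM2r //; apply: le_trans (frobn_mul _ _) _.
  by rewrite ler_wpM2l.
have WC : frobn W * C <= e.
  by rewrite -ler_pdivlMr //; apply: le_trans Wd _; rewrite ge_min lexx orbT.
apply: le_trans WC; rewrite /C.
have := frobn_ge0 W; have -> : s * (expR 1 * frobn W) * s = frobn W * (s * expR 1 * s) by ring.
by rewrite mulrDr mulr1; lra.
Qed.

(** The gap tends to 0 geometrically and dominates the squared distance to [P]
    by [direction0_min]. *)
Lemma iterate_cvg (G_ : nat -> 'M[R]_(n * m)) : (forall r, it r (G_ r)) ->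
  G_ r @[r --> \oo] --> P.
Proof.
move=> itG; have [KP _] := proj_kroneckerP hm hn pM; rewrite -/P in KP.
have V0 := direction_proj_kronecker pM; rewrite -/P in V0.
apply/cvgrPdist_le => e e0; have [delta delta0 hd] := ai_dist_cvg e0.
set C := 2 * (f G0 - f P) + 1.
have fP0 : 0 <= f G0 - f P.
  by rewrite subr_ge0; have [_ ->] := proj_kroneckerP hm hn pM.
have C0 : 0 < C by rewrite ltr_wpDl // mulr_ge0.
have rho1 : `|rho| < 1 by rewrite ger0_norm ?rho_ge0 ?rho_lt1.
have /cvgrPdist_le/(_ _ (divr_gt0 delta0 C0)) := cvg_expr rho1.
apply: filterS => r; rewrite sub0r normrN ger0_norm ?exprn_ge0 ?rho_ge0 //.
rewrite ler_pdivlMr // => hr.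
apply: le_trans (norm_le_frobn _) _; rewrite frobnB.
have [KG _] := iterate_Q0 (itG r).
apply: hd => //; apply: le_trans hr.
have h1 := direction0_min hm hn pM KP KG V0.
have h2 := iterate_rate (itG r); rewrite -/f in h1.
have : 0 <= rho ^+ r by rewrite exprn_ge0 ?rho_ge0.
have -> : rho ^+ r * C = 2 * (rho ^+ r * (f G0 - f P)) + rho ^+ r by rewrite /C; ring.
lra.
Qed.

Lemma iterate_dichotomy : (exists2 r, it r P & direction M P = 0) \/
  (exists2 G_ : nat -> 'M[R]_(n * m),
     forall r, it r (G_ r) & G_ r @[r --> \oo] --> P).
Proof.
have [[r [G [itG V0]]]|noend] := pselect (exists r G, it r G /\ direction M G = 0).
  left; exists r; last exact: direction_proj_kronecker.
  have [KG _] := iterate_Q0 itG.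
  by rewrite /P -(proj_kronecker_unique pM KG V0).
right; have all_r r : exists G, it r G.
  elim: r => [|r [G itG]]; first by exists G0; exact: iterate0.
  by apply: (iterate_next itG) => V0; apply: noend; exists r, G.
have [G_ itG_] := choice all_r.
by exists G_ => //; exact: iterate_cvg.
Qed.

End iteration.

Unset Implicit Arguments.
Set Strict Implicit.

Theorem corollary5p14 (R : realType) (m n : nat) (hm : (1 <= m)%N)
    (hn : (1 <= n)%N) :
  exists eta_low : set 'M[R]_(n * m) -> R -> R -> R -> R -> R,
  forall (M G0 : 'M[R]_(n * m)) (etabar gamma c : R),
    spd M -> kronecker_family G0 ->
    0 < etabar -> 0 < gamma < 1 -> 0 < c < 1 ->
    let f := objective M in
    let Q0 := sublevel_kronecker M G0 in
    let it := iterate M G0 etabar gamma c in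
    let P := proj_kronecker M in
    (exists L0, grad_lipschitz_near (@kronecker_family R m n) Q0 f L0) /\
    forall L0, grad_lipschitz_near (@kronecker_family R m n) Q0 f L0 ->
      let eta := eta_low Q0 L0 etabar gamma c in
      [/\ forall r G, it r G -> direction M G <> 0 ->
            exists! eta_r, step_size M etabar gamma c G eta_r,
          forall r G, it r G -> kronecker_family G,
          (exists2 r, it r P & direction M P = 0) \/
          (exists2 G_ : nat -> 'M[R]_(n * m),
             forall r, it r (G_ r) & G_ r @[r --> \oo] --> P),
          0 < eta <= (2 * c)^-1 &
          forall r G, it r G ->
            f G - f P <= (1 - 2 * c * eta) ^+ r * (f G0 - f P)].
Proof.
exists (@step_bound R m n) => M G0 etabar gamma c pM KG0 etabar0 gamma01 c01.
move=> f Q0 it P; split; first exact: grad_lipschitz_exists.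
move=> L0 hL0 eta.
have QG r G : it r G -> Q0 G by exact: iterate_Q0.
split.
- move=> r G /QG QG' _.
  have [e st] := step_size_exists hm hn pM etabar0 gamma01 c01 hL0 QG'.
  by exists e; split=> // e' st'; exact: step_size_unique st st'.
- by move=> r G /QG[].
- exact: (iterate_dichotomy hm hn pM KG0 etabar0 gamma01 c01 hL0).
- by apply/andP; split; [exact: eta_gt0|exact: eta_le].
- exact: iterate_rate.
Qed.
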